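(* For each fixed $d \in \mathbb{N}$ we have the asymptotic expansion $$L_N^d \sim \sum_{g=1}^\infty N^{2-2g}\, \vec{H}_g^d \qquad \text{as } N \to \infty,$$ where, for each integer $g \ge 1$, $\vec{H}_g^d$ is the number of $(r+2)$-tuples $(\pi_1,\pi_2,\tau_1,\dots,\tau_r)$ of permutations from the symmetric group $\mathrm{S}^d=\mathrm{Aut}\{1,\dots,d\}$ such that: (1) the product $\pi_1\pi_2\pi_1^{-1}\pi_2^{-1}\tau_1\cdots\tau_r$ equals the identity $\iota \in \mathrm{S}^d$; (2) the group generated by $\pi_1,\pi_2,\tau_1,\dots,\tau_r$ acts transitively on $\{1,\dots,d\}$; (3) the permutations $\tau_1,\dots,\tau_r$ are transpositions; (4) $r=2g-2$; (5) writing $\tau_i=(k_i\ l_i)$ with $1\le k_i<l_i\le d$, we have $l_1\le \dots \le l_r$.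
   Context: For $N\in\mathbb{N}=\{1,2,\dots\}$, let $\mathrm{U}_N$ be the group of $N\times N$ complex unitary matrices with unit mass Haar measure, and let $\mathrm{d}(U,V)$ denote the product Haar probability measure on $\mathrm{U}_N\times\mathrm{U}_N$. Define the entire function $$K_N(q)=\int_{\mathrm{U}_N\times\mathrm{U}_N} e^{qN\,\mathrm{Tr}\,UVU^*V^*}\,\mathrm{d}(U,V),\qquad q\in\mathbb{C},$$ so $K_N(0)=1$. Its principal logarithm $L_N(q)=\log K_N(q)$ is analytic in a neighborhood of $q=0$ with $L_N(0)=0$, and the numbers $L_N^d$ are defined by its Maclaurin expansion $$L_N(q)=\sum_{d=1}^\infty \frac{q^d}{d!}L_N^d.$$ The notation $a_N\sim\sum_{g=1}^\infty N^{2-2g}c_g$ as $N\to\infty$ (asymptotic expansion) means that for every integer $h\ge 1$, $a_N=\sum_{g=1}^{h}N^{2-2g}c_g+o(N^{2-2h})$ as $N\to\infty$. *)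

(* Defs.v *)
From HB Require Import structures.
From mathcomp Require Import all_boot all_order all_algebra all_fingroup.
From mathcomp Require Import complex.
From mathcomp Require Import all_classical all_reals all_analysis.

Set Implicit Arguments.
Unset Strict Implicit.
Unset Printing Implicit Defensive.

Import Order.TTheory GRing.Theory Num.Theory numFieldNormedType.Exports.

Section MonotoneHurwitz.
Local Open Scope group_scope.
Variables (d r : nat).
Implicit Types (tau : {ffun 'I_r -> {perm 'I_d}}).

(* The library composes permutations from left to right.  The count below does
   not depend on this: passing to the opposite group amounts to replacing
   pi1, pi2 by their inverses in the product relation. *)
Definition product_one (pi1 pi2 : {perm 'I_d}) tau : bool :=
  pi1 * pi2 * pi1^-1 * pi2^-1 * \prod_(i < r) tau i == 1.

Definition generates_transitive (pi1 pi2 : {perm 'I_d}) tau : bool :=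
  [transitive <<[set pi1; pi2] :|: [set tau i | i : 'I_r]>>,
    on [set: 'I_d] | 'P].

Definition monotone_transpositions tau : bool :=
  [exists k : {ffun 'I_r -> 'I_d}, exists l : {ffun 'I_r -> 'I_d},
    [forall i, (k i < l i)%N && (tau i == tperm (k i) (l i))] &&
    [forall i : 'I_r, forall j : 'I_r, (i <= j)%N ==> (l i <= l j)%N]].

Definition monotone_factorizations :
    {set {perm 'I_d} * {perm 'I_d} * {ffun 'I_r -> {perm 'I_d}}} :=
  [set t | [&& product_one t.1.1 t.1.2 t.2,
               generates_transitive t.1.1 t.1.2 t.2
             & monotone_transpositions t.2]].

End MonotoneHurwitz.

(* Natural subtraction is harmless here, as only g >= 1 is used. *)
Definition monotone_hurwitz (g d : nat) : nat :=
  #|monotone_factorizations d (2 * g - 2)|.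

Local Open Scope classical_set_scope.
Local Open Scope ring_scope.
Local Open Scope complex_scope.

(* The explicit numClosedFieldType makes the library's topological and normed
   structures on numeric fields apply to R[i], and so to matrices over it. *)
Definition CC (R : realType) : numClosedFieldType := R[i].

Section ComplexFunctions.
Variable R : realType.

Definition cexp (z : CC R) : CC R :=
  (expR (complex.Re z) * cos (complex.Im z)) +i*
  (expR (complex.Re z) * sin (complex.Im z)).

(* The principal argument of z <> 0, in ]-pi, pi]. *)
Definition carg (z : CC R) : R :=
  let t := acos (complex.Re z / complex.Re `|z|) in
  if 0 <= complex.Im z then t else - t.

Definition clog (z : CC R) : CC R := ln (complex.Re `|z|) +i* carg z.

Definition cintegral d (T : measurableType d) (mu : {measure set T -> \bar R})
    (f : T -> CC R) : CC R :=
  (\int[mu]_x complex.Re (f x)) +i* (\int[mu]_x complex.Im (f x)).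

Definition is_maclaurin (f : CC R -> CC R) (c : nat -> CC R) : Prop :=
  \forall q \near (0 : CC R),
    series (fun d => q ^+ d / d`!%:R * c d) @ \oo --> f q.

(* Equal to 0 if f has no convergent expansion; there is at most one. *)
Definition maclaurin_coef (f : CC R -> CC R) : nat -> CC R :=
  xget (fun=> 0) [set c | is_maclaurin f c].

(* a_N ~ \sum_(g >= 1) N^(2-2g) c_g as N tends to infinity *)
Definition genus_expansion (a c : nat -> CC R) : Prop :=
  forall h : nat, (0 < h)%N ->
    (fun N : nat => a N - \sum_(1 <= g < h.+1) N%:R ^ (2 - 2 * g%:Z) * c g)
      =o_\oo (fun N : nat => N%:R ^ (2 - 2 * h%:Z) : CC R).

End ComplexFunctions.

Section UnitaryGroup.
Variables (R : realType) (N : nat).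

Definition unitary_mx := {U : 'M[CC R]_N | U \is unitarymx}.

Lemma unitary_mx1 : (1%:M : 'M[CC R]_N) \is unitarymx.
Proof. by apply/unitarymxP; rewrite trmx1 map_mx1 mulmx1. Qed.

HB.instance Definition _ := Choice.on unitary_mx.
HB.instance Definition _ :=
  isPointed.Build unitary_mx (exist _ 1%:M unitary_mx1).

Definition unitary_open : set (set unitary_mx) :=
  [set (fun U : unitary_mx => val U) @^-1` O | O in @open 'M[CC R]_N].

(* U_N with the Borel sigma-algebra of its subspace topology *)
Definition unitary := g_sigma_algebraType unitary_open.

Definition unitary_val (U : unitary) : 'M[CC R]_N := sval U.

Definition unitary_mul (U V : unitary) : unitary :=
  exist _ (sval U *m sval V) (mul_unitarymx (svalP U) (svalP V)).

(* The left-invariant Borel probability measure on U_N exists and is unique. *)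
Definition is_haar (mu : probability unitary R) : Prop :=
  forall (U : unitary) (A : set unitary), measurable A ->
    mu (unitary_mul U @` A) = mu A.

End UnitaryGroup.

Coercion unitary_val : unitary >-> matrix.

Section PartitionFunction.
Local Open Scope sesquilinear_scope.
Variable R : realType.
Variables (N : nat) (mu : probability (unitary R N) R).

Definition KN (q : CC R) : CC R :=
  cintegral (mu \x mu)%E (fun UV : unitary R N * unitary R N =>
    let U : 'M[CC R]_N := UV.1 in let V : 'M[CC R]_N := UV.2 in
    cexp (q * N%:R * \tr (U *m V *m U ^t* *m V ^t*))).

Definition LN (q : CC R) : CC R := clog (KN q).

Definition LN_coef (d : nat) : CC R := maclaurin_coef LN d.

End PartitionFunction.

(* Main.v *)
Require Import Defs.
From HB Require Import structures.
From mathcomp Require Import all_boot all_order all_algebra all_fingroup.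
From mathcomp Require Import complex.
From mathcomp Require Import all_classical all_reals all_analysis.
From mathcomp Require Import ring lra zify.
Set Implicit Arguments.
Unset Strict Implicit.
Unset Printing Implicit Defensive.
Import Order.TTheory GRing.Theory Num.Theory numFieldNormedType.Exports.
Local Open Scope ring_scope.

(** Write X = Tr U V U^-1 V^-1 and m_n = N^n E X^n. Expanding the exponential,
    K_N is the exponential generating function of the moments m_n, so that the
    Taylor coefficients of log K_N at 0 are the cumulants of the sequence m. The
    theorem therefore splits into an expansion of the moments in powers of 1/N
    and a combinatorial passage from moments to cumulants.

    Moments. Expanding X^n in tensor entries reduces m_n to integrals of
    products of entries of U and their conjugates. By invariance of Haar measure
    these integrals, as functions of two of their multi-indices, commute with
    all tensor powers of unitary matrices, hence are combinations of the
    operators which permute tensor factors (commutes_comb). Their coefficients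
    solve a linear system with the matrix gram (s^-1 t), where gram s =
    N^(c(s) - n) and c(s) is the number of cycles of s; with w the inverse of
    gram for convolution on S_n this gives weingarten_formula, and inserting it
    twice collapses to m_n = sum over s, t of w (s t s^-1 t^-1)
    (commutator_moment).

    The function gram factors as the product of the 1 + J_k / N, where J_k =
    (0 k) + ... + (k-1 k) are the Jucys-Murphy elements (jucys_prodS). Inverting
    the factors one by one, w is the sum of (-1/N)^r h_r (J), and the complete
    symmetric function h_r (J) at s counts the words of r transpositions of
    weakly increasing heights whose product is s (conv_gram_hseries,
    weingarten_hseries). So m_n expands in powers of -1/N, with coefficient of
    order r the number of tuples (p, q, monotone word of length r) with
    p q p^-1 q^-1 times the word equal to 1, without transitivity
    (trace_moment_expansion).

    Cumulants. Fix a point a. Such a tuple on a set A of points preserves the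
    orbit B of a; restricting it to B and to the complement of B gives a
    transitive tuple and an arbitrary one. Nothing is lost: letters inside and
    outside B have different heights, so the weakly increasing order determines
    how the two words are interleaved (height_sorted_inj). The resulting
    recursion (card_factorizations) is the recursion which defines cumulants
    from moments (cumulant_sets); therefore the cumulants expand with the
    transitive counts as coefficients (connected_expansion). A commutator is an
    even permutation, so only even r = 2g - 2 contribute, and the powers
    (-1/N)^r become N^(2 - 2g).

    Analysis. That the coefficients of the logarithm are the cumulants is proved
    by comparing the Taylor polynomials P and Q of K_N and of the cumulant
    series: the derivative of P exp (-Q) is small since P' - Q' P vanishes to
    high order at 0 (exp_ode_bound, cumulant_series_log), and coefficients of a
    convergent power series are unique (maclaurin_uniq). *)

(** * Counting monotone words of transpositions *)

Section MonotoneCounts.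
Variable n : nat.
Implicit Types (s : {perm 'I_n}) (l : seq ('I_n * 'I_n)).

(** The letter (k, l) stands for the transposition exchanging k < l, and l is
    called its height. *)
Fixpoint monotone_word (m : nat) l : bool :=
  if l is p :: l' then [&& (p.1 < p.2)%N, (m <= p.2)%N & monotone_word p.2 l']
  else true.

Definition tprod l : {perm 'I_n} := (\prod_(p <- l) tperm p.1 p.2)%g.

(** As a function of s, the complete homogeneous symmetric function of degree r
    in the Jucys-Murphy elements of index at least m. *)
Definition nmono (m r : nat) s : nat :=
  \sum_(l : r.-tuple ('I_n * 'I_n)) (monotone_word m l && (tprod l == s)).

Lemma big_tuple_cons (U : finType) r (F : r.+1.-tuple U -> nat) :
  (\sum_l F l = \sum_(p : U) \sum_(l : r.-tuple U) F [tuple of p :: l])%N.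
Proof.
rewrite pair_big /=.
rewrite (reindex (fun pl : U * r.-tuple U => [tuple of pl.1 :: pl.2])) //=.
exists (fun l : r.+1.-tuple U => (thead l, [tuple of behead l])).
- by move=> [p l] _; rewrite /= theadE; congr (_, _); apply: val_inj.
- by move=> l _; rewrite [RHS]tuple_eta.
Qed.

Lemma nmono0 m s : nmono m 0 s = (s == 1%g).
Proof.
rewrite /nmono (big_pred1 [tuple]) => [|l]; last by rewrite [l]tuple0 /= eqxx.
by rewrite /= /tprod big_nil eq_sym.
Qed.

Lemma nmonoS_sum m r s : (nmono m r.+1 s =
  \sum_(p : 'I_n * 'I_n | (p.1 < p.2) && (m <= p.2))
     nmono p.2 r (tperm p.1 p.2 * s)%g)%N.
Proof.
rewrite /nmono big_tuple_cons [RHS]big_mkcond; apply: eq_bigr => p _ /=.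
case: ifP => [/andP[-> ->]|pN]; last first.
  by apply: big1 => l _; rewrite andbA pN.
apply: eq_bigr => l _ /=; rewrite /tprod big_cons; congr (nat_of_bool (_ && _)).
by apply/eqP/eqP => [<-|->]; rewrite mulgA tperm2 mul1g.
Qed.

(** Either no letter has height m, or the first one does; this is h_r (J_m,
    J_(m+1), ...) = h_r (J_(m+1), ...) + J_m h_(r-1) (J_m, J_(m+1), ...). *)
Lemma nmonoS (m : 'I_n) r s : (nmono m r.+1 s =
  nmono m.+1 r.+1 s + \sum_(k : 'I_n | k < m) nmono m r (tperm k m * s)%g)%N.
Proof.
rewrite !nmonoS_sum (bigID (fun p : 'I_n * 'I_n => p.2 == m)) /= addnC.
congr (_ + _)%N.
- apply: eq_bigl => p; rewrite -val_eqE /=; lia.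
- rewrite -(pair_big_dep xpredT (fun k j : 'I_n => (k < j) && (m <= j) && (j == m))%N
    (fun k j : 'I_n => nmono j r (tperm k j * s)%g)) /= [RHS]big_mkcond.
  apply: eq_bigr => k _; case: ifP => km.
    rewrite (big_pred1 m) // => j /=.
    by case: eqP => [->|]; rewrite ?andbF // km leqnn.
  rewrite big_pred0 // => j; apply/negP => /andP[/andP[kj _] /eqP jm].
  by rewrite -jm kj in km.
Qed.

Lemma nmono_max r s : nmono n r.+1 s = 0%N.
Proof.
rewrite nmonoS_sum big_pred0 // => p.
by rewrite [(n <= _)%N]leqNgt ltn_ord andbF.
Qed.

End MonotoneCounts.

(** * The Jucys factorization of the Gram function *)

Section JucysMurphy.
Variables (C : numFieldType) (n : nat).
Implicit Types (s t : {perm 'I_n}) (f h : {perm 'I_n} -> C) (x : C).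

Definition convol f h s := \sum_t f t * h (t^-1 * s)%g.

(** Left multiplication by the Jucys-Murphy element J_m in the group algebra,
    the sum of the transpositions (k m) with k < m. *)
Definition jucys_murphy (m : 'I_n) f s :=
  \sum_(k : 'I_n | (k < m)%N) f (tperm k m * s)%g.

Lemma conv_jucys_murphy m f h s :
  convol (jucys_murphy m f) h s = jucys_murphy m (convol f h) s.
Proof.
rewrite /convol /jucys_murphy.
under eq_bigr do rewrite big_distrl /=.
rewrite exchange_big /=; apply: eq_bigr => k _.
rewrite (reindex_inj (mulgI (tperm k m))) /=; apply: eq_bigr => t _.
by rewrite mulgA tperm2 mul1g invMg tpermV mulgA.
Qed.

(** The truncation at order R of the product of the (1 + x J_k)^-1 over k >= m. *)
Definition hseries x (R m : nat) s : C :=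
  \sum_(r < R) (- x) ^+ r * (nmono m r s)%:R.

Lemma hseries_max x R s : hseries x R.+1 n s = (s == 1%g)%:R.
Proof.
rewrite /hseries big_ord_recl /= expr0 mul1r nmono0 big1 ?addr0 // => r _.
by rewrite nmono_max mulr0.
Qed.

(** Multiplication by 1 + x J_m removes the factor of index m, up to the term of
    order R pushed beyond the truncation. *)
Lemma hseries_step x R (m : 'I_n) s :
  hseries x R.+1 m s + x * jucys_murphy m (hseries x R.+1 m) s =
  hseries x R.+1 m.+1 s
   + x * (- x) ^+ R * jucys_murphy m (fun t => (nmono m R t)%:R) s.
Proof.
have jV : jucys_murphy m (hseries x R.+1 m) s =
    jucys_murphy m (hseries x R m) s
    + (- x) ^+ R * jucys_murphy m (fun t => (nmono m R t)%:R) s.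
  rewrite /jucys_murphy mulr_sumr -big_split /=; apply: eq_bigr => k _.
  by rewrite /hseries big_ord_recr.
have -> : hseries x R.+1 m s =
    hseries x R.+1 m.+1 s - x * jucys_murphy m (hseries x R m) s.
  rewrite /hseries !big_ord_recl /= !nmono0 -addrA; congr (_ + _).
  rewrite /jucys_murphy exchange_big /= mulr_sumr -sumrB; apply: eq_bigr => r _.
  rewrite /bump /= add1n nmonoS natrD (natr_sum _ _ _ (fun k => nmono _ _ _)) mulrDr.
  by rewrite -mulr_sumr exprS; ring.
by rewrite jV; ring.
Qed.

(** Multi-indices constant on the cycles of s: there are N^(c(s)) of them, with
    c(s) the number of cycles. *)
Definition nfix (N : nat) s : nat :=
  #|[set I : {ffun 'I_n -> 'I_N} | [forall i, I (s i) == I i]]|.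

Definition gram (N : nat) s : C := (nfix N s)%:R / N%:R ^+ n.

Lemma nfixP N s (I : {ffun 'I_n -> 'I_N}) :
  reflect (forall i, I (s i) = I i) [forall i, I (s i) == I i].
Proof. exact: 'forall_eqP. Qed.

Lemma nfix1 N : nfix N 1 = (N ^ n)%N.
Proof.
rewrite /nfix -[RHS]/(N ^ n)%N -[in RHS](card_ord n) -[in RHS](card_ord N).
rewrite -card_ffun -cardsT; apply: eq_card => I; rewrite !inE.
by apply/nfixP => i; rewrite perm1.
Qed.

(** The product exchanges k and m first and then applies s, so it fixes m and
    short-circuits k to s m. A multi-index invariant under it is one invariant
    under s, except that the value at m is now free. *)
Lemma nfix_tperm N s (k m : 'I_n) : k != m -> s k = m ->
  (nfix N (tperm k m * s) = N * nfix N s)%N.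
Proof.
move=> km skm.
pose upd (aI : 'I_N * {ffun 'I_n -> 'I_N}) :=
  [ffun i => if i == m then aI.1 else aI.2 i].
have fixk (I : {ffun 'I_n -> 'I_N}) : (forall i, I (s i) = I i) -> I m = I k.
  by move=> Is; rewrite -skm Is.
pose X := finset.setX [set: 'I_N]
  [set I : {ffun 'I_n -> 'I_N} | [forall i, I (s i) == I i]].
have -> : (N * nfix N s = #|X|)%N by rewrite cardsX cardsT card_ord.
rewrite /nfix; have <- : #|upd @: X| = #|X|.
  apply: card_in_imset => -[a I] [b J].
  rewrite !inE /= => /nfixP Is /nfixP Js /ffunP E.
  have := E m; rewrite !ffunE eqxx /= => ->; congr pair; apply/ffunP => i.
  have [->|im] := eqVneq i m; last by have := E i; rewrite !ffunE (negPf im).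
  by rewrite (fixk I) // (fixk J) //; have := E k; rewrite !ffunE (negPf km).
apply: eq_card => I; rewrite inE; apply/nfixP/imsetP => [Is|[[a J]]].
  exists (I m, [ffun i => if i == m then I k else I i]); last first.
    by apply/ffunP => i; rewrite !ffunE /=; case: eqP => // ->.
  rewrite !inE /=; apply/nfixP => i; rewrite !ffunE.
  have [->|im] := eqVneq i m.
    have := Is k; rewrite permM tpermL => ->.
    by case: ifP.
  have [->|ik] := eqVneq i k; first by rewrite skm eqxx.
  have := Is i; rewrite permM tpermD 1?eq_sym // => ->.
  by case: eqP => // sim; case/eqP: ik; apply: (@perm_inj _ s); rewrite skm.
rewrite !inE /= => /nfixP Js -> i; rewrite !ffunE /= permM.
have [->|im] := eqVneq i m; first by rewrite tpermR skm eqxx.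
have sne : s (tperm k m i) != m.
  rewrite -[X in _ != X]skm (inj_eq perm_inj); apply: contra_neq im => tk.
  by rewrite -(tpermK k m i) tk tpermL.
rewrite (negPf sne) Js; case: tpermP => [->|im'|//]; first exact: fixk.
by rewrite im' eqxx in im.
Qed.

Lemma gram1 N : (0 < N)%N -> gram N 1 = 1.
Proof.
move=> N_gt0; rewrite /gram nfix1 natrX divff // expf_neq0 //.
by rewrite pnatr_eq0 -lt0n.
Qed.

Lemma gram_tperm N s (k m : 'I_n) : (0 < N)%N -> k != m -> s k = m ->
  gram N s = N%:R^-1 * gram N (tperm k m * s).
Proof.
move=> N_gt0 km skm; rewrite /gram nfix_tperm // natrM mulrA mulrA mulVf ?mul1r //.
by rewrite pnatr_eq0 -lt0n.
Qed.

Definition supp_below (m : nat) s := [forall i : 'I_n, (m <= i)%N ==> (s i == i)].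

Lemma supp_belowP m s :
  reflect (forall i : 'I_n, (m <= i)%N -> s i = i) (supp_below m s).
Proof.
apply: (iffP forallP) => H i; first by move=> mi; apply/eqP/(implyP (H i)).
by apply/implyP => /H/eqP.
Qed.

(** The claim of the factorization: this is the product of the 1 + J_k / N over
    k < m. *)
Definition jucys_prod N (m : nat) s : C := (supp_below m s)%:R * gram N s.

Lemma jucys_prod0 N s : (0 < N)%N -> jucys_prod N 0 s = (s == 1%g)%:R.
Proof.
move=> N_gt0; rewrite /jucys_prod; have [->|s1] := eqVneq s 1%g.
  by rewrite gram1 // mulr1; case: supp_belowP => // -[] i _; rewrite perm1.
case: supp_belowP => [s0|]; last by rewrite mul0r.
by case/eqP: s1; apply/permP => i; rewrite perm1 s0.
Qed.

Lemma jucys_prod_max N s : jucys_prod N n s = gram N s.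
Proof.
rewrite /jucys_prod; case: supp_belowP => [_|[]]; first by rewrite mul1r.
by move=> i; rewrite leqNgt ltn_ord.
Qed.

(** A permutation s supported on the points up to m either fixes m, and then
    only the term 1 of the factor 1 + J_m / N contributes, or is obtained from a
    permutation fixing m by a unique transposition (k m), with s k = m, which
    costs one cycle, that is a factor 1/N. *)
Lemma jucys_prodS N (m : 'I_n) s : (0 < N)%N ->
  jucys_prod N m.+1 s =
  jucys_prod N m s + N%:R^-1 * jucys_murphy m (jucys_prod N m) s.
Proof.
move=> N_gt0; rewrite /jucys_murphy /jucys_prod.
have [smm|smm] := eqVneq (s m) m.
  rewrite big1 => [|k km]; last first.
    case: supp_belowP => [/(_ m (leqnn m))|]; last by rewrite mul0r.
    rewrite permM tpermR => sk.
    have /perm_inj km' : s k = s m by rewrite sk.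
    by rewrite km' ltnn in km.
  rewrite mulr0 addr0; congr ((nat_of_bool _)%:R * _).
  apply/supp_belowP/supp_belowP => H i mi; last by apply: H; exact: ltnW.
  have [->//|im] := eqVneq i m; apply: H.
  by rewrite ltn_neqAle mi eq_sym andbT; apply: contra_neq im => /val_inj.
rewrite [supp_below m s](_ : _ = false) ?mul0r ?add0r; last first.
  by apply/supp_belowP => /(_ m (leqnn m)) /eqP; rewrite (negPf smm).
have [sm|sN] := supp_belowP; last first.
  rewrite mul0r big1 ?mulr0 // => k km.
  case: supp_belowP => [H|]; last by rewrite mul0r.
  case: sN => i mi; have := H i (ltnW mi).
  rewrite permM tpermD // -val_eqE neq_ltn ?mi //.
  by rewrite (ltn_trans km mi).
set k := (s^-1 m)%g; have skm : s k = m by rewrite /k permKV.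
have km : k != m by apply: contra_neq smm => {1}<-.
have k_lt : (k < m)%N.
  rewrite ltnNge; apply/negP => mk.
  have mk' : (m < k)%N.
    by rewrite ltn_neqAle mk andbT; apply: contra_neq km => /val_inj.
  by move: km; rewrite -(sm k mk') skm eqxx.
(* any other transposition leaves m displaced *)
rewrite mul1r (bigD1 k) //= big1 => [|j /andP[jm jk]]; last first.
  case: supp_belowP => [/(_ m (leqnn m))|]; last by rewrite mul0r.
  rewrite permM tpermR => sj.
  have /perm_inj E : s j = s k by rewrite sj.
  by rewrite E eqxx in jk.
rewrite addr0 (gram_tperm N_gt0 km skm) (_ : supp_below _ _ = true) ?mul1r //.
apply/supp_belowP => i mi; rewrite permM.
have [->|im] := eqVneq i m; first by rewrite tpermR.
have mi' : (m < i)%N.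
  by rewrite ltn_neqAle mi eq_sym andbT; apply: contra_neq im => /val_inj.
by rewrite tpermD ?sm // -val_eqE neq_ltn ?mi' // (ltn_trans k_lt mi').
Qed.

(** The factors of gram are cancelled in the order of increasing index by those
    of the truncated inverse: after m steps the product of the first m factors
    with the whole series is the series in the remaining ones, up to one more
    term of order R + 1 at each step. *)
Lemma conv_gram_hseries R : exists2 c : C, 0 <= c &
  forall (N : nat) s, (0 < N)%N ->
  `|convol (gram N) (hseries N%:R^-1 R.+1 0) s - (s == 1%g)%:R|
     <= c * N%:R^-1 ^+ R.+1.
Proof.
suff H m : (m <= n)%N -> exists2 c : C, 0 <= c & forall (N : nat) s, (0 < N)%N ->
  `|convol (jucys_prod N m) (hseries N%:R^-1 R.+1 0) s - hseries N%:R^-1 R.+1 m s|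
     <= c * N%:R^-1 ^+ R.+1.
  have [c c0 Hc] := H n (leqnn n); exists c => // N s N_gt0.
  rewrite -(hseries_max N%:R^-1 R); apply: le_trans (Hc N s N_gt0).
  by rewrite /convol; under [in leRHS]eq_bigr do rewrite jucys_prod_max.
elim: m => [_|m IHm mn].
  exists 0 => // N s N_gt0; rewrite /convol (bigD1 1%g) //= jucys_prod0 // eqxx.
  rewrite mul1r invg1 mul1g big1 ?addr0 ?subrr ?normr0 ?mul0r // => t t1.
  by rewrite jucys_prod0 // (negPf t1) mul0r.
have [c c0 Hc] := IHm (ltnW mn); pose m' := Ordinal mn.
pose b : C := \sum_(s : {perm 'I_n}) (nmono m R s)%:R.
have b0 : 0 <= b by apply: sumr_ge0 => s _; exact: ler0n.
(* multiplication by 1 + J_m / N enlarges the previous error at most 1 + n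
   times, and the truncation contributes one term bounded by n b *)
exists (c + n%:R * c + n%:R * b) => [|N s N_gt0].
  by rewrite !addr_ge0 // mulr_ge0 // ler0n.
set x := N%:R^-1; have x0 : 0 <= x by rewrite invr_ge0 ler0n.
have x1 : x <= 1 by rewrite invf_le1 ?ltr0n // ler1n.
pose D s := convol (jucys_prod N m) (hseries x R.+1 0) s - hseries x R.+1 m s.
have -> : convol (jucys_prod N m.+1) (hseries x R.+1 0) s - hseries x R.+1 m.+1 s =
   D s + x * jucys_murphy m' D s
   + x * (- x) ^+ R * jucys_murphy m' (fun t => (nmono m R t)%:R) s.
  have -> : convol (jucys_prod N m.+1) (hseries x R.+1 0) s =
     convol (jucys_prod N m) (hseries x R.+1 0) s
     + x * jucys_murphy m' (convol (jucys_prod N m) (hseries x R.+1 0)) s.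
    rewrite -conv_jucys_murphy /convol mulr_sumr -big_split /=.
    by apply: eq_bigr => t _; rewrite (@jucys_prodS N m') // mulrDl mulrA.
  have -> : jucys_murphy m' D s =
     jucys_murphy m' (convol (jucys_prod N m) (hseries x R.+1 0)) s
      - jucys_murphy m' (hseries x R.+1 m) s by rewrite /jucys_murphy -sumrB.
  have := @hseries_step x R m' s => /= E.
  rewrite /D mulrBr.
  transitivity (convol (jucys_prod N m) (hseries x R.+1 0) s
    + x * jucys_murphy m' (convol (jucys_prod N m) (hseries x R.+1 0)) s
    - (hseries x R.+1 m s + x * jucys_murphy m' (hseries x R.+1 m) s)
    + x * (- x) ^+ R * jucys_murphy m' (fun t => (nmono m R t)%:R) s).
    by rewrite E; ring.
  by ring.
have jbound f (B : C) : 0 <= B -> (forall t, `|f t| <= B) -> `|jucys_murphy m' f s| <= n%:R * B.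
  move=> B0 fB; rewrite /jucys_murphy big_mkcond.
  apply: le_trans (ler_norm_sum _ _ _) _.
  rewrite -[n in leRHS]card_ord -sum1_card natr_sum mulr_suml.
  by apply: ler_sum => k _; rewrite mul1r; case: ifP; rewrite ?normr0.
have cx0 : 0 <= c * x ^+ R.+1 by rewrite mulr_ge0 // exprn_ge0.
rewrite !mulrDl; apply: le_trans (ler_normD _ _) _; apply: lerD.
  apply: le_trans (ler_normD _ _) _; apply: lerD; first exact: Hc.
  rewrite normrM -[leRHS]mul1r; apply: ler_pM => //; first by rewrite ger0_norm.
  by rewrite -mulrA; apply: jbound => // t; exact: Hc.
rewrite normrM mulrC; apply: ler_pM => //.
  apply: jbound => // t; rewrite ger0_norm ?ler0n // /b (bigD1 t) //=.
  by rewrite lerDl; apply: sumr_ge0 => u _; exact: ler0n.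
by rewrite exprS normrM normrX normrN ger0_norm.
Qed.

End JucysMurphy.

(** * Inverting the Gram function *)

Section GroupConvolution.
Variables (C : numFieldType) (n : nat).
Implicit Types (f g h : {perm 'I_n} -> C) (s t : {perm 'I_n}).

Definition dirac1 s : C := (s == 1%g)%:R.

Definition l1norm f : C := \sum_s `|f s|.

Lemma convA f g h s : convol (convol f g) h s = convol f (convol g h) s.
Proof.
rewrite /convol; under eq_bigr do rewrite mulr_suml.
rewrite exchange_big /=; apply: eq_bigr => t _.
rewrite mulr_sumr (reindex_inj (mulgI t)) /=; apply: eq_bigr => u _.
by rewrite mulKg invMg mulgA mulrA.
Qed.

Lemma conv_dirac1 f s : convol f dirac1 s = f s.
Proof.
rewrite /convol (bigD1 s) //= /dirac1 mulVg eqxx mulr1 big1 ?addr0 // => t ts.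
by rewrite -eq_invg_mul invgK (negPf ts) mulr0.
Qed.

Lemma dirac1_conv f s : convol dirac1 f s = f s.
Proof.
rewrite /convol (bigD1 1%g) //= /dirac1 eqxx mul1r invg1 mul1g big1 ?addr0 //.
by move=> t /negPf ->; rewrite mul0r.
Qed.

Lemma l1norm_ge0 f : 0 <= l1norm f.
Proof. exact: sumr_ge0. Qed.

Lemma conv_bound f h (B : C) s :
  (forall t, `|h t| <= B) -> `|convol f h s| <= l1norm f * B.
Proof.
move=> hB; apply: le_trans (ler_norm_sum _ _ _) _.
by rewrite mulr_suml; apply: ler_sum => t _; rewrite normrM ler_wpM2l.
Qed.

Lemma l1norm_bound h (B : C) :
  (forall t, `|h t| <= B) -> l1norm h <= #|{perm 'I_n}|%:R * B.
Proof.
move=> hB; rewrite -sum1_card natr_sum mulr_suml.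
by apply: ler_sum => t _; rewrite mul1r.
Qed.

Lemma l1norm_dirac1 : l1norm dirac1 = 1.
Proof.
rewrite /l1norm (bigD1 1%g) //= /dirac1 eqxx normr1 big1 ?addr0 //.
by move=> t /negPf ->; rewrite normr0.
Qed.

(** Convolution by g is a small perturbation of the identity, as w = w g - w (g
    - 1); the smallness of g - 1 absorbs the last term into the left-hand side. *)
Lemma conv_inj_bound (g w : {perm 'I_n} -> C) (B : C) :
  (forall s, `|g s - dirac1 s| <= B) ->
  #|{perm 'I_n}|%:R * B <= 2^-1 ->
  l1norm w <= 2 * l1norm (convol w g).
Proof.
move=> gB B2; set v := convol w g.
pose e s := g s - dirac1 s.
have wE s : w s = v s - convol w e s.
  by rewrite -[w s]conv_dirac1 /v /convol -sumrB; apply: eq_bigr => t _; rewrite /e; ring.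
have le : l1norm w <= l1norm v + l1norm w * 2^-1.
  apply: (@le_trans _ _ (l1norm v + \sum_s `|convol w e s|)).
    rewrite /l1norm -big_split; apply: ler_sum => s _ /=.
    by rewrite wE; apply: ler_normB.
  rewrite lerD2l; apply: le_trans (l1norm_bound (B := l1norm w * B) _) _.
    by move=> s; apply: conv_bound.
  by rewrite mulrCA ler_wpM2l // l1norm_ge0.
rewrite [X in X <= _]splitr lerD2r ler_pdivrMr // mulrC in le.
exact: le.
Qed.

End GroupConvolution.

Lemma natc_Re (R : realType) (N : nat) : N%:R = (N%:R : R)%:C%C :> CC R.
Proof. by rewrite (rmorph_nat (real_complex R)). Qed.

(** In the partial order of the complex numbers 0 <= c makes c real. *)
Lemma complex_archimedean (R : realType) (c : CC R) :
  0 <= c -> exists N0 : nat, forall N, (N0 <= N)%N -> c <= N%:R.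
Proof.
rewrite lecE => /andP[/eqP Imc Rec].
exists (Num.bound (complex.Re c)) => N bN; rewrite natc_Re lecE /= Imc eqxx /=.
by apply: le_trans (ltW (archi_boundP Rec)) _; rewrite ler_nat.
Qed.

Section Weingarten.
Variables (R : realType) (n : nat).
Local Notation C := (CC R).
Implicit Types (w : {perm 'I_n} -> C).

(** The case of order 0 of the approximate inverse, where the truncated series
    is the unit of the group algebra. *)
Lemma gram_near_dirac1 : exists2 N0 : nat, (0 < N0)%N &
  exists2 B : nat -> C, (forall N (s : {perm 'I_n}), (N0 <= N)%N ->
    `|gram C N s - dirac1 C s| <= B N)
  & forall N, (N0 <= N)%N -> #|{perm 'I_n}|%:R * B N <= 2^-1.
Proof.
have [c c0 Hc] := @conv_gram_hseries C n 0.
have Hc' N (s : {perm 'I_n}) : (0 < N)%N -> `|gram C N s - dirac1 C s| <= c * N%:R^-1.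
  move=> N0; rewrite -[gram C N s]conv_dirac1.
  have := Hc N s N0; rewrite expr1; apply: le_trans.
  rewrite le_eqVlt; apply/orP; left.
  apply/eqP; congr (`|_ - _|); rewrite /convol; apply: eq_bigr => t _.
  by congr (_ * _); rewrite /hseries big_ord1 expr0 mul1r nmono0.
have M0 : 0 <= 2 * (#|{perm 'I_n}|%:R * c) by rewrite !mulr_ge0.
have [N0 HN0] := complex_archimedean M0.
exists N0.+1 => //; exists (fun N => c * N%:R^-1) => [N s NN|N NN].
  by apply: Hc'; exact: leq_trans NN.
have N_gt0 : (0 < N%:R :> C) by rewrite ltr0n; exact: leq_trans NN.
by rewrite mulrA ler_pdivrMr // ler_pdivlMl //; exact/HN0/ltnW.
Qed.

(** Convolution by gram is injective by the perturbation bound, hence bijective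
    since the group algebra is finite-dimensional. *)
Lemma weingarten_exists : exists2 N0 : nat, (0 < N0)%N &
  forall N, (N0 <= N)%N -> exists w, forall s, convol w (gram C N) s = dirac1 C s.
Proof.
have [N0 N0_gt0 [B gB B2]] := gram_near_dirac1; exists N0 => // N NN.
pose G := \matrix_(i < #|{perm 'I_n}|, j < #|{perm 'I_n}|)
  gram C N ((enum_val i)^-1 * enum_val j)%g.
pose row_of w := \row_j w (enum_val j : {perm 'I_n}) : 'rV[C]_#|{perm 'I_n}|.
have mulG w j : (row_of w *m G) 0 j = convol w (gram C N) (enum_val j).
  rewrite !mxE /convol [RHS](reindex_onto enum_val enum_rank) /=; last first.
    by move=> t _; rewrite enum_rankK.
  by apply: eq_big => [i|i _]; rewrite ?enum_valK ?eqxx // !mxE.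
have Gfree : row_free G.
  apply: inj_row_free => v vG.
  pose w s := v 0 (enum_rank s).
  have vE : v = row_of w by apply/rowP => j; rewrite mxE /w enum_valK.
  have w0 : l1norm w <= 0.
    apply: le_trans (conv_inj_bound _ (fun s => gB N s NN) (B2 N NN)) _.
    rewrite [l1norm _]big1 ?mulr0 // => s _.
    by rewrite -[s]enum_rankK -mulG -vE vG mxE normr0.
  rewrite vE; apply/rowP => j; rewrite !mxE; apply/eqP; rewrite -normr_le0.
  apply: le_trans w0; rewrite /l1norm (bigD1 (enum_val j)) //= lerDl.
  exact: sumr_ge0.
have /row_fullP[G' G'G] : row_full G.
  by rewrite row_full_unit -row_free_unit.
exists (fun s => G' (enum_rank 1%g) (enum_rank s)) => s.
rewrite -[s]enum_rankK -mulG.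
have -> : row_of (fun s => G' (enum_rank 1%g) (enum_rank s)) = row (enum_rank 1%g) G'.
  by apply/rowP => j; rewrite !mxE enum_valK.
rewrite -row_mul G'G !mxE enum_rankK /dirac1.
by rewrite (inj_eq enum_rank_inj) eq_sym.
Qed.

(** The truncated series h is an approximate right inverse and w an exact left
    inverse, so that w - h = - w (gram h - 1), and w is bounded uniformly in N. *)
Lemma weingarten_hseries (r : nat) : exists c : C, exists N0 : nat, forall N w s,
  (N0 <= N)%N -> (forall t, convol w (gram C N) t = dirac1 C t) ->
  `|w s - hseries N%:R^-1 r.+1 0 s| <= c * N%:R^-1 ^+ r.+1.
Proof.
have [N0 N0_gt0 [B gB B2]] := gram_near_dirac1.
have [c c0 Hc] := @conv_gram_hseries C n r.
exists (2 * c), N0 => N w s NN wG; have N_gt0 := leq_trans N0_gt0 NN.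
pose h : {perm 'I_n} -> C := hseries N%:R^-1 r.+1 0.
pose e t := convol (gram C N) h t - dirac1 C t.
have -> : w s - h s = - convol w e s.
  have -> : h s = convol w (convol (gram C N) h) s.
    rewrite -convA -[LHS]dirac1_conv; apply: eq_bigr => t _.
    by rewrite wG.
  rewrite -[w s]conv_dirac1 /convol -sumrB -sumrN; apply: eq_bigr => t _.
  by rewrite /e /convol; ring.
rewrite normrN; apply: le_trans (conv_bound _ _ (fun t => Hc N t N_gt0)) _.
rewrite -mulrA ler_wpM2r //.
  by rewrite mulr_ge0 // exprn_ge0 // invr_ge0 ler0n.
apply: le_trans (conv_inj_bound _ (fun s => gB N s NN) (B2 N NN)) _.
rewrite [l1norm _](_ : _ = 1) ?mulr1 // -(l1norm_dirac1 C n).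
by apply: eq_bigr => t _; rewrite wG.
Qed.

End Weingarten.

(** * Splitting a factorization along the orbit of a point *)

Section OrbitDecomposition.
Local Open Scope group_scope.
Variable n : nat.
Local Notation T := 'I_n.
Implicit Types (A B D : {set T}) (p q : {perm T}) (l : seq (T * T)) (a : T).

Definition height_le : rel (T * T) := relpre snd (fun i j : T => (i <= j)%N).

Lemma height_le_trans : transitive height_le.
Proof. by move=> x y z; apply: leq_trans. Qed.

Lemma height_le_total : total height_le.
Proof. by move=> x y; apply: leq_total. Qed.

(** Splitting monotonicity into conditions on single letters and sortedness
    makes it accessible to filtering and sorting. *)
Lemma monotone_wordE m l : monotone_word m l =
  [&& all (fun x : T * T => x.1 < x.2)%N l, all (fun x : T * T => m <= x.2)%N l
    & sorted height_le l].
Proof.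
elim: l m => //= x l IHl m; rewrite IHl (path_sortedE height_le_trans).
have [_|] := boolP (x.1 < x.2)%N; last by [].
have [mx|] := boolP (m <= x.2)%N; last by rewrite !andbF.
have [_|] := boolP (all _ l); last by [].
rewrite /= (eq_all (a2 := height_le x)) //.
have [/allP xl|] := boolP (all (height_le x) l); last by rewrite !andbF.
rewrite (_ : all _ l = true) //; apply/allP => y /xl.
exact: leq_trans.
Qed.

Definition word_on A l := all (fun x => (x.1 \in A) && (x.2 \in A)) l.

(** The transpositions of the word preserve D: no letter joins a point of D to a
    point outside D. *)
Definition respects D l := all (fun x => (x.1 \in D) == (x.2 \in D)) l.

Definition inside B : pred (T * T) := fun x => x.2 \in B.

Lemma tprod_cons x l : tprod (x :: l) = tperm x.1 x.2 * tprod l.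
Proof. by rewrite /tprod big_cons. Qed.

Lemma tprod_on A l : word_on A l -> perm_on A (tprod l).
Proof.
elim: l => [_|x l IHl] /=; first by rewrite /tprod big_nil perm_on1.
case/andP=> /andP[x1 x2] /IHl lA; rewrite tprod_cons; apply: perm_onM => //.
apply/fintype.subsetP => i; rewrite inE; case: tpermP => [->//|->//|_ _].
by rewrite eqxx.
Qed.

Lemma word_on_filter B l : respects B l -> word_on B (seq.filter (inside B) l).
Proof.
move=> /allP lB; apply/allP => x; rewrite mem_filter => /andP[xB /lB/eqP ->].
by rewrite andbb.
Qed.

Lemma word_on_filterC A B l : word_on A l -> respects B l ->
  word_on (A :\: B) (seq.filter (predC (inside B)) l).
Proof.
move=> /allP lA /allP lB; apply/allP => x; rewrite mem_filter /= => /andP[xB xl].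
have /andP[x1 x2] := lA x xl.
by rewrite !inE (eqP (lB x xl)) x1 x2 !andbT andbb.
Qed.

Lemma tprod_split B l : respects B l ->
  tprod l = tprod (seq.filter (inside B) l) * tprod (seq.filter (predC (inside B)) l).
Proof.
elim: l => [_|x l IHl] /=; first by rewrite /tprod !big_nil mulg1.
case/andP=> /eqP xB lB; rewrite tprod_cons (IHl lB).
case: ifP => [_|xNB]; rewrite /= tprod_cons mulgA //.
rewrite [RHS]mulgA; congr (_ * _); apply: (@perm_onC _ (~: B) B).
- apply/fintype.subsetP => i; rewrite inE; case: tpermP => [->|->|_ _].
  + by rewrite inE xB [_ \in _]xNB.
  + by rewrite inE [_ \in _]xNB.
  + by rewrite eqxx.
- exact/tprod_on/word_on_filter.
- by rewrite finset.disjoints_subset.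
Qed.

(** A letter of the first subword and a letter of the second have different
    heights, so the order of the heights dictates the interleaving. *)
Lemma height_sorted_inj B l l' : sorted height_le l -> sorted height_le l' ->
  seq.filter (inside B) l = seq.filter (inside B) l' ->
  seq.filter (predC (inside B)) l = seq.filter (predC (inside B)) l' -> l = l'.
Proof.
elim: l l' => [|x l IHl] [|y l'] //=.
- by move=> _ _; case: ifP.
- by move=> _ _; case: ifP.
rewrite !(path_sortedE height_le_trans) => /andP[/allP xl sl] /andP[/allP yl sl'].
have [xB|xB] := boolP (inside B x); have [yB|yB] := boolP (inside B y) => /=.
- by move=> [-> E1] E2; rewrite (IHl l').
- move=> E1 E2.
  have xl' : x \in seq.filter (inside B) l' by rewrite -E1 mem_head.
  have yl0 : y \in seq.filter (predC (inside B)) l by rewrite E2 mem_head.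
  move: xl' yl0; rewrite !mem_filter => /andP[_ /yl xy] /andP[_ /xl yx].
  have xy2 : x.2 = y.2 by apply: val_inj; apply/eqP; rewrite eqn_leq; apply/andP.
  by move: yB; rewrite /inside -xy2 [_ \in _]xB.
- move=> E1 E2.
  have yl0 : y \in seq.filter (inside B) l by rewrite E1 mem_head.
  have xl' : x \in seq.filter (predC (inside B)) l' by rewrite -E2 mem_head.
  move: xl' yl0; rewrite !mem_filter => /andP[_ /yl xy] /andP[_ /xl yx].
  have xy2 : x.2 = y.2 by apply: val_inj; apply/eqP; rewrite eqn_leq; apply/andP.
  by move: xB; rewrite /inside xy2 [_ \in _]yB.
- by move=> E1 [-> E2]; rewrite (IHl l').
Qed.

Definition triple r : finType := ({perm T} * {perm T} * r.-tuple (T * T))%type.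

Definition commutator_prod p q l := p * q * p^-1 * q^-1 * tprod l.

(** The tuples counted by the coefficients of the moments: those of the theorem
    on the set of points A, without transitivity and with each transposition
    recorded as a letter. *)
Definition factorizations A r : {set triple r} :=
  [set t : triple r | [&& perm_on A t.1.1, perm_on A t.1.2, word_on A t.2,
    monotone_word 0 t.2 & commutator_prod t.1.1 t.1.2 t.2 == 1]].

Definition stable D p q l :=
  [&& [forall i, (p i \in D) == (i \in D)],
      [forall i, (q i \in D) == (i \in D)] & respects D l].

(** B is the orbit of a under the group generated by p, q and the letters of l,
    presented as the smallest invariant set containing a. *)
Definition orbit_of a B p q l :=
  [&& a \in B, stable B p q l &
      [forall D : {set T}, (a \in D) && stable D p q l ==> (B \subset D)]].

Definition connected_factorizations a B r : {set triple r} :=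
  [set t in factorizations B r | orbit_of a B t.1.1 t.1.2 t.2].

Lemma stableP D p q l :
  reflect [/\ forall i, (p i \in D) = (i \in D), forall i, (q i \in D) = (i \in D)
    & respects D l] (stable D p q l).
Proof.
apply: (iffP and3P) => [[/'forall_eqP ? /'forall_eqP ?]|[? ?]]; split=> //;
  exact/'forall_eqP.
Qed.

Lemma orbit_of_uniq a p q l A : perm_on A p -> perm_on A q -> word_on A l ->
  a \in A -> exists B : {set T}, forall B',
    orbit_of a B' p q l && (B' \subset A) = (B' == B).
Proof.
move=> pA qA lA aA.
pose B : {set T} := \bigcap_(D : {set T} | (a \in D) && stable D p q l) D; exists B.
have aB : a \in B by apply/bigcapP => D /andP[].
have sB : stable B p q l.
  apply/stableP; split=> [i|i|].
  - by apply/bigcapP/bigcapP => iB D PD; have /andP[_ /stableP[]] := PD;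
      move=> /(_ i) pD _ _; have := iB D PD; rewrite pD.
  - by apply/bigcapP/bigcapP => iB D PD; have /andP[_ /stableP[]] := PD;
      move=> _ /(_ i) pD _; have := iB D PD; rewrite pD.
  - apply/allP => x xl; apply/eqP.
    by apply/bigcapP/bigcapP => iB D PD; have /andP[_ /stableP[]] := PD;
      move=> _ _ /allP/(_ x xl)/eqP xD; have := iB D PD; rewrite xD.
have minB D : a \in D -> stable D p q l -> B \subset D.
  by move=> aD sD; apply: finset.bigcap_inf; rewrite aD.
have sA : stable A p q l.
  apply/stableP; split=> [i|i|]; try exact: perm_closed.
  by apply/allP => x /(allP lA) /andP[-> ->].
move=> B'; apply/andP/eqP => [[/and3P[aB' sB' /forallP minB'] _]|->].
  apply/eqP; rewrite finset.eqEsubset minB // andbT.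
  by have /implyP := minB' B; apply; rewrite aB.
split; last exact: minB.
rewrite /orbit_of aB sB; apply/forallP => D; apply/implyP => /andP[]; exact: minB.
Qed.

Section Juxtaposition.
Variables (a : T) (A B : {set T}) (r s : nat).
Hypotheses (aB : a \in B) (BA : B \subset A).

Let disjAB : [disjoint B & A :\: B].
Proof. by rewrite disjoint_sym finset.disjoints_subset finset.setDE subsetIr. Qed.

(** The inverse of the restriction to an invariant set and to its complement;
    sorting by height interleaves the two words. *)
Definition juxtapose (uv : triple r * triple s) : triple (r + s) :=
  (uv.1.1.1 * uv.2.1.1, uv.1.1.2 * uv.2.1.2,
   [tuple of sort height_le (uv.1.2 ++ uv.2.2)]).

Lemma word_on_inside l : word_on B l -> seq.filter (inside B) l = l.
Proof. by move=> lB; apply/all_filterP/allP => x /(allP lB) /andP[]. Qed.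

Lemma word_on_insideC l : word_on B l -> seq.filter (predC (inside B)) l = [::].
Proof.
move=> lB; apply/eqP; rewrite -(negbK (_ == _)) -has_filter; apply/hasPn => x.
by move=> /(allP lB) /andP[_ xB] /=; rewrite negbK.
Qed.

Lemma word_onD_inside l : word_on (A :\: B) l -> seq.filter (inside B) l = [::].
Proof.
move=> lB; apply/eqP; rewrite -(negbK (_ == _)) -has_filter; apply/hasPn => x.
by move=> /(allP lB) /andP[_] /=; rewrite inE => /andP[].
Qed.

Lemma word_onD_insideC l :
  word_on (A :\: B) l -> seq.filter (predC (inside B)) l = l.
Proof.
move=> lB; apply/all_filterP/allP => x /(allP lB) /andP[_] /=.
by rewrite inE => /andP[].
Qed.

(** Sorting is stable, so it commutes with the selection of the letters inside
    B, and each of the two words is already sorted. *)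
Lemma sort_cat_filters l l' : word_on B l -> word_on (A :\: B) l' ->
  sorted height_le l -> sorted height_le l' ->
  seq.filter (inside B) (sort height_le (l ++ l')) = l /\
  seq.filter (predC (inside B)) (sort height_le (l ++ l')) = l'.
Proof.
move=> lB lB' sl sl'.
rewrite !(filter_sort height_le_total height_le_trans) !filter_cat.
rewrite word_on_inside // word_onD_inside // word_on_insideC // word_onD_insideC //.
by rewrite cats0 /= !(sorted_sort height_le_trans).
Qed.

Lemma respects_juxtapose l l' : word_on B l -> word_on (A :\: B) l' ->
  respects B (sort height_le (l ++ l')).
Proof.
move=> lB lB'; apply/allP => x; rewrite mem_sort mem_cat => /orP[].
  by move=> /(allP lB) /andP[-> ->].
by move=> /(allP lB') /andP[]; rewrite !inE => /andP[/negPf-> _] /andP[/negPf-> _].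
Qed.

(** Permutations supported on disjoint sets commute, so the factors can be
    regrouped. *)
Lemma commutator_prod_split p q p' q' l : perm_on B p -> perm_on B q ->
  perm_on (A :\: B) p' -> perm_on (A :\: B) q' -> word_on A l -> respects B l ->
  commutator_prod (p * p') (q * q') l =
  commutator_prod p q (seq.filter (inside B) l)
   * commutator_prod p' q' (seq.filter (predC (inside B)) l).
Proof.
move=> pB qB pB' qB' lA lB.
have comm u v : perm_on B u -> perm_on (A :\: B) v -> commute u v.
  by move=> uB vB; apply: perm_onC uB vB disjAB.
have comm' u v : perm_on (A :\: B) u -> perm_on B v -> u * v = v * u.
  by move=> uB vB; apply/esym/comm.
rewrite /commutator_prod (tprod_split lB).
set w := tprod (seq.filter (inside B) l); set w' := tprod _.
have wB : perm_on B w by exact/tprod_on/word_on_filter.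
have wB' : perm_on (A :\: B) w' by exact/tprod_on/word_on_filterC.
have -> : (p * p')^-1 = p^-1 * p'^-1.
  by rewrite invMg; apply: comm'; apply: perm_onV.
have -> : (q * q')^-1 = q^-1 * q'^-1.
  by rewrite invMg; apply: comm'; apply: perm_onV.
have mv u u' v v' : perm_on (A :\: B) u' -> perm_on B v ->
    u * u' * (v * v') = u * v * (u' * v').
  by move=> uB vB; rewrite -!mulgA; congr (_ * _); rewrite !mulgA (comm' u' v).
have VB u : perm_on B u -> perm_on B u^-1 by exact: perm_onV.
have VB' u : perm_on (A :\: B) u -> perm_on (A :\: B) u^-1 by exact: perm_onV.
have MB' u v : perm_on (A :\: B) u -> perm_on (A :\: B) v ->
   perm_on (A :\: B) (u * v) by exact: perm_onM.
rewrite (mv p p' q q') // (mv (p * q) (p' * q') p^-1 p'^-1) ?MB' ?VB //.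
rewrite (mv (p * q * p^-1) (p' * q' * p'^-1) q^-1 q'^-1) ?MB' ?VB ?VB' //.
by rewrite (mv (p * q * p^-1 * q^-1) (p' * q' * p'^-1 * q'^-1)) ?MB' ?VB ?VB'.
Qed.

Lemma stable_juxtapose D p q p' q' l l' : perm_on B p -> perm_on B q ->
  perm_on (A :\: B) p' -> perm_on (A :\: B) q' -> 
  word_on B l -> word_on (A :\: B) l' -> D \subset B ->
  stable D (p * p') (q * q') (sort height_le (l ++ l')) = stable D p q l.
Proof.
move=> pB qB pB' qB' lB lB' DB.
have actE u u' i : perm_on B u -> perm_on (A :\: B) u' ->
    ((u * u') i \in D) = (u i \in D).
  move=> uB uB'; rewrite permM; have [iB|iB] := boolP (u i \in B).
    by rewrite (out_perm uB') // inE iB.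
  have iB' : u' (u i) \notin B.
    have [iD|iD] := boolP (u i \in A :\: B).
      by move: iD; rewrite -(perm_closed _ uB') inE => /andP[].
    by rewrite (out_perm uB').
  by rewrite !(contraNF (fintype.subsetP DB _)).
rewrite /stable; congr [&& _, _ & _].
- by apply: eq_forallb => i; rewrite actE.
- by apply: eq_forallb => i; rewrite actE.
rewrite /respects all_sort all_cat (_ : all _ l' = true) ?andbT //.
apply/allP => x /(allP lB') /andP[]; rewrite !inE => /andP[x1 _] /andP[x2 _].
by rewrite !(contraNF (fintype.subsetP DB _)).
Qed.

End Juxtaposition.

End OrbitDecomposition.

Arguments height_le {n}.

(** * Counting factorizations by the orbit of a point *)

Section OrbitCount.
Local Open Scope group_scope.
Variable n : nat.
Local Notation T := 'I_n.
Implicit Types (A B D : {set T}) (p q : {perm T}) (l : seq (T * T)) (a : T).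

Lemma stable_setI D D' p q l :
  stable D p q l -> stable D' p q l -> stable (D :&: D') p q l.
Proof.
move=> /stableP[pD qD lD] /stableP[pD' qD' lD']; apply/stableP; split.
- by move=> i; rewrite !inE pD pD'.
- by move=> i; rewrite !inE qD qD'.
- apply/allP => x xl; rewrite !inE.
  by rewrite (eqP (allP lD x xl)) (eqP (allP lD' x xl)).
Qed.

(** Minimality may be tested on subsets of B only, as invariant sets are stable
    under intersection; in this form it depends only on the restriction to B. *)
Lemma orbit_ofE a B p q l : orbit_of a B p q l =
  [&& a \in B, stable B p q l & [forall D : {set T},
     [&& D \subset B, a \in D & stable D p q l] ==> (B \subset D)]].
Proof.
rewrite /orbit_of; have [aB|//] := boolP (a \in B).
have [sB|//] := boolP (stable B p q l); rewrite /=.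
apply/forallP/forallP => H D; apply/implyP.
  by case/and3P=> DB aD sD; apply: (implyP (H D)); rewrite aD.
case/andP=> aD sD; apply: fintype.subset_trans (subsetIr B D).
apply: (implyP (H _)); rewrite subsetIl inE aB aD; exact: stable_setI.
Qed.

Lemma perm_on_mul_inj B B' p p' q q' : [disjoint B & B'] ->
  perm_on B p -> perm_on B q -> perm_on B' p' -> perm_on B' q' ->
  p * p' = q * q' -> p = q /\ p' = q'.
Proof.
move=> /pred0P BB' pB qB pB' qB' E.
have fixB u v i : perm_on B u -> perm_on B' v -> i \in B -> (u * v) i = u i.
  move=> uB vB iB; rewrite permM (out_perm vB) //.
  by have := BB' (u i); rewrite /= (perm_closed _ uB) iB => /= ->.
have pq : p = q.
  apply/permP => i; have [iB|iB] := boolP (i \in B).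
    by rewrite -(fixB p p') // -(fixB q q') // E.
  by rewrite (out_perm pB) // (out_perm qB).
by split=> //; move: E; rewrite pq => /mulgI.
Qed.

Lemma restr_perm_split A B p : B \subset A -> perm_on A p ->
  (forall i, (p i \in B) = (i \in B)) ->
  perm_on (A :\: B) ((restr_perm B p)^-1 * p).
Proof.
move=> BA pA pB; have pN : p \in 'N(B | 'P) by apply/astabsP.
have rB := restr_perm_on B p.
apply/fintype.subsetP => i; rewrite !inE permM; apply: contraR.
rewrite negb_and negbK => /orP[iB|iA].
  have jB : (restr_perm B p)^-1 i \in B by rewrite (perm_closed _ (perm_onV rB)).
  by rewrite -(restr_permE pN jB) permKV.
have iB : i \notin B by apply: contraNN iA => /(fintype.subsetP BA).
by rewrite (out_perm (perm_onV rB)) // (out_perm pA).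
Qed.

Lemma commutator_prod_on B p q l : perm_on B p -> perm_on B q -> word_on B l ->
  perm_on B (commutator_prod p q l).
Proof.
by move=> pB qB lB; rewrite /commutator_prod !perm_onM ?perm_onV ?tprod_on.
Qed.

Lemma perm_on_sub B A p : B \subset A -> perm_on B p -> perm_on A p.
Proof. by move=> BA pB; apply: fintype.subset_trans BA. Qed.

(** Juxtaposition is a bijection between the pairs of a transitive factorization
    on B and an arbitrary one on its complement in A, and the factorizations on
    A for which a has orbit B and exactly r letters lie inside B. *)
Lemma card_juxtapose a A B r s : a \in B -> B \subset A ->
  #|[set t in factorizations A (r + s) | orbit_of a B t.1.1 t.1.2 t.2 &
       count (inside B) t.2 == r]|
  = (#|connected_factorizations a B r| * #|factorizations (A :\: B) s|)%N.
Proof.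
move=> aB BA; rewrite -cardsX.
set X := finset.setX _ _; set Y := [set t in _ | _].
have disj : [disjoint B & A :\: B].
  by rewrite disjoint_sym finset.disjoints_subset finset.setDE subsetIr.
have XP u v : (u, v) \in X -> [/\ perm_on B u.1.1, perm_on B u.1.2, word_on B u.2,
    sorted height_le u.2 & orbit_of a B u.1.1 u.1.2 u.2] /\
   [/\ perm_on (A :\: B) v.1.1, perm_on (A :\: B) v.1.2, word_on (A :\: B) v.2
     & sorted height_le v.2].
  by rewrite !inE /= !monotone_wordE => /andP[/andP[/and5P[-> -> -> /and3P[_ _ ->] _] ->]
     /and5P[-> -> -> /and3P[_ _ ->] _]].
have <- : #|@juxtapose n r s @: X| = #|X|.
  apply: card_in_imset => -[u v] [u' v'] /XP[[pB qB lB sB _] [pB' qB' lB' sB']].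
  move=> /XP[[PB QB LB SB _] [PB' QB' LB' SB']].
  case=> /(perm_on_mul_inj disj pB PB pB' PB') [p1 p2].
  move=> /(perm_on_mul_inj disj qB QB qB' QB') [q1 q2] E.
  have [l1 l2] := sort_cat_filters lB lB' sB sB'.
  have [L1 L2] := sort_cat_filters LB LB' SB SB'.
  rewrite E L1 in l1; rewrite E L2 in l2.
  move: u v u' v' p1 p2 q1 q2 l1 l2 {pB qB lB sB pB' qB' lB' sB' PB QB LB SB
    PB' QB' LB' SB' E L1 L2}.
  by move=> [[? ?] ?] [[? ?] ?] [[? ?] ?] [[? ?] ?] /= -> -> -> -> /val_inj -> /val_inj ->.
apply: eq_card => t; apply/idP/imsetP.
  rewrite !inE monotone_wordE.
  move=> /andP[/and5P[pA qA lA /and3P[lt _ st] /eqP E] /andP[conn /eqP cnt]].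
  have [_ /stableP[pB qB lB] _] := and3P conn.
  (* the preimage of t: its restrictions to B and to the complement of B *)
  have lszE : size (seq.filter (inside B) t.2) == r by rewrite size_filter cnt.
  have lszE' : size (seq.filter (predC (inside B)) t.2) == s.
    have := count_predC (inside B) t.2; rewrite size_tuple cnt => /addnI E'.
    by rewrite size_filter E'.
  pose u : triple n r := (restr_perm B t.1.1, restr_perm B t.1.2, Tuple lszE).
  pose v : triple n s := ((restr_perm B t.1.1)^-1 * t.1.1,
    (restr_perm B t.1.2)^-1 * t.1.2, Tuple lszE').
  have sl : sorted height_le u.2 by rewrite /=; apply: sorted_filter => //; exact: height_le_trans.
  have sl' : sorted height_le v.2 by rewrite /=; apply: sorted_filter => //; exact: height_le_trans.
  have lB1 : word_on B u.2 by exact: word_on_filter.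
  have lB2 : word_on (A :\: B) v.2 by exact: word_on_filterC.
  have tE : t = juxtapose (u, v).
    rewrite [t]surjective_pairing [t.1]surjective_pairing /juxtapose /=.
    rewrite !mulKVg; congr (_, _); apply: val_inj => /=.
    have [f1 f2] := sort_cat_filters lB1 lB2 sl sl'.
    apply: (@height_sorted_inj n B) => //.
    by apply: sort_sorted; exact: height_le_total.
  have v1 : perm_on (A :\: B) v.1.1 by exact: restr_perm_split.
  have v2 : perm_on (A :\: B) v.1.2 by exact: restr_perm_split.
  have u1 : perm_on B u.1.1 by exact: restr_perm_on.
  have u2 : perm_on B u.1.2 by exact: restr_perm_on.
  have := commutator_prod_split u1 u2 v1 v2 lA lB.
  rewrite !mulKVg E -[1]mulg1 => /esym.
  case/(perm_on_mul_inj disj (commutator_prod_on u1 u2 lB1) (perm_on1 _)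
          (commutator_prod_on v1 v2 lB2) (perm_on1 _)) => Eu Ev.
  exists (u, v) => //.
  rewrite !inE /= !monotone_wordE Eu Ev u1 u2 v1 v2 lB1 lB2 sl sl' eqxx.
  have ltf (P : pred (T * T)) : all (fun x : T * T => x.1 < x.2)%N (seq.filter P t.2).
    by apply/allP => x; rewrite mem_filter => /andP[_] /(allP lt).
  have all0 l : all (fun x : T * T => 0 <= x.2)%N l by apply/allP.
  rewrite !ltf !all0 /= orbit_ofE aB /=.
  move: conn; rewrite orbit_ofE => /and3P[_ sB /forallP minB].
  have stE D : D \subset B -> stable D u.1.1 u.1.2 u.2 = stable D t.1.1 t.1.2 t.2.
    move=> DB; rewrite -(stable_juxtapose u1 u2 v1 v2 lB1 lB2 DB).
    by rewrite [in RHS]tE.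
  rewrite [stable _ _ _ _]stE // sB andbT /=; apply/forallP => D.
  apply/implyP => /and3P[DB aD sD]; apply: (implyP (minB D)).
  by rewrite DB aD -stE.
move=> [[u v] uvX ->{t}].
have [[pB qB lB sl conn] [pB' qB' lB' sl']] := XP _ _ uvX.
have [f1 f2] := sort_cat_filters lB lB' sl sl'.
move: uvX; rewrite !inE /= !monotone_wordE => /andP[/andP[/and5P[_ _ _ /and3P[lt _ _] /eqP Eu] _]
     /and5P[_ _ _ /and3P[lt' _ _] /eqP Ev]].
have BA' : A :\: B \subset A by exact: subsetDl.
have sortA : word_on A (sort height_le (u.2 ++ v.2)).
  apply/allP => x; rewrite mem_sort mem_cat => /orP[/(allP lB)|/(allP lB')].
    by case/andP=> x1 x2; rewrite !(fintype.subsetP BA).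
  by case/andP=> x1 x2; rewrite !(fintype.subsetP BA').
have P1 : perm_on A (u.1.1 * v.1.1).
  by apply: perm_onM; [exact: perm_on_sub pB | exact: perm_on_sub pB'].
have P2 : perm_on A (u.1.2 * v.1.2).
  by apply: perm_onM; [exact: perm_on_sub qB | exact: perm_on_sub qB'].
rewrite P1 P2 sortA /=.
rewrite (@commutator_prod_split n A B) ?(@respects_juxtapose n A B) // f1 f2 Eu Ev mulg1 eqxx.
rewrite sort_sorted ?andbT; last exact: height_le_total.
rewrite all_sort all_cat lt lt' /= -size_filter f1 size_tuple eqxx andbT.
apply/andP; split; first exact/allP.
move: conn; rewrite !orbit_ofE => /and3P[_ sB /forallP minB].
rewrite aB (@stable_juxtapose n A B) // sB /=; apply/forallP => D.
apply/implyP => /and3P[DB aD sD]; apply: (implyP (minB D)).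
by rewrite DB aD -(stable_juxtapose pB qB pB' qB' lB lB').
Qed.

(** Every factorization is counted once, according to the orbit B of a and to
    the number of letters inside B. *)
Lemma card_factorizations a A R : a \in A ->
  #|factorizations A R| = (\sum_(B : {set T} | (a \in B) && (B \subset A))
    \sum_(r < R.+1) #|connected_factorizations a B r|
                      * #|factorizations (A :\: B) (R - r)|)%N.
Proof.
move=> aA; pose conn B (t : triple n R) := orbit_of a B t.1.1 t.1.2 t.2.
have -> : #|factorizations A R| = (\sum_(t in factorizations A R)
    \sum_(B : {set T} | (a \in B) && (B \subset A)) conn B t)%N.
  rewrite -sum1_card; apply: eq_bigr => t; rewrite inE => /and5P[pA qA lA _ _].
  have [B HB] := orbit_of_uniq pA qA lA aA.
  have := HB B; rewrite eqxx => /andP[cB BA].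
  rewrite (bigD1 B) /=; last by case/and3P: cB => ->.
  rewrite [conn B t]cB big1 // => B' /andP[/andP[_ BA'] B'B].
  by have := HB B'; rewrite (negPf B'B) BA' andbT /conn => ->.
rewrite exchange_big /=; apply: eq_bigr => B /andP[aB BA].
pose num (t : triple n R) : 'I_R.+1 := inord (count (inside B) t.2).
have numE t : num t = count (inside B) t.2 :> nat.
  by rewrite inordK // ltnS -[R in leqRHS](size_tuple t.2) count_size.
rewrite -big_mkcondr /= (partition_big num xpredT) //=.
apply: eq_bigr => r _; rewrite sum1_card.
have rR : (r <= R)%N by rewrite -ltnS.
have card_jux r' s' : R = (r' + s')%N ->
    #|[set t in factorizations A R | orbit_of a B t.1.1 t.1.2 t.2 &
         count (inside B) t.2 == r']|
    = (#|connected_factorizations a B r'| * #|factorizations (A :\: B) s'|)%N.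
  by move=> {num numE rR r conn} ->; exact: card_juxtapose.
rewrite -card_jux ?subnKC //; apply: eq_card => t; rewrite [RHS]inE unfold_in /=.
by rewrite -val_eqE /= numE andbA.
Qed.

End OrbitCount.

(** * Independence of the labels *)

Section Relabelling.
Local Open Scope group_scope.
Variables (n k : nat) (f : 'I_k -> 'I_n).
Hypothesis f_mono : forall i j, (f i < f j)%N = (i < j)%N.
Implicit Types (s t : {perm 'I_k}) (l : seq ('I_k * 'I_k)).

Let f_inj : injective f.
Proof.
move=> i j fij; apply: val_inj; apply/eqP; rewrite eqn_leq [(i <= j)%N]leqNgt [(j <= i)%N]leqNgt.
by rewrite -!f_mono fij !ltnn.
Qed.

Let A : {set 'I_n} := f @: setT%SET.

(** Transport of a permutation along f, by the identity outside the image of f. *)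
Definition extend_fun s (i : 'I_n) :=
  if [pick j | f j == i] is Some j then f (s j) else i.

Lemma extend_funE s j : extend_fun s (f j) = f (s j).
Proof.
rewrite /extend_fun; case: pickP => [j' /eqP/f_inj -> //|/(_ j)].
by rewrite eqxx.
Qed.

Lemma extend_fun_out s i : i \notin A -> extend_fun s i = i.
Proof.
rewrite /extend_fun; case: pickP => // j /eqP <-.
by rewrite imset_f // inE.
Qed.

Lemma extend_fun_inj s : injective (extend_fun s).
Proof.
have inA j : f j \in A by rewrite imset_f // inE.
move=> i i'; have [/imsetP[j _ ->]|iA] := boolP (i \in A);
  have [/imsetP[j' _ ->]|iA'] := boolP (i' \in A); rewrite ?extend_funE.
- by move=> /f_inj/perm_inj ->.
- by rewrite extend_fun_out // => E; rewrite -E inA in iA'.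
- by rewrite extend_fun_out // => E; rewrite E inA in iA.
- by rewrite !extend_fun_out.
Qed.

Definition extend s : {perm 'I_n} := perm (@extend_fun_inj s).

Lemma extendE s j : extend s (f j) = f (s j).
Proof. by rewrite permE extend_funE. Qed.

Lemma extend_out s i : i \notin A -> extend s i = i.
Proof. by rewrite permE; exact: extend_fun_out. Qed.

Lemma extendP s p : perm_on A p -> (forall j, p (f j) = f (s j)) -> extend s = p.
Proof.
move=> pA ps; apply/permP => i; have [/imsetP[j _ ->]|iA] := boolP (i \in A).
  by rewrite extendE ps.
by rewrite extend_out // (out_perm pA).
Qed.

Lemma extend_on s : perm_on A (extend s).
Proof.
apply/fintype.subsetP => i; rewrite inE; apply: contraR => iA.
by rewrite extend_out.
Qed.

Lemma extendM s t : extend (s * t) = extend s * extend t.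
Proof.
by apply: extendP => [|j]; rewrite ?perm_onM ?extend_on // !permM !extendE.
Qed.

Lemma extend_inj : injective extend.
Proof.
move=> s t st; apply/permP => j; apply: f_inj.
by rewrite -!extendE st.
Qed.

Lemma extend1 : extend 1 = 1.
Proof. by apply: extendP => [|j]; rewrite ?perm_on1 // !perm1. Qed.

Lemma extendV s : extend s^-1 = (extend s)^-1.
Proof. by apply/eqP; rewrite eq_sym eq_invg_mul -extendM mulgV extend1. Qed.

Lemma extend_tperm i j : extend (tperm i j) = tperm (f i) (f j).
Proof.
apply: extendP => [|m]; last by rewrite inj_tperm.
apply/fintype.subsetP => m; rewrite inE.
by case: tpermP => [->|->|_ _]; rewrite ?imset_f ?inE // eqxx.
Qed.

Lemma extend_surj p : perm_on A p -> exists s, extend s = p.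
Proof.
move=> pA; pose g j := odflt j [pick j' | f j' == p (f j)].
have gE j : f (g j) = p (f j).
  rewrite /g; case: pickP => [j' /eqP //|] /=.
  have : p (f j) \in A by rewrite (perm_closed _ pA) imset_f // inE.
  by move=> /imsetP[j' _ ->] /(_ j'); rewrite eqxx.
have g_inj : injective g.
  by move=> i j /(congr1 f); rewrite !gE => /perm_inj/f_inj.
by exists (perm g_inj); apply: extendP => // j; rewrite permE gE.
Qed.

Definition map_pair (x : 'I_k * 'I_k) := (f x.1, f x.2).

Lemma map_pair_inj : injective map_pair.
Proof. by move=> [i j] [i' j'] [/f_inj -> /f_inj ->]. Qed.

Lemma tprod_map l : tprod (map map_pair l) = extend (tprod l).
Proof.
elim: l => [|x l IHl] /=; first by rewrite /tprod !big_nil extend1.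
by rewrite !tprod_cons IHl extendM extend_tperm.
Qed.

Lemma monotone_word_map l : monotone_word 0 (map map_pair l) = monotone_word 0 l.
Proof.
rewrite !monotone_wordE !all_map sorted_map; congr [&& _, _ & _].
- by apply: eq_all => x /=; rewrite f_mono.
- by apply: eq_sorted => x y /=; rewrite /height_le /= leqNgt f_mono -leqNgt.
Qed.

Lemma word_on_map_ex (l : seq ('I_n * 'I_n)) : word_on A l ->
  exists l', l = map map_pair l'.
Proof.
elim: l => [_|[x1 x2] l IHl] /=; first by exists [::].
case/andP=> /andP[/imsetP[i _ ->] /imsetP[j _ ->]] /IHl[l' ->].
by exists ((i, j) :: l').
Qed.

Lemma word_on_map l : word_on A (map map_pair l).
Proof. by rewrite /word_on all_map; apply/allP => x _ /=; rewrite !imset_f ?inE. Qed.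

Lemma card_factorizations_image r :
  #|factorizations A r| = #|factorizations [set: 'I_k] r|.
Proof.
pose phi (t : triple k r) : triple n r :=
  (extend t.1.1, extend t.1.2, [tuple of map map_pair t.2]).
have phi_inj : injective phi.
  move=> [[p q] l] [[p' q'] l'] [/extend_inj -> /extend_inj ->].
  by move=> /(inj_map map_pair_inj) /val_inj ->.
rewrite -(card_imset _ phi_inj); apply: eq_card => t; apply/idP/imsetP.
  rewrite inE => /and5P[/extend_surj[p pE] /extend_surj[q qE] /word_on_map_ex[l lE] lt E].
  have szl : size l == r by rewrite -(size_map map_pair) -lE size_tuple.
  have tE : t = phi (p, q, Tuple szl).
    rewrite [t]surjective_pairing [t.1]surjective_pairing -pE -qE.
    by congr (_, _); apply: val_inj.
  exists (p, q, Tuple szl) => //; rewrite inE /=.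
  have onT (u : {perm 'I_k}) : perm_on [set: 'I_k] u 
    by apply/fintype.subsetP => x _; rewrite inE.
  rewrite !onT /=.
  move: lt E; rewrite lE monotone_word_map -pE -qE => -> /=.
  rewrite /commutator_prod tprod_map -!extendV -!extendM -extend1.
  move=> /eqP/extend_inj ->; rewrite eqxx /= andbT.
  by apply/allP => x _; rewrite !inE.
move=> [[[p q] l]]; rewrite inE /= => /and5P[_ _ _ ml E] ->.
rewrite inE /= !extend_on word_on_map monotone_word_map ml /=.
rewrite /commutator_prod tprod_map -!extendV -!extendM.
by rewrite [_ * _](eqP E) extend1.
Qed.

End Relabelling.

(** Monotonicity depends on the order of the points, hence the relabelling by
    the increasing enumeration of A. *)
Lemma card_factorizations_relabel n (A : {set 'I_n}) r :
  #|factorizations A r| = #|factorizations [set: 'I_#|A|] r|.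
Proof.
have srt : sorted ltn (map val (enum A)).
  have -> : map val (enum A) =
      seq.filter (fun i => [exists j in A, val j == i]) (iota 0 n).
    rewrite -val_enum_ord filter_map; congr map; rewrite enumT [LHS]/enum_mem.
    apply: eq_filter => i /=.
    apply/idP/existsP => [iA|[j /andP[jA /eqP/val_inj <-] //]].
    by exists i; rewrite eqxx andbT.
  by apply: (sorted_filter ltn_trans); exact: iota_ltn_sorted.
have mono (i j : 'I_#|A|) : (enum_val i < enum_val j)%N = (i < j)%N.
  have valE (m : 'I_#|A|) : val (enum_val m) = nth 0%N (map val (enum A)) m.
    by rewrite (nth_map (enum_val m)) -?cardE // -enum_val_nth.
  have lt_nth (a b : 'I_#|A|) : (a < b)%N -> (enum_val a < enum_val b)%N.
    move=> ab; rewrite -[X in (X < _)%N]/(val (enum_val a)).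
    rewrite -[X in (_ < X)%N]/(val (enum_val b)) !valE.
    by rewrite (sorted_ltn_nth ltn_trans) // inE size_map -cardE.
  have [ij|ji|/val_inj ->] := ltngtP i j; [exact: lt_nth| |by rewrite ltnn].
  by apply/negbTE; rewrite -leqNgt ltnW ?lt_nth.
rewrite -(card_factorizations_image mono); congr #|factorizations _ _|.
apply/setP => i; apply/idP/imsetP => [iA|[j _ ->]]; last exact: enum_valP.
by exists (enum_rank_in iA i); rewrite ?enum_rankK_in ?inE.
Qed.

(** * Monotone factorizations as words *)

Section HurwitzCount.
Local Open Scope group_scope.
Variable n : nat.
Local Notation T := 'I_n.
Implicit Types (p q : {perm T}) (l : seq (T * T)).

(** The word has to be the inverse of the commutator of p and q, which is the
    commutator of q and p. *)
Lemma card_factorizations_nmono r : (#|factorizations [set: T] r| =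
  \sum_(p : {perm T}) \sum_(q : {perm T}) nmono 0 r (p * q * p^-1 * q^-1))%N.
Proof.
rewrite exchange_big pair_big /= -sum1_card big_mkcond /=.
rewrite (pair_big xpredT xpredT (fun (pq : {perm T} * {perm T}) (l : r.-tuple (T * T)) =>
  (monotone_word 0 l && (tprod l == pq.2 * pq.1 * pq.2^-1 * pq.1^-1) : nat))) /=.
apply: eq_bigr => t _; rewrite inE.
have onT (u : {perm T}) : perm_on [set: T] u.
  by apply/fintype.subsetP => x _; rewrite inE.
have wT : word_on [set: T] t.2 by apply/allP => x _; rewrite !inE.
rewrite !onT wT /= /commutator_prod -eq_invg_mul !invMg !invgK !mulgA.
by rewrite [_ == tprod _]eq_sym; case: (_ && _).
Qed.

Lemma odd_tprod l : all (fun x : T * T => x.1 < x.2)%N l ->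
  odd_perm (tprod l) = odd (size l).
Proof.
elim: l => [_|x l IHl] /=; first by rewrite /tprod big_nil odd_perm1.
case/andP=> x12 /IHl lE; rewrite tprod_cons odd_permM odd_tperm lE.
by rewrite -val_eqE neq_ltn x12.
Qed.

(** Commutators are even, transpositions are odd. *)
Lemma factorizations_odd (A : {set T}) r : odd r -> factorizations A r = finset.set0.
Proof.
move=> r_odd; apply/setP => t; rewrite !inE; apply/negP => /and5P[_ _ _].
rewrite monotone_wordE => /and3P[lt _ _] /eqP /(congr1 (@odd_perm _)).
rewrite /commutator_prod !odd_permM !odd_permV (odd_tprod lt) size_tuple r_odd.
by rewrite odd_perm1; case: odd_perm; case: odd_perm.
Qed.

Lemma tperm_ltn_inj (i j i' j' : T) : (i < j)%N -> (i' < j')%N ->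
  tperm i j = tperm i' j' -> (i, j) = (i', j').
Proof.
move=> ij ij' E; have := congr1 (fun s : {perm T} => s i) E; rewrite /= tpermL.
case: tpermP => [-> -> //|ij'' j_i'|_ _ ji]; last by rewrite ji ltnn in ij.
by rewrite ij'' j_i' in ij; have := ltn_trans ij ij'; rewrite ltnn.
Qed.

Variables (r : nat) (a : T).

(** A transposition determines its letter (k, l) with k < l, so words of letters
    and words of transpositions correspond bijectively. *)
Definition forget_labels (t : triple n r) :
    {perm T} * {perm T} * {ffun 'I_r -> {perm T}} :=
  (t.1.1, t.1.2, [ffun i => tperm (tnth t.2 i).1 (tnth t.2 i).2]).

Lemma stabilised_respects p q (l : r.-tuple (T * T)) (D : {set T}) :
  let tau := (forget_labels (p, q, l)).2 in
  stable D p q l =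
  ([set p; q] :|: [set tau i | i : 'I_r] \subset 'N(D | 'P)).
Proof.
move=> tau; apply/stableP/fintype.subsetP => [[pD qD /allP lD] u|H].
  move=> uG; apply/astabsP => x /=; rewrite /aperm; move: uG; rewrite !inE.
  move=> /orP[/orP[]/eqP->|/imsetP[i _ ->]] //.
  rewrite ffunE; have /eqP := lD _ (mem_tnth i l).
  by case: tpermP => [->|->|].
have gen u : u \in [set p; q] :|: [set tau i | i : 'I_r] ->
    forall x, (u x \in D) = (x \in D) by move=> /H/astabsP.
split; [by apply: gen; rewrite !inE eqxx | by apply: gen; rewrite !inE eqxx orbT|].
apply/allP => x /tnthP[i ->].
have := gen (tau i); rewrite inE imset_f ?orbT // => /(_ isT) /(_ (tnth l i).2).
by rewrite ffunE tpermR => ->.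
Qed.

(** The sets preserved by the generators are those preserved by the group, and
    the smallest one containing a is the orbit of a. *)
Lemma orbit_of_transitive p q (l : r.-tuple (T * T)) :
  orbit_of a [set: T] p q l =
  generates_transitive p q (forget_labels (p, q, l)).2.
Proof.
rewrite /generates_transitive; set gens := _ :|: _.
have stabE D : stable D p q l = [acts <<gens>>, on D | 'P].
  by rewrite stabilised_respects gen_subG.
rewrite /orbit_of inE stabE /=.
apply/andP/idP => [[_ /forallP H]|tr]; last split.
- have : [set: T] \subset orbit 'P <<gens>> a.
    apply: (implyP (H _)); rewrite orbit_refl stabE /=.
    by apply: acts_orbit; apply/fintype.subsetP => x; rewrite inE.
  move=> sub; apply/imsetP; exists a; rewrite ?inE //.
  by apply/eqP; rewrite finset.eqEsubset sub; apply/fintype.subsetP => x; rewrite inE.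
- by apply/fintype.subsetP => u _; apply/astabsP => x; rewrite !inE.
- apply/forallP => D; apply/implyP => /andP[aD]; rewrite stabE => sD.
  by rewrite -(atransP tr a) ?inE // acts_sub_orbit.
Qed.

Lemma card_monotone_factorizations :
  #|monotone_factorizations n r| = #|connected_factorizations a [set: T] r|.
Proof.
have onT (u : {perm T}) : perm_on [set: T] u.
  by apply/fintype.subsetP => x _; rewrite inE.
have wT l : word_on [set: T] l by apply/allP => x _; rewrite !inE.
have prodE p q (l : r.-tuple (T * T)) :
    product_one p q (forget_labels (p, q, l)).2 = (commutator_prod p q l == 1).
  rewrite /product_one /commutator_prod /tprod big_tuple.
  by under eq_bigr do rewrite ffunE.
have <- : #|forget_labels @: connected_factorizations a [set: T] r|
    = #|connected_factorizations a [set: T] r|.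
  apply: card_in_imset => -[[p q] l] [[p' q'] l'].
  rewrite !inE /= !monotone_wordE => /andP[/and5P[_ _ _ /and3P[lt _ _] _] _].
  move=> /andP[/and5P[_ _ _ /and3P[lt' _ _] _] _] [-> -> /ffunP E].
  congr (_, _); apply: eq_from_tnth => i; have := E i; rewrite !ffunE.
  move=> /tperm_ltn_inj; rewrite (allP lt) ?(allP lt') ?mem_tnth // => /(_ isT isT).
  by rewrite -!surjective_pairing.
apply: eq_card => -[[p q] tau]; apply/idP/imsetP.
  rewrite inE /= => /and3P[prod1 tr] /existsP[k /existsP[j /andP[/forallP kj /forallP jj]]].
  pose l := [tuple (k i, j i) | i < r].
  have tauE : tau = (forget_labels (p, q, l)).2.
    by apply/ffunP => i; rewrite ffunE tnth_mktuple; have /andP[_ /eqP] := kj i.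
  exists (p, q, l); last by rewrite tauE.
  have E1 : commutator_prod p q l == 1 by rewrite -prodE -tauE.
  have c1 : orbit_of a [set: T] p q l by rewrite orbit_of_transitive -tauE.
  rewrite inE c1 andbT inE; apply/and5P; split => //.
  rewrite monotone_wordE; apply/and3P; split.
  - by apply/allP => x /tnthP[i ->]; rewrite tnth_mktuple /=; have /andP[] := kj i.
  - exact/allP.
  - rewrite sorted_pairwise; last exact: height_le_trans.
    apply/(pairwiseP (a, a)) => i i'; rewrite !inE size_tuple => ir ir' ii'.
    rewrite -(tnth_nth _ l (Ordinal ir)) -(tnth_nth _ l (Ordinal ir')).
    rewrite !tnth_mktuple /height_le /=.
    by have /forallP/(_ (Ordinal ir'))/implyP := jj (Ordinal ir); apply; exact: ltnW.
move=> [[[p' q'] l]]; rewrite !inE /= => /andP[/and5P[_ _ _ ml E] conn] [-> -> ->].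
have trE := orbit_of_transitive p' q' l; have pE := prodE p' q' l.
rewrite /= in trE pE; rewrite -trE conn pE E /=.
move: ml; rewrite monotone_wordE => /and3P[lt _ sl].
apply/existsP; exists [ffun i => (tnth l i).1].
apply/existsP; exists [ffun i => (tnth l i).2]; apply/andP; split; apply/forallP => i.
  by rewrite !ffunE eqxx andbT; apply: (allP lt); exact: mem_tnth.
apply/forallP => i'; rewrite !ffunE; apply/implyP => ii'.
have := sorted_leq_nth (@height_le_trans n) (fun x => leqnn _) (a, a) sl.
move=> /(_ i i'); rewrite !inE size_tuple !ltn_ord => /(_ isT isT ii').
by rewrite -!tnth_nth.
Qed.

End HurwitzCount.

(** * Moments and cumulants *)

Section Cumulants.
Variable C : fieldType.
Implicit Types m k : nat -> C.

(** With M and K the exponential generating functions of m and k, this is the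
    differential equation M' = K' M, that is M = exp K. *)
Definition cumulant_rel m k := forall n,
  m n.+1 = \sum_(i < n.+1) ('C(n, i))%:R * k i.+1 * m (n - i)%N.

Fixpoint cumulant_seq m n : seq C :=
  if n is n'.+1 then
    let s := cumulant_seq m n' in
    rcons s (m n - \sum_(i < n') ('C(n', i))%:R * s`_i * m (n' - i)%N)
  else [::].

Definition cumulant m n : C := if n is n'.+1 then (cumulant_seq m n)`_n' else 0.

Lemma size_cumulant_seq m n : size (cumulant_seq m n) = n.
Proof. by elim: n => //= n IHn; rewrite size_rcons IHn. Qed.

Lemma cumulant_seqE m n i : (i < n)%N -> (cumulant_seq m n)`_i = cumulant m i.+1.
Proof.
elim: n => // n IHn; rewrite ltnS leq_eqVlt => /orP[/eqP -> //|ltin].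
by rewrite /= nth_rcons size_cumulant_seq ltin IHn.
Qed.

Lemma cumulantP m : m 0%N = 1 -> cumulant_rel m (cumulant m).
Proof.
move=> m0 n; rewrite big_ord_recr /= binn subnn m0 mulr1 mul1r.
rewrite nth_rcons size_cumulant_seq ltnn eqxx addrC.
set S := \sum_(i < n) _ * _; set S' := \sum_(i < n) _ * _.
suff -> : S = S' by rewrite subrK.
by apply: eq_bigr => i _; rewrite cumulant_seqE.
Qed.

(** The recursion sorted by subsets: B plays the role of the block containing a,
    and there are 'C(n, i) such sets B with i + 1 elements. *)
Lemma cumulant_sets m k (T : finType) (A : {set T}) a : cumulant_rel m k -> a \in A ->
  m #|A| = \sum_(B : {set T} | (a \in B) && (B \subset A)) k #|B| * m #|A :\: B|.
Proof.
move=> mk aA; have [n An] : exists n, #|A| = n.+1.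
  by exists #|A|.-1; rewrite prednK // card_gt0; apply/finset.set0Pn; exists a.
have cardD (B : {set T}) : B \subset A -> #|A :\: B| = (n.+1 - #|B|)%N.
  by move=> BA; rewrite cardsD (finset.setIidPr BA) An.
rewrite An mk.
pose num (B : {set T}) : 'I_n.+1 := inord #|B|.-1.
rewrite (partition_big num xpredT) //=; apply: eq_bigr => i _.
pose X := [set B : {set T} | [&& a \in B, B \subset A & #|B| == i.+1]].
have numP (B : {set T}) : ((a \in B) && (B \subset A)) && (num B == i) = (B \in X).
  rewrite inE -andbA; case aB: (a \in B) => //=; case BA: (B \subset A) => //=.
  have Bgt0 : (0 < #|B|)%N by rewrite card_gt0; apply/finset.set0Pn; exists a.
  have Ble : (#|B|.-1 < n.+1)%N by rewrite prednK // -An subset_leq_card.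
  by rewrite -val_eqE /= inordK // -eqSS prednK.
transitivity (\sum_(B in X) (k i.+1 * m (n - i)%N)); last first.
  apply: eq_big => [B|B]; first by rewrite -numP.
  by rewrite inE => /and3P[_ BA /eqP cB]; rewrite cardD // cB subSS.
rewrite sumr_const -[RHS]mulr_natl mulrA; congr (_%:R * _ * _).
have nE : n = #|A :\ a| by rewrite (cardsD1 a A) aA in An; case: An.
rewrite [X in 'C(X, _)]nE -cards_draws; set Y := [set B : {set T} | _ & _].
have inj : {in Y &, injective (fun B : {set T} => a |: B)}.
  move=> B B'; rewrite !inE => /andP[BA _] /andP[BA' _] E.
  have aB (D : {set T}) : D \subset A :\ a -> a \notin D.
    by move=> DA; apply/negP => /(fintype.subsetP DA); rewrite !inE eqxx.
  by rewrite -(setU1K (aB B BA)) E (setU1K (aB B' BA')).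
rewrite -(card_in_imset inj); apply: eq_card => B; rewrite [RHS]inE.
apply/imsetP/and3P => [[D]|[aB BA /eqP cB]].
  rewrite inE => /andP[DA /eqP cD] ->.
  have aD : a \notin D by apply/negP => /(fintype.subsetP DA); rewrite !inE eqxx.
  rewrite !inE eqxx cardsU1 aD cD eqxx; split => //.
  apply/fintype.subsetP => x; rewrite !inE => /orP[/eqP -> //|/(fintype.subsetP DA)].
  by rewrite !inE => /andP[].
exists (B :\ a); last by rewrite finset.setD1K.
rewrite inE finset.setSD //=.
by move: cB; rewrite (cardsD1 a B) aB add1n => -[->].
Qed.

End Cumulants.

(** * Expansions in inverse powers of N *)

Section Asymptotics.
Variable R : realType.
Local Notation C := (CC R).
Implicit Types (f g : nat -> C) (c e : nat -> C).

(** Expanding in -1/N rather than 1/N makes the coefficients of the moments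
    nonnegative counts; the explicit remainder of the next order makes the
    notion stable under products. *)
Definition inverse_expansion f c := forall r, exists K : C, exists N0 : nat,
  forall N, (N0 <= N)%N ->
  `|f N - \sum_(i < r.+1) (- N%:R^-1) ^+ i * c i| <= K * N%:R^-1 ^+ r.+1.

Lemma inverse_expansion_ext f g c e : (exists N0, forall N, (N0 <= N)%N -> f N = g N) ->
  (forall i, c i = e i) -> inverse_expansion f c -> inverse_expansion g e.
Proof.
move=> [N1 fg] ce fc r; have [K [N0 H]] := fc r; exists K, (maxn N0 N1) => N.
rewrite geq_max => /andP[NN0 NN1]; rewrite -fg //.
by under eq_bigr do rewrite -ce; exact: H.
Qed.

Lemma inverse_expansionD f g c e : inverse_expansion f c -> inverse_expansion g e ->
  inverse_expansion (fun N => f N + g N) (fun i => c i + e i).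
Proof.
move=> fc ge r; have [K [N0 H]] := fc r; have [K' [N1 H']] := ge r.
exists (K + K'), (maxn N0 N1) => N; rewrite geq_max => /andP[NN0 NN1].
rewrite mulrDl; apply: le_trans (lerD (H N NN0) (H' N NN1)).
apply: le_trans (ler_normD _ _); rewrite le_eqVlt; apply/orP; left; apply/eqP.
congr `|_|; under eq_bigr do rewrite mulrDr.
by rewrite big_split /=; ring.
Qed.

Lemma inverse_expansion0 : inverse_expansion (fun=> 0) (fun=> 0).
Proof.
move=> r; exists 0, 0%N => N _; rewrite big1 ?subrr ?normr0 ?mul0r // => i _.
by rewrite mulr0.
Qed.

Lemma inverse_expansionN f c : inverse_expansion f c ->
  inverse_expansion (fun N => - f N) (fun i => - c i).
Proof.
move=> fc r; have [K [N0 H]] := fc r; exists K, N0 => N NN0.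
under eq_bigr do rewrite mulrN.
by rewrite sumrN -opprD normrN; exact: H.
Qed.

Lemma inverse_expansion_sum (I : finType) (P : pred I) (f : I -> nat -> C) (c : I -> nat -> C) :
  (forall i, P i -> inverse_expansion (f i) (c i)) ->
  inverse_expansion (fun N => \sum_(i | P i) f i N) (fun r => \sum_(i | P i) c i r).
Proof.
move=> H; rewrite [X in inverse_expansion X _](_ : _ =
    fun N => (\sum_(i | P i) f i) N); last by apply/funext => N; rewrite fct_sumE.
rewrite [X in inverse_expansion _ X](_ : _ =
    fun N => (\sum_(i | P i) c i) N); last by apply/funext => N; rewrite fct_sumE.
elim/big_ind2 : _ => //; first exact: inverse_expansion0.
by move=> f1 c1 f2 c2; exact: inverse_expansionD.
Qed.

Lemma inverse_bounded f c : inverse_expansion f c ->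
  exists2 B : C, 0 <= B & exists N0 : nat, forall N, (N0 <= N)%N -> `|f N| <= B.
Proof.
move=> /(_ 0%N)[K [N0 H]]; exists (`|c 0%N| + `|K|); first exact: addr_ge0.
exists (maxn N0 1) => N; rewrite geq_max => /andP[NN0 N1].
have -> : f N = (f N - \sum_(i < 1) (- N%:R^-1) ^+ i * c i) + c 0%N.
  by rewrite big_ord1 expr0 mul1r subrK.
rewrite addrC; apply: le_trans (ler_normD _ _) _; rewrite lerD2l.
have x0 : 0 <= (N%:R^-1 : C) by rewrite invr_ge0 ler0n.
apply: le_trans (H N NN0) _; rewrite expr1.
apply: (@le_trans _ _ (`|K| * N%:R^-1)).
  apply: ler_wpM2r => //; apply: real_ler_norm.
  have := le_trans (normr_ge0 _) (H N NN0); rewrite expr1.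
  rewrite pmulr_lge0 ?invr_gt0 ?ltr0n //; exact: ger0_real.
by rewrite ler_piMr // invf_le1 ?ltr0n // ler1n.
Qed.

Lemma inverse_expansionM f g c e : inverse_expansion f c -> inverse_expansion g e ->
  inverse_expansion (fun N => f N * g N)
    (fun r => \sum_(i < r.+1) c i * e (r - i)%N).
Proof.
move=> fc ge r.
have [B B0 [N2 gB]] := inverse_bounded ge.
have [K [N0 H]] := fc r; have [K' [N1 H']] := ge r.
pose cp := \poly_(i < r.+1) c i; pose ep := \poly_(i < r.+1) e i.
pose A : C := \sum_(i < r.+1) `|c i|.
(* the product of the two truncations has terms of order greater than r, whose
   coefficients are bounded by Q *)
pose Q : C := \sum_(i < (r.+1 + r.+1)%N) `|(cp * ep)`_i|.
exists (K * B + A * K' + Q), (maxn (maxn N0 N1) (maxn N2 1)) => N.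
rewrite !geq_max => /andP[/andP[NN0 NN1] /andP[NN2 N_gt0]].
set x : C := N%:R^-1; set y := - x.
have x0 : 0 <= x by rewrite invr_ge0 ler0n.
have x1 : x <= 1 by rewrite invf_le1 ?ltr0n // ler1n.
have ny : `|y| = x by rewrite normrN ger0_norm.
have hornerE (h : nat -> C) : (\poly_(i < r.+1) h i).[y] = \sum_(i < r.+1) y ^+ i * h i.
  by rewrite horner_poly; apply: eq_bigr => i _; rewrite mulrC.
have prodE : (cp * ep).[y] = \sum_(i < r.+1) y ^+ i * \sum_(j < i.+1) c j * e (i - j)%N
    + \sum_(i < r.+1) (cp * ep)`_(r.+1 + i) * y ^+ (r.+1 + i).
  have sz : (size (cp * ep)%R <= r.+1 + r.+1)%N.
    apply: leq_trans (size_polyMleq _ _) _; apply: leq_trans (leq_pred _) _.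
    exact: leq_add (size_poly _ _) (size_poly _ _).
  rewrite (horner_coef_wide _ sz) big_split_ord /=; congr (_ + _).
  apply: eq_bigr => i _; rewrite mulrC coefM; congr (_ * _); apply: eq_bigr => j _.
  have ir := ltn_ord i; have ji := ltn_ord j.
  by rewrite !coef_poly !ifT //; lia.
set T := \sum_(i < r.+1) y ^+ i * _.
have -> : f N * g N - T = (f N - cp.[y]) * g N + cp.[y] * (g N - ep.[y])
    + \sum_(i < r.+1) (cp * ep)`_(r.+1 + i) * y ^+ (r.+1 + i).
  rewrite (_ : f N * g N - T = f N * g N - cp.[y] * ep.[y] + (cp.[y] * ep.[y] - T)); last by ring.
  by rewrite -hornerM [in X in _ + X]prodE /T hornerM; ring.
have gB' := gB N NN2; have HN := H N NN0; have HN' := H' N NN1.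
rewrite -/x -/y -!hornerE -/cp -/ep in HN HN'.
rewrite [leRHS]mulrDl [X in _ <= X + _]mulrDl.
apply: le_trans (ler_normD _ _) _; apply: lerD.
  apply: le_trans (ler_normD _ _) _; rewrite !normrM; apply: lerD.
    by rewrite [leRHS]mulrAC; apply: ler_pM.
  rewrite -[leRHS]mulrA; apply: ler_pM => //; rewrite hornerE.
  apply: le_trans (ler_norm_sum _ _ _) _; apply: ler_sum => i _.
  by rewrite normrM normrX ny ler_piMl // exprn_ile1.
rewrite /Q big_split_ord /= mulrDl; apply: ler_wpDl.
  by rewrite mulr_ge0 ?sumr_ge0 ?exprn_ge0.
rewrite mulr_suml; apply: le_trans (ler_norm_sum _ _ _) _; apply: ler_sum => i _.
rewrite normrM normrX ny exprD ler_wpM2l //.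
by rewrite ler_piMr ?exprn_ge0 // exprn_ile1.
Qed.

End Asymptotics.

(** * Cumulants count transitive factorizations *)

Section ConnectedExpansion.
Variables (R : realType) (n : nat) (m : nat -> nat -> CC R).
Hypothesis m0 : forall N, m N 0 = 1.
Hypothesis m_expansion : forall k, inverse_expansion (fun N => m N k)
  (fun r => #|factorizations [set: 'I_k] r|%:R).

Lemma card_factorizations0 r :
  #|factorizations (finset.set0 : {set 'I_n}) r| = (r == 0)%N.
Proof.
case: r => [|r] /=.
  rewrite (_ : factorizations _ _ = [set (1%g, 1%g, [tuple])]) ?cards1 //.
  apply/setP => -[[p q] l]; rewrite !inE /= [l]tuple0 /=.
  apply/and3P/eqP => [[p0 q0 _]|[-> ->]].
    by congr (_, _, _); apply/permP => i; rewrite perm1 (out_perm (S := finset.set0)) ?inE.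
  split; rewrite ?perm_on1 // /commutator_prod /tprod big_nil.
  by rewrite !mulg1 !invg1 !mulg1.
apply/eqP; rewrite cards_eq0; apply/eqP/setP => -[[p q] l]; rewrite !inE /=.
by apply/negP => /and5P[_ _]; rewrite [l]tuple_eta /= !inE.
Qed.

(** The recursion of the cumulants over the subsets containing a and the
    decomposition of factorizations along the orbit of a have the same shape,
    and in both the term B = A is the unknown one. *)
Lemma connected_expansion (A : {set 'I_n}) a : a \in A ->
  inverse_expansion (fun N => cumulant (m N) #|A|)
    (fun r => #|connected_factorizations a A r|%:R).
Proof.
have [k] := ubnP #|A|; elim: k => // k IHk in A *; rewrite ltnS => Ak aA.
have mA (B : {set 'I_n}) : inverse_expansion (fun N => m N #|B|)
    (fun r => #|factorizations B r|%:R).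
  apply: inverse_expansion_ext (m_expansion #|B|); first by exists 0%N.
  by move=> r; rewrite (card_factorizations_relabel B).
pose P (B : {set 'I_n}) := [&& a \in B, B \subset A & B != A].
have PE B : P B = (a \in B) && (B \subset A) && (B != A) by rewrite /P andbA.
have PA : (a \in A) && (A \subset A) by rewrite aA /=.
have sum_exp : inverse_expansion
    (fun N => \sum_(B | P B) cumulant (m N) #|B| * m N #|A :\: B|)
    (fun r => \sum_(B | P B) \sum_(i < r.+1) #|connected_factorizations a B i|%:R
         * #|factorizations (A :\: B) (r - i)|%:R).
  apply: inverse_expansion_sum => B /and3P[aB BA BnA].
  have cB := IHk B (leq_trans (proper_card _) Ak) aB.
  apply: inverse_expansionM (cB _) (mA (A :\: B)).
  by rewrite finset.properEneq BnA.
apply: inverse_expansion_ext (inverse_expansionD (mA A) (inverse_expansionN sum_exp)).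
  exists 0%N => N _; rewrite (cumulant_sets (cumulantP (m0 N)) aA) (bigD1 A) //=.
  rewrite finset.setDv cards0 m0 mulr1 -addrA.
  rewrite [X in _ + X](_ : _ = 0) ?addr0 //.
  by under [X in X - _]eq_bigl do rewrite -PE; rewrite subrr.
move=> r; rewrite (card_factorizations r aA) (bigD1 A) //= natrD finset.setDv.
rewrite big_ord_recr /= subnn card_factorizations0 muln1 big1 ?add0n; last first.
  move=> i _; rewrite card_factorizations0 subn_eq0 leqNgt ltn_ord.
  by rewrite muln0.
rewrite -addrA [X in _ + X](_ : _ = 0) ?addr0 //.
rewrite natr_sum; under eq_bigl do rewrite -PE.
rewrite -sumrB big1 // => B _; rewrite natr_sum -sumrB big1 // => i _.
by rewrite natrM subrr.
Qed.

End ConnectedExpansion.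

(** * Tensor powers of unitary matrices *)

Section TensorPowers.
Local Open Scope sesquilinear_scope.
Variables (C : numClosedFieldType) (n N : nat).
Local Notation idx := {ffun 'I_n -> 'I_N}.
Implicit Types (A B M : 'M[C]_N) (I J K L : idx) (s t : {perm 'I_n}).

(** The entries of the n-th tensor power of M. *)
Definition tensor M I J : C := \prod_k M (I k) (J k).

(** Permutation of the tensor factors. *)
Definition relabel I s : idx := [ffun k => I (s k)].

Lemma relabelM I s t : relabel (relabel I t) s = relabel I (s * t)%g.
Proof. by apply/ffunP => k; rewrite !ffunE permM. Qed.

Lemma relabel1 I : relabel I 1 = I.
Proof. by apply/ffunP => k; rewrite ffunE perm1. Qed.

Lemma eq_relabel I J s : (I == relabel J s) = (J == relabel I s^-1).
Proof.
by apply/eqP/eqP => ->; rewrite relabelM ?mulVg ?mulgV relabel1.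
Qed.

Lemma tensor_mul A B I J :
  tensor (A *m B) I J = \sum_K tensor A I K * tensor B K J.
Proof.
rewrite /tensor; under eq_bigr do rewrite mxE.
rewrite bigA_distr_bigA; apply: eq_bigr => K _.
by rewrite -big_split.
Qed.

Lemma tensor1 I J : tensor 1%:M I J = (I == J)%:R.
Proof.
rewrite /tensor; have [->|IJ] := eqVneq I J.
  by rewrite big1 // => k _; rewrite mxE eqxx.
have [k Ik] : exists k, I k != J k.
  apply/existsP; apply: contraNT IJ; rewrite negb_exists => /forallP H.
  by apply/eqP/ffunP => k; apply/eqP; rewrite -[_ == _]negbK H.
by rewrite (bigD1 k) //= mxE (negPf Ik) mul0r.
Qed.

Lemma tensor_relabel M I J s : tensor M (relabel I s) (relabel J s) = tensor M I J.
Proof.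
rewrite /tensor [RHS](reindex_inj (@perm_inj _ s)) /=.
by apply: eq_bigr => k _; rewrite !ffunE.
Qed.

Lemma tensor_adj M I J : tensor (M^t*) I J = (tensor M J I)^*.
Proof.
by rewrite /tensor rmorph_prod; apply: eq_bigr => k _; rewrite !mxE.
Qed.

Lemma sum_diracl (F : idx -> C) I : \sum_K (I == K)%:R * F K = F I.
Proof.
rewrite (bigD1 I) //= eqxx mul1r big1 ?addr0 // => K; rewrite eq_sym.
by move=> /negPf ->; rewrite mul0r.
Qed.

Lemma sum_diracr (F : idx -> C) I : \sum_K F K * (K == I)%:R = F I.
Proof.
by under eq_bigr do rewrite mulrC eq_sym; rewrite sum_diracl.
Qed.

Definition commutes (T : idx -> idx -> C) := forall A, A \is unitarymx ->
  forall I L, \sum_K T I K * tensor A K L = \sum_K tensor A I K * T K L.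

Lemma commutes_perm s : commutes (fun I J => (I == relabel J s)%:R).
Proof.
move=> A _ I L; rewrite [RHS]sum_diracr.
under eq_bigr do rewrite eq_relabel eq_sym.
by rewrite sum_diracl -[LHS](tensor_relabel _ _ _ s) relabelM mulgV relabel1.
Qed.

Lemma commutes_sub_comb (T : idx -> idx -> C) (c : {perm 'I_n} -> C) :
  commutes T ->
  commutes (fun I J => T I J - \sum_s c s * (I == relabel J s)%:R).
Proof.
move=> cT A Au I L.
under eq_bigr do rewrite mulrBl mulr_suml.
rewrite sumrB cT // exchange_big /=.
under [RHS]eq_bigr do rewrite mulrBr mulr_sumr.
rewrite sumrB; congr (_ - _); rewrite [RHS]exchange_big /=; apply: eq_bigr => s _.
under eq_bigr do rewrite -mulrA; rewrite -mulr_sumr (commutes_perm s Au).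
by rewrite mulr_sumr; apply: eq_bigr => K _; rewrite mulrCA.
Qed.

(** Take a root of -1 of order n!: if z^i = z^j with i < j <= n, then j - i
    divides n! and z^(n!) would be 1. *)
Lemma root_no_small_power : exists2 z : C, `|z| = 1 &
  forall i j, (i <= n)%N -> (j <= n)%N -> z ^+ i = z ^+ j -> i = j.
Proof.
pose m := n`!; have m_gt0 : (0 < m)%N := fact_gt0 n.
pose z : C := m.-root (-1).
have zm : z ^+ m = -1 by rewrite rootCK.
have z1 : `|z| = 1.
  apply/eqP; rewrite -(@pexpr_eq1 _ _ m) -?lt0n //.
  by rewrite -normrX zm normrN1.
have z0 : z != 0 by rewrite -normr_eq0 z1 oner_eq0.
exists z => //; suff lt i j : (i < j <= n)%N -> z ^+ i <> z ^+ j.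
  move=> i j i_n j_n E; have [ij|ji|//] := ltngtP i j.
    by case: (lt i j) => //; rewrite ij.
  by case: (lt j i) => //; rewrite ji.
move=> /andP[ij jn] E.
have : z ^+ (j - i) = 1 by rewrite expfB // E divff // expf_neq0.
have : (j - i %| m)%N by rewrite dvdn_fact // subn_gt0 ij (leq_trans (leq_subr _ _)).
case/dvdnP=> k mE zji.
move: zm; rewrite mE mulnC exprM zji expr1n => /eqP.
by rewrite -addr_eq0 -mulr2n pnatr_eq0.
Qed.

Lemma relabelP I J : (forall a, #|[set k | I k == a]| = #|[set k | J k == a]|) ->
  exists s, I = relabel J s.
Proof.
move=> cnt.
have : perm_eq [tuple I k | k < n] [tuple J k | k < n].
  apply/seq.permP => P.
  have E H : count P [tuple H k | k < n] = (\sum_(a | P a) #|[set k | H k == a]|)%N.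
    rewrite /= count_map -sum1_count big_mkcond /= big_enum /= -big_mkcond /=.
    rewrite (partition_big H P) //=; apply: eq_bigr => a Pa.
    rewrite sum1_card; apply: eq_card => k; rewrite !inE unfold_in /=.
    by case: eqP => [->|]; rewrite ?andbF ?andbT.
  by rewrite !E; apply: eq_bigr => a _; rewrite cnt.
case/tuple_permP => s sE; exists s; apply/ffunP => k; rewrite ffunE.
by have /(congr1 (fun l => tnth l k)) := val_inj sE; rewrite !tnth_mktuple.
Qed.

(** Diagonal unitary matrices separate weights: with z in position a and 1
    elsewhere, the tensor power acts on the basis vector of index J by z to the
    number of occurrences of a in J. So I and J take each value equally often. *)
Lemma commutes_weight T I J : commutes T -> T I J != 0 ->
  exists s, I = relabel J s.
Proof.
move=> cT TIJ; apply: relabelP => a.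
have [z z1 zinj] := root_no_small_power.
pose D : 'rV[C]_N := \row_j (if j == a then z else 1).
have diagE K L : tensor (diag_mx D) K L = (K == L)%:R * z ^+ #|[set k | L k == a]|.
  have [->|KL] := eqVneq K L.
    rewrite mul1r /tensor -prodr_const [RHS]big_mkcond /=; apply: eq_bigr => k _.
    by rewrite !mxE eqxx mulr1n inE.
  have [k Kk] : exists k, K k != L k.
    apply/existsP; apply: contraNT KL; rewrite negb_exists => /forallP H.
    by apply/eqP/ffunP => k; apply/eqP; rewrite -[_ == _]negbK H.
  by rewrite /tensor (bigD1 k) //= !mxE (negPf Kk) mulr0n !mul0r.
have Du : diag_mx D \is unitarymx.
  apply/unitarymxP; rewrite tr_diag_mx map_diag_mx mulmx_diag.
  apply/matrixP => i j; rewrite !mxE; congr (_ *+ _); case: ifP => _.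
    by rewrite -normCK z1 expr1n.
  by rewrite rmorph1 mulr1.
have := cT _ Du I J.
under eq_bigr do rewrite diagE mulrA; rewrite -mulr_suml sum_diracr.
under [in RHS]eq_bigr do rewrite diagE -mulrA; rewrite sum_diracl mulrC.
move=> /(mulIf TIJ)/zinj E.
have card_n K : (#|[set k | K k == a]| <= n)%N.
  by rewrite -[n in leqRHS]card_ord max_card.
by rewrite E.
Qed.

Lemma unitary_completion (V : 'M[C]_(n, N)) (nN : (n <= N)%N) : V \is unitarymx ->
  exists2 U : 'M[C]_N, U \is unitarymx & forall k, row (widen_ord nN k) U = row k V.
Proof.
move=> Vu.
pose O := orthomx Num.Def.conjC (mx_of_hermitian (hermitian1mx _)) V.
pose W := col_mx V (schmidt (row_base O)).
have Wu : W \is unitarymx.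
  apply/unitarymxP; rewrite tr_col_mx map_row_mx mul_col_row.
  rewrite !(unitarymxP _) ?schmidt_unitarymx ?rank_leq_col //.
  have VO : V *m (schmidt (row_base O))^t* = 0.
    apply/orthomx1P.
    by rewrite orthomx_sym eqmx_schmidt_free ?eq_row_base ?row_base_free.
  have OV : schmidt (row_base O) *m V^t* = 0.
    by apply/orthomx1P; rewrite eqmx_schmidt_free ?eq_row_base ?row_base_free.
  by rewrite VO OV -scalar_mx_block.
have rN : (n + \rank O = N)%N.
  by rewrite -[n in LHS](mxrank_unitary Vu) add_rank_ortho.
exists (castmx (rN, erefl N) W).
  have castU p (X : 'M[C]_(p, N)) (e : p = N) :
      X \is unitarymx -> castmx (e, erefl N) X \is unitarymx.
    by subst p; rewrite castmx_id.
  exact: castU.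
move=> k; apply/rowP => j; rewrite !mxE castmxE /= cast_ord_id.
have -> : cast_ord (esym rN) (widen_ord nN k) = lshift _ k by apply: val_inj.
by rewrite col_mxEu.
Qed.

End TensorPowers.

(** * The commutant of the tensor powers *)

Section Commutant.
Local Open Scope sesquilinear_scope.
Variables (C : numClosedFieldType) (n N : nat).
Hypothesis large : (n + n * n <= N)%N.
Local Notation idx := {ffun 'I_n -> 'I_N}.
Implicit Types (I J K L : idx) (s t : {perm 'I_n}).

Lemma leq_dim : (n <= N)%N.
Proof. exact: leq_trans (leq_addr _ _) large. Qed.

(** Since its entries are distinct, the relabellings of this multi-index are
    distinct, and the coefficients of a combination of permutations can be read
    off from one column. *)
Definition std_idx : idx := [ffun k => widen_ord leq_dim k].

(** The multi-index J takes at most n values, which leaves n^2 coordinates. *)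
Lemma fresh_coordinates J : exists2 e : 'I_n * 'I_n -> 'I_N,
  injective e & forall p k, e p != J k.
Proof.
pose F := [set a | a \notin J @: [set: 'I_n]].
have le : (#|{: 'I_n * 'I_n}| <= #|F|)%N.
  rewrite card_prod card_ord -(leq_add2l n); apply: leq_trans large _.
  rewrite -[N in leqLHS]card_ord -(cardsC F) addnC leq_add2r.
  rewrite (_ : ~: F = J @: [set: 'I_n]); last by apply/setP => a; rewrite !inE negbK.
  by apply: leq_trans (leq_imset_card _ _) _; rewrite cardsT card_ord.
pose e p := enum_val (widen_ord le (enum_rank p)).
exists e => [p q|p k].
  by move=> /enum_val_inj /(congr1 val) /= /val_inj /enum_rank_inj.
have : e p \in F := enum_valP _.
by rewrite inE; apply: contraNneq => ->; rewrite imset_f ?inE.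
Qed.

(** Repeated values in J make the basis vectors of indices J 0, ..., J (n-1)
    linearly dependent. One fresh coordinate for each pair i < j, equal to 1 on
    the i-th vector and to -[J i = J j] on the j-th one, cancels the scalar
    product of this pair and of no other pair. *)
Lemma orthogonal_lifts J : exists v : 'I_n -> 'I_N -> C,
  [/\ forall k a, (v k a)^* = v k a,
      forall k, 0 < \sum_a v k a * v k a,
      forall k l, k != l -> \sum_a v k a * v l a = 0
    & forall k a, a \in J @: [set: 'I_n] -> v k a = (a == J k)%:R].
Proof.
have [e e_inj eJ] := fresh_coordinates J.
pose x k (p : 'I_n * 'I_n) : C := if (p.1 < p.2)%N then
  (k == p.1)%:R - (k == p.2)%:R * (J p.1 == J p.2)%:R else 0.
pose v k a : C := (a == J k)%:R + \sum_p (a == e p)%:R * x k p.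
have vJ k l : v k (J l) = (J l == J k)%:R.
  by rewrite /v big1 ?addr0 // => p _; rewrite eq_sym (negPf (eJ p l)) mul0r.
have ve k p : v k (e p) = x k p.
  rewrite /v (negPf (eJ p k)) add0r (bigD1 p) //= eqxx mul1r big1 ?addr0 // => q qp.
  by rewrite (inj_eq e_inj) eq_sym (negPf qp) mul0r.
have dot k l : \sum_a v k a * v l a = (J k == J l)%:R + \sum_p x k p * x l p.
  under eq_bigr do rewrite [v k _]/v mulrDl.
  rewrite big_split /=; congr (_ + _).
    rewrite (bigD1 (J k)) //= eqxx mul1r vJ big1 ?addr0 // => a aJ.
    by rewrite (negPf aJ) mul0r.
  under eq_bigr do rewrite mulr_suml.
  rewrite exchange_big /=; apply: eq_bigr => p _.
  rewrite (bigD1 (e p)) //= eqxx mul1r ve big1 ?addr0 // => a ap.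
  by rewrite (negPf ap) !mul0r.
have xreal k p : (x k p)^* = x k p.
  by rewrite /x; case: ifP; rewrite ?rmorph0 // rmorphB rmorphM !rmorph_nat.
have dot0 (k l : 'I_n) : (k < l)%N -> \sum_a v k a * v l a = 0.
  move=> kl; rewrite dot (bigD1 (k, l)) //= big1 => [|[i j] /= neq].
    have kl' : (k == l) = false by rewrite -val_eqE; exact: ltn_eqF.
    rewrite /x /= kl !eqxx kl' eq_sym [l == k]eq_sym kl'.
    by rewrite mul0r subr0 !mul1r sub0r addr0 [J l == _]eq_sym subrr.
  rewrite /x /=; case: ifP => ij; last by rewrite mul0r.
  have [li|_] := eqVneq l i.
    have ki : (k == i) = false by rewrite -val_eqE -li; exact: ltn_eqF.
    have kj : (k == j) = false.
      by rewrite -val_eqE; apply: ltn_eqF; apply: ltn_trans ij; rewrite -li.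
    by rewrite ki kj mul0r subr0 mul0r.
  have [lj|_] := eqVneq l j; last by rewrite mul0r subr0 mulr0.
  have kj : (k == j) = false by rewrite -val_eqE -lj; exact: ltn_eqF.
  have ki : (k == i) = false.
    by apply/negP => /eqP ki; rewrite ki lj eqxx in neq.
  by rewrite ki kj mul0r subr0 mul0r.
exists v; split.
- move=> k a; rewrite rmorphD rmorph_nat rmorph_sum; congr (_ + _).
  apply: eq_bigr => p _; rewrite rmorphM rmorph_nat; congr (_ * _); exact: xreal.
- move=> k; rewrite dot eqxx; apply: ltr_pwDl => //; apply: sumr_ge0 => p _.
  by rewrite -{2}xreal mul_conjC_ge0.
- move=> k l kl; have [lt|gt|/val_inj E] := ltngtP k l; first exact: dot0.
    by under eq_bigr do rewrite mulrC; exact: dot0.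
  by rewrite E eqxx in kl.
- by move=> k a /imsetP[l _ ->].
Qed.

(** Normalizing the vectors and completing them to an orthonormal basis gives a
    unitary matrix whose tensor power maps the standard basis vector to a
    multiple of the tensor product of the v k. *)
Lemma unitary_lifts (v : 'I_n -> 'I_N -> C) :
  (forall k a, (v k a)^* = v k a) -> (forall k, 0 < \sum_a v k a * v k a) ->
  (forall k l, k != l -> \sum_a v k a * v l a = 0) ->
  exists2 A : 'M[C]_N, A \is unitarymx & exists2 c : C, c != 0 &
    forall K, tensor A K std_idx = c * \prod_k v k (K k).
Proof.
move=> vreal vpos vorth; pose d k : C := (sqrtC (\sum_a v k a * v k a))^-1.
have d_gt0 k : 0 < d k by rewrite invr_gt0 sqrtC_gt0.
have dd k : d k * d k * (\sum_a v k a * v k a) = 1.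
  by rewrite /d -invfM -expr2 sqrtCK mulVf // gt_eqF.
pose V : 'M[C]_(n, N) := \matrix_(k, a) (d k * v k a).
have Vu : V \is unitarymx.
  apply/unitarymxP/matrixP => k l; rewrite !mxE.
  transitivity (d k * d l * \sum_a v k a * v l a).
    rewrite mulr_sumr; apply: eq_bigr => a _.
    rewrite !mxE rmorphM /= [X in _ * (_ * X) = _]vreal.
    by rewrite [X in _ * (X * _) = _](CrealP (gtr0_real (d_gt0 l))) mulrACA.
  by have [->|kl] := eqVneq k l; rewrite ?dd // vorth // mulr0.
have [U Uu UV] := unitary_completion leq_dim Vu.
exists U^T; first by rewrite trmx_unitary.
exists (\prod_k d k); first by apply/prodf_neq0 => k _; rewrite gt_eqF.
move=> K; rewrite /tensor -big_split /=; apply: eq_bigr => k _.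
have /rowP/(_ (K k)) := UV k; rewrite !mxE !ffunE => ->.
by [].
Qed.

(** Apply T to the tensor product of orthogonal lifts of the basis vectors of
    indices J k: this is T applied to the image of the standard vector under a
    tensor power, hence 0. Only rearrangements K of J can contribute to its
    entry at I, and the fresh coordinates do not occur in them, so the entry is
    a nonzero multiple of T I J. *)
Lemma commutes_eq0 (T : idx -> idx -> C) : commutes T ->
  (forall I, T I std_idx = 0) -> forall I J, T I J = 0.
Proof.
move=> cT T0 I J; apply/eqP/negPn/negP => TIJ.
have [v [vreal vpos vorth vJ]] := orthogonal_lifts J.
have [A Au [c c0 tensorA]] := unitary_lifts vreal vpos vorth.
have := cT A Au I std_idx.
rewrite [RHS]big1; last by move=> K _; rewrite T0 mulr0.
rewrite (bigD1 J) //= tensorA big1 ?mulr1; last first.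
  by move=> k _; rewrite vJ ?eqxx // imset_f ?inE.
rewrite big1 ?addr0; first by move=> /eqP; rewrite mulf_eq0 (negPf TIJ) (negPf c0).
move=> K KJ; have [->|TIK] := eqVneq (T I K) 0; first by rewrite mul0r.
have [s Is] := commutes_weight cT TIJ; have [t It] := commutes_weight cT TIK.
have KE : K = relabel J (t^-1 * s)%g.
  by rewrite -relabelM -Is It relabelM mulVg relabel1.
have [k Kk] : exists k, K k != J k.
  apply/existsP; apply: contraNT KJ; rewrite negb_exists => /forallP H.
  by apply/eqP/ffunP => k; apply/eqP; rewrite -[_ == _]negbK H.
rewrite tensorA (bigD1 k) //= vJ; last by rewrite KE ffunE imset_f ?inE.
by rewrite (negPf Kk) mul0r !mulr0.
Qed.

Lemma std_idx_inj : injective std_idx.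
Proof. by move=> i j; rewrite !ffunE => /(congr1 val) /= /val_inj. Qed.

(** Subtract from T the combination of permutations with the same standard
    column; the difference is in the commutant and has standard column 0. *)
Theorem commutes_comb (T : idx -> idx -> C) : commutes T ->
  exists c : {perm 'I_n} -> C,
    forall I J, T I J = \sum_s c s * (I == relabel J s)%:R.
Proof.
move=> cT; pose c s := T (relabel std_idx s) std_idx; exists c => I J.
apply/eqP; rewrite -subr_eq0; apply/eqP.
refine (commutes_eq0 (commutes_sub_comb c cT) _ I J) => {}I.
have relabel_std s t : (relabel std_idx s == relabel std_idx t) = (s == t).
  apply/eqP/eqP => [/ffunP E|-> //]; apply/permP => k; apply: std_idx_inj.
  by have := E k; rewrite !ffunE.
have [[s /eqP ->]|noS] := pselect (exists s, I == relabel std_idx s).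
  rewrite (bigD1 s) //= eqxx mulr1 big1 ?addr0 ?subrr // => t ts.
  by rewrite relabel_std eq_sym (negPf ts) mulr0.
have [->|TI] := eqVneq (T I std_idx) 0.
  rewrite big1 ?subrr // => s _; case: eqP => [E|]; last by rewrite mulr0.
  by case: noS; exists s; apply/eqP.
by case: noS; have [s ->] := commutes_weight cT TI; exists s.
Qed.

End Commutant.

(** * Integration over the unitary group *)

Section WeingartenFormula.
Local Open Scope sesquilinear_scope.
Variables (C : numClosedFieldType) (n N : nat).
Hypothesis large : (n + n * n <= N)%N.
Hypothesis N_gt0 : (0 < N)%N.
Local Notation idx := {ffun 'I_n -> 'I_N}.
Implicit Types (I J K L : idx) (s t : {perm 'I_n}).
Variable mom : idx -> idx -> idx -> idx -> C.
Hypothesis mom_inv : forall A : 'M[C]_N, A \is unitarymx -> forall I J I' J',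
  mom I J I' J' = \sum_K \sum_K' tensor A I K * (tensor A I' K')^* * mom K J K' J'.
Hypothesis mom_trace : forall J J', \sum_I mom I J I J' = (J == J')%:R.
Hypothesis mom_relabel : forall I J I' J' s,
  mom (relabel I s) (relabel J s) I' J' = mom I J I' J'.
Variable w : {perm 'I_n} -> C.
Hypothesis w_gram : forall s, convol w (gram C N) s = (s == 1%g)%:R.

Lemma mom_commutes J J' : commutes (fun I I' => mom I J I' J').
Proof.
move=> A Au I L.
transitivity (\sum_K \sum_K' tensor A I K * mom K J K' J' * (K' == L)%:R).
  under eq_bigr do rewrite (mom_inv Au) mulr_suml.
  rewrite exchange_big; apply: eq_bigr => K _ /=.
  under eq_bigr do rewrite mulr_suml.
  rewrite exchange_big; apply: eq_bigr => K' _ /=.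
  have /esym/(congr1 (fun M => tensor M K' L)) : A^t* *m A = 1%:M.
    by apply/mulmx1C/unitarymxP.
  rewrite /= tensor1 tensor_mul => ->; rewrite mulr_sumr.
  by apply: eq_bigr => I' _; rewrite tensor_adj; ring.
by apply: eq_bigr => K _; rewrite sum_diracr.
Qed.

Lemma sum_relabel_eq s t :
  \sum_(I : idx) (relabel I s == relabel I t)%:R = N%:R ^+ n * gram C N (s^-1 * t).
Proof.
rewrite /gram mulrCA divff ?mulr1; last by rewrite expf_neq0 // pnatr_eq0 -lt0n.
rewrite /nfix -sum1_card natr_sum [RHS]big_mkcond /=; apply: eq_bigr => I _.
rewrite inE; have -> : (relabel I s == relabel I t) =
   [forall i, I ((s^-1 * t)%g i) == I i].
  apply/eqP/nfixP => [/ffunP E i|E].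
    by have := E (s^-1 i)%g; rewrite !ffunE permKV permM => ->.
  apply/ffunP => k; rewrite !ffunE.
  by have := E (s k); rewrite permM permK => ->.
by case: ifP.
Qed.

Lemma w_gram_shift s u :
  \sum_t w (s^-1 * t)%g * gram C N (t^-1 * u) = (s == u)%:R.
Proof.
rewrite (reindex_inj (mulgI s)) /=; under eq_bigr do rewrite mulKg invMg -mulgA.
by have := w_gram (s^-1 * u); rewrite /convol => ->; rewrite -eq_mulVg1.
Qed.

(** For fixed J and J', the moments are a combination of permutations with some
    coefficients c. Summing over I = relabel I' t on one hand uses unitarity,
    and on the other hand gives the convolution of c with gram, which w inverts. *)
Theorem weingarten_formula I J I' J' : mom I J I' J' =
  N%:R ^- n * \sum_s \sum_t w (s^-1 * t)%g
     * (I == relabel I' s)%:R * (J == relabel J' t)%:R.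
Proof.
have [c cE] := commutes_comb large (mom_commutes J J').
have Nn : N%:R ^+ n != 0 :> C by rewrite expf_neq0 // pnatr_eq0 -lt0n.
have Gc t : N%:R ^+ n * \sum_s c s * gram C N (t^-1 * s)%g = (J == relabel J' t)%:R.
  transitivity (\sum_K mom (relabel K t) J K J').
    under [RHS]eq_bigr do rewrite cE.
    rewrite exchange_big mulr_sumr; apply: eq_bigr => s _ /=.
    by rewrite -mulr_sumr sum_relabel_eq mulrCA.
  have E K : mom (relabel K t) J K J' = mom K (relabel J t^-1) K J'.
    by rewrite -(mom_relabel K (relabel J t^-1) K J' t) relabelM mulgV relabel1.
  under eq_bigr do rewrite E.
  rewrite mom_trace; congr (nat_of_bool _)%:R.
  by rewrite eq_sym eq_relabel invgK.
have cw s : c s = N%:R ^- n * \sum_t w (s^-1 * t)%g * (J == relabel J' t)%:R.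
  under eq_bigr do rewrite -Gc mulrCA.
  rewrite -mulr_sumr mulKf //.
  under eq_bigr do rewrite mulr_sumr.
  rewrite exchange_big /= (bigD1 s) //= [X in _ + X]big1 ?addr0 => [|u us];
    under eq_bigr do rewrite mulrCA; rewrite -mulr_sumr w_gram_shift.
    by rewrite eqxx mulr1.
  by rewrite eq_sym (negPf us) mulr0.
rewrite cE mulr_sumr; apply: eq_bigr => s _.
rewrite cw -mulrA; congr (_ * _); rewrite mulr_suml; apply: eq_bigr => t _.
by rewrite mulrAC.
Qed.

(** Four permutations appear after inserting the formula for U and for V. The
    Kronecker symbols leave a single free multi-index, whose summation produces
    N^n gram; this gram is absorbed by one of the two factors w, and identifies
    one of the permutations with a conjugate of the inverse of another. *)
Theorem commutator_moment :
  N%:R ^+ n * \sum_a \sum_b \sum_c \sum_e mom a b e c * mom b c a e =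
  \sum_s \sum_t w (s * t * s^-1 * t^-1)%g.
Proof.
have Nn : N%:R ^+ n != 0 :> C by rewrite expf_neq0 // pnatr_eq0 -lt0n.
have step e : \sum_a \sum_b \sum_c mom a b e c * mom b c a e =
  N%:R ^- n * N%:R ^- n * \sum_s \sum_t \sum_s' \sum_t'
     w (s^-1 * t)%g * w (s'^-1 * t')%g
      * (relabel e (t * t') == relabel e (s' * s))%:R.
  transitivity (N%:R ^- n * N%:R ^- n * \sum_a \sum_b \sum_c \sum_s \sum_t \sum_s' \sum_t'
     w (s^-1 * t)%g * w (s'^-1 * t')%g * (a == relabel e s)%:R * (b == relabel c t)%:R *
     (b == relabel a s')%:R * (c == relabel e t')%:R).
    rewrite mulr_sumr; apply: eq_bigr => a _; rewrite mulr_sumr; apply: eq_bigr => b _.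
    rewrite mulr_sumr; apply: eq_bigr => c _; rewrite !weingarten_formula mulrACA.
    congr (_ * _); rewrite mulr_suml; apply: eq_bigr => s _.
    rewrite mulr_suml; apply: eq_bigr => t _.
    rewrite mulr_sumr; apply: eq_bigr => s' _.
    by rewrite mulr_sumr; apply: eq_bigr => t' _; ring.
  congr (_ * _).
  under eq_bigr do under eq_bigr do rewrite exchange_big.
  under eq_bigr do rewrite exchange_big.
  rewrite exchange_big; apply: eq_bigr => s _ /=.
  under eq_bigr do under eq_bigr do rewrite exchange_big.
  under eq_bigr do rewrite exchange_big.
  rewrite exchange_big; apply: eq_bigr => t _ /=.
  under eq_bigr do under eq_bigr do rewrite exchange_big.
  under eq_bigr do rewrite exchange_big.
  rewrite exchange_big; apply: eq_bigr => s' _ /=.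
  under eq_bigr do under eq_bigr do rewrite exchange_big.
  under eq_bigr do rewrite exchange_big.
  rewrite exchange_big; apply: eq_bigr => t' _ /=.
  under eq_bigr do under eq_bigr do rewrite sum_diracr.
  transitivity (\sum_a \sum_b w (s^-1 * t)%g * w (s'^-1 * t')%g *
     (relabel e (t * t') == relabel a s')%:R * (b == relabel e (t * t'))%:R * (a == relabel e s)%:R).
    apply: eq_bigr => a _; apply: eq_bigr => b _; rewrite relabelM.
    by have [->|_] := eqVneq b; rewrite ?mulr0 ?mul0r //; ring.
  under eq_bigr do rewrite -mulr_suml sum_diracr.
  by rewrite sum_diracr relabelM.
have {}step : \sum_a \sum_b \sum_c \sum_e mom a b e c * mom b c a e =
   N%:R ^- n * \sum_s \sum_t \sum_s' \sum_t'
     w (s^-1 * t)%g * w (s'^-1 * t')%g * gram C N (t'^-1 * (t^-1 * s' * s)).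
  under eq_bigr do under eq_bigr do rewrite exchange_big.
  under eq_bigr do rewrite exchange_big.
  rewrite exchange_big; under eq_bigr do rewrite step.
  rewrite -mulr_sumr -mulrA; congr (_ * _).
  rewrite exchange_big mulr_sumr; apply: eq_bigr => s _ /=.
  rewrite exchange_big mulr_sumr; apply: eq_bigr => t _ /=.
  rewrite exchange_big mulr_sumr; apply: eq_bigr => s' _ /=.
  rewrite exchange_big mulr_sumr; apply: eq_bigr => t' _ /=.
  rewrite -mulr_sumr sum_relabel_eq invMg !mulgA mulrCA; congr (_ * _).
  by rewrite mulKf.
rewrite step mulVKf // (reindex_inj invg_inj) /=; apply: eq_bigr => s _.
rewrite exchange_big; apply: eq_bigr => s' _ /=.
under eq_bigr do under eq_bigr do rewrite -mulrA.
under eq_bigr do rewrite -mulr_sumr w_gram_shift.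
(* only the permutation for which the argument of the remaining Kronecker symbol
   is trivial survives *)
rewrite invgK (bigD1 (s' * s^-1 * s'^-1)%g) //= [X in _ + X]big1 ?addr0.
  by rewrite !invMg !invgK !mulgA mulgKV mulgK eqxx mulr1.
move=> t tN; case: eqP => [E|]; last by rewrite mulr0.
have E2 : (t * s' = s' * s^-1)%g by rewrite [in LHS]E !mulgA mulgV mul1g.
by case/eqP: tN; rewrite -E2 mulgK.
Qed.

End WeingartenFormula.

(** * Real and imaginary parts *)

Section ComplexParts.
Variable R : realType.
Implicit Types (z w : CC R).
Local Notation Re := (@complex.Re R).
Local Notation Im := (@complex.Im R).

Lemma cc_eq z w : Re z = Re w -> Im z = Im w -> z = w.
Proof. by case: z => a b; case: w => c e /= -> ->. Qed.

Lemma cReD z w : Re (z + w) = Re z + Re w. Proof. by case: z; case: w. Qed.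
Lemma cImD z w : Im (z + w) = Im z + Im w. Proof. by case: z; case: w. Qed.
Lemma cReN z : Re (- z) = - Re z. Proof. by case: z. Qed.
Lemma cImN z : Im (- z) = - Im z. Proof. by case: z. Qed.
Lemma cReM z w : Re (z * w) = Re z * Re w - Im z * Im w.
Proof. by case: z; case: w. Qed.
Lemma cImM z w : Im (z * w) = Re z * Im w + Im z * Re w.
Proof. by case: z; case: w. Qed.
Lemma cRe_conj z : Re (z^*) = Re z. Proof. by case: z. Qed.
Lemma cIm_conj z : Im (z^*) = - Im z. Proof. by case: z. Qed.

Lemma cRe_sum I (r : seq I) (P : pred I) (F : I -> CC R) :
  Re (\sum_(i <- r | P i) F i) = \sum_(i <- r | P i) Re (F i).
Proof. by apply: (big_morph Re cReD). Qed.
Lemma cIm_sum I (r : seq I) (P : pred I) (F : I -> CC R) :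
  Im (\sum_(i <- r | P i) F i) = \sum_(i <- r | P i) Im (F i).
Proof. by apply: (big_morph Im cImD). Qed.

Lemma normc_real z : `|z| = (Re `|z|)%:C%C.
Proof. by case: z => a b; rewrite normc_def. Qed.

Lemma cRe_le_norm z : `|Re z| <= Re `|z|.
Proof.
case: z => a b; rewrite normc_def /= -sqrtr_sqr ler_wsqrtr //.
by rewrite lerDl sqr_ge0.
Qed.

Lemma cIm_le_norm z : `|Im z| <= Re `|z|.
Proof.
case: z => a b; rewrite normc_def /= -sqrtr_sqr ler_wsqrtr //.
by rewrite lerDr sqr_ge0.
Qed.

Lemma cnorm_le z : `|z| <= (`|Re z| + `|Im z|)%:C%C.
Proof.
case: z => a b; rewrite normc_def lecR /=.
rewrite -[leRHS]ger0_norm ?addr_ge0 // -sqrtr_sqr ler_wsqrtr //.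
rewrite sqrrD !real_normK ?num_real //.
by rewrite lerD2r lerDl mulrn_wge0 // mulr_ge0.
Qed.

Lemma cRe_norm_le z (B : R) : (`|z| <= B%:C%C) = (Re `|z| <= B).
Proof. by rewrite normc_real lecR. Qed.

End ComplexParts.

(** * Integrals of bounded complex functions *)

Section ComplexIntegral.
Local Open Scope classical_set_scope.
Variables (R : realType) (d : measure_display) (T : measurableType d).
Local Notation Re := (@complex.Re R).
Local Notation Im := (@complex.Im R).
Implicit Types (f g : T -> CC R).

(** On a probability space these functions are integrable and form an algebra,
    which contains all functions integrated below. *)
Definition bounded_measurable f :=
  [/\ measurable_fun [set: T] (fun x => Re (f x)),
      measurable_fun [set: T] (fun x => Im (f x))
    & exists B : R, forall x, `|f x| <= B%:C%C].

Lemma bounded_measurable_cst c : bounded_measurable (fun=> c).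
Proof.
split; [exact: measurable_cst|exact: measurable_cst|].
by exists (Re `|c|) => x; rewrite -normc_real.
Qed.

Lemma bounded_measurableD f g : bounded_measurable f -> bounded_measurable g ->
  bounded_measurable (fun x => f x + g x).
Proof.
move=> [fr fi [B fB]] [gr gi [B' gB]]; split.
- by under eq_fun do rewrite cReD; exact: measurable_realfun.measurable_funD.
- by under eq_fun do rewrite cImD; exact: measurable_realfun.measurable_funD.
- exists (B + B') => x; rewrite (rmorphD (real_complex R)).
  by apply: le_trans (ler_normD _ _) _; apply: lerD.
Qed.

Lemma bounded_measurableM f g : bounded_measurable f -> bounded_measurable g ->
  bounded_measurable (fun x => f x * g x).
Proof.
move=> [fr fi [B fB]] [gr gi [B' gB]]; split.
- under eq_fun do rewrite cReM.
  by apply: measurable_realfun.measurable_funB; exact: measurable_realfun.measurable_funM.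
- under eq_fun do rewrite cImM.
  by apply: measurable_realfun.measurable_funD; exact: measurable_realfun.measurable_funM.
- exists (B * B') => x; rewrite (rmorphM (real_complex R)) normrM.
  exact: ler_pM.
Qed.

Lemma bounded_measurable_conj f : bounded_measurable f ->
  bounded_measurable (fun x => (f x)^*).
Proof.
move=> [fr fi [B fB]]; split.
- by under eq_fun do rewrite cRe_conj.
- by under eq_fun do rewrite cIm_conj; exact: measurableT_comp.
- by exists B => x; rewrite norm_conjC.
Qed.

Lemma bounded_measurable_sum I (r : seq I) (F : I -> T -> CC R) :
  (forall i, bounded_measurable (F i)) ->
  bounded_measurable (fun x => \sum_(i <- r) F i x).
Proof.
move=> FB; elim: r => [|i r IHr].
  by under eq_fun do rewrite big_nil; exact: bounded_measurable_cst.
by under eq_fun do rewrite big_cons; exact: bounded_measurableD.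
Qed.

Lemma bounded_measurable_prod I (r : seq I) (F : I -> T -> CC R) :
  (forall i, bounded_measurable (F i)) ->
  bounded_measurable (fun x => \prod_(i <- r) F i x).
Proof.
move=> FB; elim: r => [|i r IHr].
  by under eq_fun do rewrite big_nil; exact: bounded_measurable_cst.
by under eq_fun do rewrite big_cons; exact: bounded_measurableM.
Qed.

Variable mu : {measure set T -> \bar R}.
Hypothesis mu1 : mu [set: T] = 1%E.

Lemma bounded_integrable (h : T -> R) (B : R) : measurable_fun [set: T] h ->
  (forall x, `|h x| <= B) -> mu.-integrable [set: T] (EFin \o h).
Proof.
move=> mh hB; apply: measurable_bounded_integrable => //; first by rewrite mu1 ltry.
exists B; split; first exact: num_real.
by move=> M BM x _ /=; apply: le_trans (hB x) (ltW BM).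
Qed.

Lemma bounded_measurable_integrable f : bounded_measurable f ->
  mu.-integrable [set: T] (EFin \o (fun x => Re (f x))) /\
  mu.-integrable [set: T] (EFin \o (fun x => Im (f x))).
Proof.
move=> [fr fi [B fB]]; split; apply: (@bounded_integrable _ B) => // x.
  by apply: le_trans (cRe_le_norm _) _; rewrite -cRe_norm_le.
by apply: le_trans (cIm_le_norm _) _; rewrite -cRe_norm_le.
Qed.

Lemma cintegral_cst c : cintegral mu (fun=> c) = c.
Proof. by apply: cc_eq => /=; rewrite Rintegral_cst // mu1 mulr1. Qed.

Lemma cintegralD f g : bounded_measurable f -> bounded_measurable g ->
  cintegral mu (fun x => f x + g x) = cintegral mu f + cintegral mu g.
Proof.
move=> /bounded_measurable_integrable[fr fi] /bounded_measurable_integrable[gr gi].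
by apply: cc_eq; rewrite ?cReD ?cImD /= -RintegralD //; apply: eq_Rintegral => x _;
  rewrite ?cReD ?cImD.
Qed.

Lemma cintegralZ c f : bounded_measurable f ->
  cintegral mu (fun x => c * f x) = c * cintegral mu f.
Proof.
move=> bf; have [fr fi] := bounded_measurable_integrable bf.
have Z (a : R) (h : T -> R) : mu.-integrable [set: T] (EFin \o h) ->
    mu.-integrable [set: T] (EFin \o (fun x => a * h x)).
  move=> ih; rewrite (_ : _ \o _ = (fun x => a%:E * (EFin \o h) x)%E); last first.
    by apply/funext => x /=; rewrite EFinM.
  exact: integrableZl.
apply: cc_eq; rewrite ?cReM ?cImM /= -!RintegralZl //.
  rewrite -RintegralB //; [|exact: Z|exact: Z].
  by apply: eq_Rintegral => x _; rewrite cReM.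
rewrite -RintegralD //; [|exact: Z|exact: Z].
by apply: eq_Rintegral => x _; rewrite cImM.
Qed.

Lemma cintegral_sum I (r : seq I) (F : I -> T -> CC R) :
  (forall i, bounded_measurable (F i)) ->
  cintegral mu (fun x => \sum_(i <- r) F i x) = \sum_(i <- r) cintegral mu (F i).
Proof.
move=> FB; elim: r => [|i r IHr].
  by under eq_fun do rewrite big_nil; rewrite big_nil cintegral_cst.
under eq_fun do rewrite big_cons; rewrite big_cons cintegralD ?IHr //.
exact: bounded_measurable_sum.
Qed.

(** Real and imaginary parts are estimated separately, which costs the factor 2. *)
Lemma cintegral_bound f (e : R) : bounded_measurable f ->
  (forall x, `|f x| <= e%:C%C) -> `|cintegral mu f| <= (e + e)%:C%C.
Proof.
move=> bf fe; have [fr fi] := bounded_measurable_integrable bf.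
apply: le_trans (cnorm_le _) _; rewrite lecR /=.
have bound (h : T -> R) : mu.-integrable [set: T] (EFin \o h) -> (forall x, `|h x| <= e) ->
    `|\int[mu]_x h x| <= e.
  move=> ih he; apply: le_trans (le_normr_Rintegral _ ih) _ => //.
  rewrite -[leRHS]mulr1 -[X in _ * X](_ : fine (mu setT) = 1); last by rewrite mu1.
  rewrite -Rintegral_cst //; apply: le_Rintegral => //.
    by rewrite (_ : _ \o _ = abse \o (EFin \o h)) //; exact: integrable_abse.
  by apply: (@bounded_integrable _ `|e|) => // x; exact: measurable_cst.
apply: lerD; apply: bound => // x.
  by apply: le_trans (cRe_le_norm _) _; rewrite -cRe_norm_le.
by apply: le_trans (cIm_le_norm _) _; rewrite -cRe_norm_le.
Qed.

End ComplexIntegral.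

(** * Haar measure *)

Section UnitaryMeasurability.
Local Open Scope classical_set_scope.
Variables (R : realType) (N : nat).
Local Notation M := 'M[CC R]_N.
Local Notation UN := (unitary R N).

Lemma open_val_measurable (O : set M) : open O ->
  measurable ((fun U : UN => (U : M)) @^-1` O).
Proof. by move=> openO; apply: sub_sigma_algebra; exists O. Qed.

(** The function h stands for the real or the imaginary part, both of Lipschitz
    constant 1. *)
Lemma open_ray (h : CC R -> R) : (forall z w, `|h z - h w| <= complex.Re `|z - w|) ->
  forall (a : R) (i j : 'I_N), open [set X : M | a < h (X i j)].
Proof.
move=> hlip a i j; rewrite openE => X /= aX.
have e0 : (0 : CC R) < (h (X i j) - a)%:C%C by rewrite ltcR subr_gt0.
apply/nbhs_ballP; exists (h (X i j) - a)%:C%C => //= Y [_ /(_ i j)].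
rewrite -ball_normE /= normc_real ltcR => lt.
have := le_lt_trans (ler_norm _) (le_lt_trans (hlip _ _) lt).
by rewrite ltrD2l ltrN2.
Qed.

Lemma entry_part_measurable (h : CC R -> R) i j :
  (forall z w, `|h z - h w| <= complex.Re `|z - w|) ->
  measurable_fun [set: UN] (fun U : UN => h ((U : M) i j)).
Proof.
move=> hlip; apply: (measurability _ (measurable_realfun.RGenOInfty.measurableE R)).
move=> _ [_ [a ->] <-]; rewrite setTI.
rewrite (_ : _ @^-1` _ = (fun U : UN => (U : M)) @^-1` [set X : M | a < h (X i j)]).
  exact: (open_val_measurable (@open_ray h hlip a i j)).
by apply/seteqP; split=> U /=; rewrite in_itv /= andbT.
Qed.

Lemma unitary_entry_le1 (U : UN) i j : `|(U : M) i j| <= 1.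
Proof.
have /unitarymxP/matrixP/(_ i i) := svalP U; rewrite !mxE eqxx => E.
rewrite -(@expr_le1 _ 2) // normCK -[leRHS]E (bigD1 j) //= !mxE lerDl.
by apply: sumr_ge0 => k _; rewrite !mxE mul_conjC_ge0.
Qed.

Lemma bounded_measurable_entry i j : bounded_measurable (fun U : UN => (U : M) i j).
Proof.
split.
- apply: (@entry_part_measurable (@complex.Re R)) => z w.
  by rewrite -cReN -cReD; exact: cRe_le_norm.
- apply: (@entry_part_measurable (@complex.Im R)) => z w.
  by rewrite -cImN -cImD; exact: cIm_le_norm.
- by exists 1 => U; exact: unitary_entry_le1.
Qed.

Lemma open_mulmx (A : M) (O : set M) : open O -> open (mulmx A @^-1` O).
Proof.
rewrite !openE => openO X /= /openO /nbhs_ballP[e /= e0 ballO].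
pose K : CC R := \sum_i \sum_j `|A i j|.
have K0 : 0 <= K by apply: sumr_ge0 => i _; exact: sumr_ge0.
have K1 : 0 < K + 1 by rewrite ltr_wpDl.
apply/nbhs_ballP; exists (e / (K + 1)) => /=; first exact: divr_gt0.
move=> Y [_ XY]; apply: ballO; split=> // i j.
have {}XY k l : `|X k l - Y k l| <= e / (K + 1).
  by have := XY k l; rewrite -ball_normE /= => /ltW.
rewrite -ball_normE /= !mxE -sumrB.
apply: (@le_lt_trans _ _ (K * (e / (K + 1)))).
  apply: le_trans (ler_norm_sum _ _ _) _.
  apply: (@le_trans _ _ (\sum_k `|A i k| * (e / (K + 1)))).
    by apply: ler_sum => k _; rewrite -mulrBr normrM ler_wpM2l.
  rewrite -mulr_suml ler_wpM2r //; first by apply/ltW/divr_gt0.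
  by rewrite /K [leRHS](bigD1 i) //= lerDl sumr_ge0 // => k _; exact: sumr_ge0.
by rewrite mulrCA gtr_pMr // ltr_pdivrMr // mul1r ltrDl.
Qed.

(** The sigma-algebra is generated by the open sets, and left multiplication is
    continuous. *)
Lemma unitary_mul_measurable (A : UN) : measurable_fun [set: UN] (unitary_mul A).
Proof.
refine (@measurability _ _ UN UN setT (unitary_mul A) (@unitary_open R N) erefl _).
move=> _ [_ [Q openQ <-] <-].
rewrite setTI; apply: sub_sigma_algebra; exists (mulmx (A : M) @^-1` Q) => //.
exact: open_mulmx.
Qed.

Lemma unitary_mulA_inv (A : UN) : exists B : UN,
  (forall U, unitary_mul A (unitary_mul B U) = U) /\
  (forall U, unitary_mul B (unitary_mul A U) = U).
Proof.
have Au := svalP A; have Bu : (map_mx Num.conj (sval A)^T) \is unitarymx.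
  by rewrite trmxC_unitary.
exists (exist (fun X : M => X \is unitarymx) _ Bu).
split=> U; apply: val_inj => /=.
  by rewrite mulmxA (unitarymxP Au) mul1mx.
rewrite mulmxA [X in X *m _](_ : _ = 1%:M) ?mul1mx //.
exact/mulmx1C/(unitarymxP Au).
Qed.

Variable mu : probability UN R.
Hypothesis haar : is_haar mu.

(** Invariance is assumed for images; the preimage is the image under the
    inverse matrix. *)
Lemma haar_preimage (A : UN) (S : set UN) : measurable S ->
  mu (unitary_mul A @^-1` S) = mu S.
Proof.
move=> mS; have [B [AB BA]] := unitary_mulA_inv A.
rewrite -(haar B mS); congr (mu _); apply/seteqP; split=> U /=.
  by move=> SU; exists (unitary_mul A U).
by move=> [V SV <-]; rewrite AB.
Qed.

Lemma haar_Rintegral (A : UN) (h : UN -> R) (b : R) : measurable_fun [set: UN] h ->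
  (forall U, `|h U| <= b) ->
  \int[mu]_U h (unitary_mul A U) = \int[mu]_U h U.
Proof.
move=> mh hb; have mA := unitary_mul_measurable A.
congr fine.
transitivity (\int[pushforward mu (unitary_mul A)]_U (EFin \o h) U)%E.
  rewrite integral_pushforward //.
  - exact/measurable_realfun.measurable_EFinP.
  - rewrite preimage_setT.
    apply: (@bounded_integrable _ _ _ _ (probability_setT mu) (h \o unitary_mul A) b) => //.
      exact: measurableT_comp.
    by move=> U; exact: hb.
pose nu : {measure set UN -> \bar R} :=
  measure_function_pushforward__canonical__measure_function_Measure mu mA.
refine (@eq_measure_integral _ _ _ setT mu nu (EFin \o h) _) => S mS _.
exact: haar_preimage.
Qed.

Lemma haar_cintegral (A : UN) (f : UN -> CC R) : bounded_measurable f ->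
  cintegral mu (fun U => f (unitary_mul A U)) = cintegral mu f.
Proof.
move=> [fr fi [B fB]]; apply: cc_eq => /=.
  rewrite (@haar_Rintegral A (fun U => complex.Re (f U)) B) // => U.
  by apply: le_trans (cRe_le_norm _) _; rewrite -cRe_norm_le.
rewrite (@haar_Rintegral A (fun U => complex.Im (f U)) B) // => U.
by apply: le_trans (cIm_le_norm _) _; rewrite -cRe_norm_le.
Qed.

End UnitaryMeasurability.

(** * Products of independent factors *)

Section ProductIntegral.
Local Open Scope classical_set_scope.
Variables (R : realType) (d : measure_display) (T : measurableType d).
Variable mu : probability T R.

Lemma bounded_measurable_fst (f : T -> CC R) : bounded_measurable f ->
  bounded_measurable (fun xy : T * T => f xy.1).
Proof.
move=> [fr fi [B fB]]; split; last by exists B.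
  exact: (measurableT_comp fr measurable_fst).
exact: (measurableT_comp fi measurable_fst).
Qed.

Lemma bounded_measurable_snd (f : T -> CC R) : bounded_measurable f ->
  bounded_measurable (fun xy : T * T => f xy.2).
Proof.
move=> [fr fi [B fB]]; split; last by exists B.
  exact: (measurableT_comp fr measurable_snd).
exact: (measurableT_comp fi measurable_snd).
Qed.

Lemma Rintegral_prod (h k : T -> R) (b c : R) :
  measurable_fun [set: T] h -> (forall x, `|h x| <= b) ->
  measurable_fun [set: T] k -> (forall x, `|k x| <= c) ->
  \int[(mu \x mu)%E]_xy (h xy.1 * k xy.2) = \int[mu]_x h x * \int[mu]_x k x.
Proof.
move=> mh hb mk kc.
have ih := bounded_integrable (probability_setT mu) mh hb.
have ik := bounded_integrable (probability_setT mu) mk kc.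
have ihk : (mu \x mu)%E.-integrable [set: T * T] (EFin \o (fun xy : T * T => h xy.1 * k xy.2)).
  apply: (@bounded_integrable _ _ _ _ (probability_setT _) _ (b * c)).
    apply: measurable_realfun.measurable_funM.
      exact: (measurableT_comp mh measurable_fst).
    exact: (measurableT_comp mk measurable_snd).
  by move=> xy; rewrite normrM; apply: ler_pM.
rewrite /Rintegral -(integral12_prod_meas1 ihk) /fubini_F /=.
rewrite (_ : (\int[mu]_x _)%E = (\int[mu]_x (h x * \int[mu]_y k y)%:E)%E); last first.
  apply: eq_integral => x _; under eq_integral do rewrite EFinM.
  rewrite integralZl // EFinM; congr (_ * _)%E.
  by rewrite /Rintegral fineK //; exact: integrable_fin_num.
by rewrite -/(Rintegral mu setT (fun x => h x * \int[mu]_y k y)) RintegralZr.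
Qed.

Lemma cintegral_prod (f g : T -> CC R) : bounded_measurable f -> bounded_measurable g ->
  cintegral (mu \x mu)%E (fun xy => f xy.1 * g xy.2) = cintegral mu f * cintegral mu g.
Proof.
move=> bf bg; have [fr fi [B fB]] := bf; have [gr gi [B' gB]] := bg.
have fRe x : `|complex.Re (f x)| <= B.
  by apply: le_trans (cRe_le_norm _) _; rewrite -cRe_norm_le.
have fIm x : `|complex.Im (f x)| <= B.
  by apply: le_trans (cIm_le_norm _) _; rewrite -cRe_norm_le.
have gRe x : `|complex.Re (g x)| <= B'.
  by apply: le_trans (cRe_le_norm _) _; rewrite -cRe_norm_le.
have gIm x : `|complex.Im (g x)| <= B'.
  by apply: le_trans (cIm_le_norm _) _; rewrite -cRe_norm_le.
have iprod (h k : T -> R) : measurable_fun [set: T] h -> (forall x, `|h x| <= B) ->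
   measurable_fun [set: T] k -> (forall x, `|k x| <= B') ->
   (mu \x mu)%E.-integrable [set: T * T] (EFin \o (fun xy : T * T => h xy.1 * k xy.2)).
  move=> mh hb mk kc; apply: (@bounded_integrable _ _ _ _ (probability_setT _) _ (B * B')).
    apply: measurable_realfun.measurable_funM.
      exact: (measurableT_comp mh measurable_fst).
    exact: (measurableT_comp mk measurable_snd).
  by move=> xy; rewrite normrM; apply: ler_pM.
apply: cc_eq; rewrite ?cReM ?cImM /=.
  rewrite -(Rintegral_prod fr fRe gr gRe) -(Rintegral_prod fi fIm gi gIm).
  rewrite -RintegralB //; [|exact: (iprod _ _ fr fRe gr gRe)
    |exact: (iprod _ _ fi fIm gi gIm)].
  by apply: eq_Rintegral => x _; rewrite cReM.
rewrite -(Rintegral_prod fr fRe gi gIm) -(Rintegral_prod fi fIm gr gRe).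
rewrite -RintegralD //; [|exact: (iprod _ _ fr fRe gi gIm)
  |exact: (iprod _ _ fi fIm gr gRe)].
by apply: eq_Rintegral => x _; rewrite cImM.
Qed.

End ProductIntegral.

(** * Moments of the trace of a commutator *)

Section CommutatorTrace.
Local Open Scope classical_set_scope.
Local Open Scope sesquilinear_scope.
Variables (R : realType) (N : nat) (mu : probability (unitary R N) R).
Local Notation C := (CC R).
Local Notation UN := (unitary R N).

Definition commutator_trace (UV : UN * UN) : C :=
  let U : 'M[C]_N := UV.1 in let V : 'M[C]_N := UV.2 in
  \tr (U *m V *m U ^t* *m V ^t*).

Definition trace_moment n : C :=
  N%:R ^+ n * cintegral (mu \x mu)%E (fun UV => commutator_trace UV ^+ n).

Let mu2_setT : (mu \x mu)%E [set: UN * UN] = 1%E := probability_setT _.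

Lemma bounded_measurable_tensor n (I J : {ffun 'I_n -> 'I_N}) :
  bounded_measurable (fun U : UN => tensor (U : 'M[C]_N) I J).
Proof.
by apply: bounded_measurable_prod => k; exact: bounded_measurable_entry.
Qed.

(** The n-th power of a trace is the trace of the n-th tensor power, and tensor
    powers are multiplicative. *)
Lemma commutator_traceX n UV : commutator_trace UV ^+ n =
  \sum_(a : {ffun 'I_n -> 'I_N}) \sum_(b : {ffun 'I_n -> 'I_N})
  \sum_(c : {ffun 'I_n -> 'I_N}) \sum_(e : {ffun 'I_n -> 'I_N})
   (tensor (UV.1 : 'M[C]_N) a b * (tensor (UV.1 : 'M[C]_N) e c)^*)
   * (tensor (UV.2 : 'M[C]_N) b c * (tensor (UV.2 : 'M[C]_N) a e)^*).
Proof.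
rewrite -[n in LHS]card_ord -prodr_const /commutator_trace /mxtrace.
rewrite bigA_distr_bigA; apply: eq_bigr => a _.
rewrite -[LHS]/(tensor (UV.1 *m UV.2 *m (UV.1 : 'M[C]_N) ^t* *m (UV.2 : 'M[C]_N) ^t*) a a).
rewrite tensor_mul; under eq_bigr do rewrite tensor_mul mulr_suml.
under eq_bigr do under eq_bigr do rewrite tensor_mul !mulr_suml.
under [RHS]eq_bigr do rewrite exchange_big.
rewrite [RHS]exchange_big; apply: eq_bigr => e _ /=.
rewrite [RHS]exchange_big; apply: eq_bigr => c _; apply: eq_bigr => b _ /=.
by rewrite !tensor_adj; ring.
Qed.

Lemma bounded_measurable_tensors n (I J I' J' : {ffun 'I_n -> 'I_N}) :
  bounded_measurable (fun U : UN =>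
    tensor (U : 'M[C]_N) I J * (tensor (U : 'M[C]_N) I' J')^*).
Proof.
by apply: bounded_measurableM; last apply: bounded_measurable_conj;
  exact: bounded_measurable_tensor.
Qed.

Lemma bounded_measurable_traceX n :
  bounded_measurable (fun UV => commutator_trace UV ^+ n).
Proof.
under eq_fun do rewrite commutator_traceX.
do 4!apply: bounded_measurable_sum => ?; apply: bounded_measurableM.
  exact: (bounded_measurable_fst (bounded_measurable_tensors _ _ _ _)).
exact: (bounded_measurable_snd (bounded_measurable_tensors _ _ _ _)).
Qed.

Lemma trace_moment0 : trace_moment 0 = 1.
Proof.
by rewrite /trace_moment; under eq_fun do rewrite expr0; rewrite cintegral_cst // mulr1.
Qed.

Hypothesis haar : is_haar mu.

Definition haar_moment n (I J I' J' : {ffun 'I_n -> 'I_N}) : C :=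
  cintegral mu (fun U : UN => tensor (U : 'M[C]_N) I J * (tensor (U : 'M[C]_N) I' J')^*).

Let mu_setT : mu [set: UN] = 1%E := probability_setT _.

Lemma trace_momentE n : trace_moment n =
  N%:R ^+ n * \sum_(a : {ffun 'I_n -> 'I_N}) \sum_(b : {ffun 'I_n -> 'I_N})
  \sum_(c : {ffun 'I_n -> 'I_N}) \sum_(e : {ffun 'I_n -> 'I_N})
   haar_moment a b e c * haar_moment b c a e.
Proof.
congr (_ * _); under eq_fun do rewrite commutator_traceX.
have bm (a b c e : {ffun 'I_n -> 'I_N}) : bounded_measurable (fun UV : UN * UN =>
   (tensor (UV.1 : 'M[C]_N) a b * (tensor (UV.1 : 'M[C]_N) e c)^*)
   * (tensor (UV.2 : 'M[C]_N) b c * (tensor (UV.2 : 'M[C]_N) a e)^*)).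
  apply: bounded_measurableM.
    exact: (bounded_measurable_fst (bounded_measurable_tensors _ _ _ _)).
  exact: (bounded_measurable_snd (bounded_measurable_tensors _ _ _ _)).
rewrite cintegral_sum //; last by move=> a; do 3!apply: bounded_measurable_sum => ?.
apply: eq_bigr => a _; rewrite cintegral_sum //; last first.
  by move=> b; do 2!apply: bounded_measurable_sum => ?.
apply: eq_bigr => b _; rewrite cintegral_sum //; last first.
  by move=> c; apply: bounded_measurable_sum => ?.
apply: eq_bigr => c _; rewrite cintegral_sum //; apply: eq_bigr => e _.
rewrite -cintegral_prod //; exact: bounded_measurable_tensors.
Qed.

Lemma haar_moment_inv n (A : 'M[C]_N) : A \is unitarymx ->
  forall I J I' J' : {ffun 'I_n -> 'I_N}, haar_moment I J I' J' =
    \sum_K \sum_K' tensor A I K * (tensor A I' K')^* * haar_moment K J K' J'.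
Proof.
move=> Au I J I' J'.
pose A' : UN := exist (fun X : 'M[C]_N => X \is unitarymx) A Au.
rewrite /haar_moment -(haar_cintegral haar A' (bounded_measurable_tensors I J I' J')).
transitivity (cintegral mu (fun U : UN => \sum_K \sum_K'
  (tensor A I K * (tensor A I' K')^*) *
   (tensor (U : 'M[C]_N) K J * (tensor (U : 'M[C]_N) K' J')^*))).
  congr cintegral; apply/funext => U /=.
  rewrite -[tensor _ I J]/(tensor (A *m unitary_val U) I J).
  rewrite -[tensor _ I' J']/(tensor (A *m unitary_val U) I' J') !tensor_mul.
  rewrite rmorph_sum mulr_suml; apply: eq_bigr => K _.
  rewrite mulr_sumr; apply: eq_bigr => K' _; rewrite rmorphM /=; ring.
have bm K K' : bounded_measurable (fun U : UN =>
  (tensor A I K * (tensor A I' K')^*) *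
   (tensor (U : 'M[C]_N) K J * (tensor (U : 'M[C]_N) K' J')^*)).
  apply: bounded_measurableM; first exact: bounded_measurable_cst.
  exact: bounded_measurable_tensors.
rewrite cintegral_sum // => [|K]; last by apply: bounded_measurable_sum => ?.
apply: eq_bigr => K _; rewrite cintegral_sum //; apply: eq_bigr => K' _.
by rewrite cintegralZ //; exact: bounded_measurable_tensors.
Qed.

(** The columns of a unitary matrix are orthonormal. *)
Lemma haar_moment_trace n (J J' : {ffun 'I_n -> 'I_N}) :
  \sum_I haar_moment I J I J' = (J == J')%:R.
Proof.
rewrite /haar_moment -cintegral_sum //; last by move=> I; exact: bounded_measurable_tensors.
rewrite -[RHS](cintegral_cst mu_setT); congr cintegral; apply/funext => U.
have /esym/(congr1 (fun M => tensor M J' J)) : (unitary_val U) ^t* *m unitary_val U = 1%:M.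
  exact/mulmx1C/unitarymxP/(svalP U).
rewrite /= tensor1 tensor_mul eq_sym => ->; apply: eq_bigr => I _.
by rewrite tensor_adj mulrC.
Qed.

Lemma haar_moment_relabel n (I J I' J' : {ffun 'I_n -> 'I_N}) s :
  haar_moment (relabel I s) (relabel J s) I' J' = haar_moment I J I' J'.
Proof.
by congr cintegral; apply/funext => U; rewrite tensor_relabel.
Qed.

Lemma trace_moment_weingarten n (w : {perm 'I_n} -> C) :
  (n + n * n <= N)%N -> (0 < N)%N -> (forall s, convol w (gram C N) s = dirac1 C s) ->
  trace_moment n = \sum_s \sum_t w (s * t * s^-1 * t^-1)%g.
Proof.
move=> large N_gt0 w_gram; rewrite trace_momentE.
apply: commutator_moment => //.
- exact: haar_moment_inv.
- exact: haar_moment_trace.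
- exact: haar_moment_relabel.
Qed.

End CommutatorTrace.

(** The n-th moment sums the inverse of gram over all commutators, and the
    truncated series for this inverse counts monotone words. *)
Theorem trace_moment_expansion (R : realType) (mu : forall N, probability (unitary R N) R)
    (mu_haar : forall N, (0 < N)%N -> is_haar (mu N)) n :
  inverse_expansion (fun N => trace_moment (mu N) n)
    (fun r => #|factorizations [set: 'I_n] r|%:R).
Proof.
move=> r; have [N0 N0_gt0 wE] := weingarten_exists R n.
have [c [N1 wh]] := weingarten_hseries R n r.
exists ((#|{perm 'I_n}| * #|{perm 'I_n}|)%:R * c), (maxn (maxn N0 N1) (n + n * n)) => N.
rewrite !geq_max => /andP[/andP[NN0 NN1] large].
have N_gt0 := leq_trans N0_gt0 NN0; have [w wG] := wE N NN0.
rewrite (trace_moment_weingarten (mu_haar N N_gt0) large N_gt0 wG).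
have -> : \sum_(i < r.+1) (- N%:R^-1) ^+ i * #|factorizations [set: 'I_n] i|%:R =
   \sum_(s : {perm 'I_n}) \sum_(t : {perm 'I_n})
     hseries (N%:R^-1 : CC R) r.+1 0 (s * t * s^-1 * t^-1)%g.
  under eq_bigr do rewrite card_factorizations_nmono natr_sum mulr_sumr.
  rewrite exchange_big; apply: eq_bigr => s _ /=.
  under eq_bigr do rewrite natr_sum mulr_sumr.
  by rewrite exchange_big.
rewrite -sumrB; apply: le_trans (ler_norm_sum _ _ _) _.
rewrite natrM -mulrA -mulrA -sum1_card natr_sum mulr_suml; apply: ler_sum => s _.
rewrite mul1r -sumrB; apply: le_trans (ler_norm_sum _ _ _) _.
rewrite mulr_suml; apply: ler_sum => t _; rewrite mul1r.
exact: wh.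
Qed.

(** * The complex exponential along a segment *)

Section ComplexExponential.
Local Open Scope classical_set_scope.
Variable R : realType.
Local Notation C := (CC R).
Local Notation Re := (@complex.Re R).
Local Notation Im := (@complex.Im R).
Implicit Types (z w q : C) (f g : R -> C) (p : {poly C}).

Lemma cexp0 : cexp (0 : C) = 1.
Proof. by apply: cc_eq; rewrite /= expR0 ?cos0 ?sin0 ?mulr1 ?mulr0. Qed.

Lemma cexpD z w : cexp (z + w) = cexp z * cexp w.
Proof.
case: z => a b; case: w => c e; apply: cc_eq => /=; rewrite expRD.
  by rewrite cosD; ring.
by rewrite sinD; ring.
Qed.

Lemma cexpNr z : cexp z * cexp (- z) = 1.
Proof. by rewrite -cexpD subrr cexp0. Qed.

Lemma norm_cexp z : `|cexp z| = (expR (Re z))%:C%C.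
Proof.
rewrite normc_def /= !exprMn -mulrDr cos2Dsin2 mulr1 sqrtr_sqr.
by rewrite ger0_norm // expR_ge0.
Qed.

Lemma norm_cexp_le z : `|cexp z| <= (expR (Re `|z|))%:C%C.
Proof.
by rewrite norm_cexp lecR ler_expR; apply: le_trans (ler_norm _) (cRe_le_norm _).
Qed.

(** Derivatives are taken along the real parameter of a segment, which suffices
    for estimates by the mean value theorem. *)
Definition has_cderiv f f' := forall t : R,
  is_derive t 1 (fun u => Re (f u)) (Re (f' t)) /\
  is_derive t 1 (fun u => Im (f u)) (Im (f' t)).

Lemma has_cderiv_ext f g f' g' : f =1 g -> f' =1 g' ->
  has_cderiv f f' -> has_cderiv g g'.
Proof. by move=> /funext -> /funext ->. Qed.

Lemma has_cderiv_cst z : has_cderiv (fun=> z) (fun=> 0).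
Proof. by move=> t; split; exact: is_derive_cst. Qed.

Lemma has_cderivD f g f' g' : has_cderiv f f' -> has_cderiv g g' ->
  has_cderiv (fun t => f t + g t) (fun t => f' t + g' t).
Proof.
move=> df dg t; have [fr fi] := df t; have [gr gi] := dg t; split.
  by under eq_fun do rewrite cReD; rewrite cReD; exact: is_deriveD.
by under eq_fun do rewrite cImD; rewrite cImD; exact: is_deriveD.
Qed.

Lemma has_cderivM f g f' g' : has_cderiv f f' -> has_cderiv g g' ->
  has_cderiv (fun t => f t * g t) (fun t => f' t * g t + f t * g' t).
Proof.
move=> df dg t; have [fr fi] := df t; have [gr gi] := dg t; split.
  under eq_fun do rewrite cReM.
  have := is_deriveB (is_deriveM fr gr) (is_deriveM fi gi) => D.
  by apply: is_derive_eq D _; rewrite cReD !cReM /GRing.scale /=; ring.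
under eq_fun do rewrite cImM.
have := is_deriveD (is_deriveM fr gi) (is_deriveM fi gr) => D.
by apply: is_derive_eq D _; rewrite cImD !cImM /GRing.scale /=; ring.
Qed.

Lemma has_cderiv_line q : has_cderiv (fun t => t%:C%C * q) (fun=> q).
Proof.
case: q => a b t; split => /=.
  under eq_fun do rewrite mul0r subr0.
  have := is_deriveM (is_derive_id t 1) (is_derive_cst a t 1) => D.
  by apply: is_derive_eq D _; rewrite /GRing.scale /=; ring.
under eq_fun do rewrite mul0r addr0.
have := is_deriveM (is_derive_id t 1) (is_derive_cst b t 1) => D.
by apply: is_derive_eq D _; rewrite /GRing.scale /=; ring.
Qed.

Lemma has_cderiv_poly p q :
  has_cderiv (fun t => p.[t%:C%C * q]) (fun t => q * p^`().[t%:C%C * q]).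
Proof.
elim/poly_ind: p => [|p c IHp].
  apply: has_cderiv_ext (has_cderiv_cst 0) => t; first by rewrite horner0.
  by rewrite deriv0 horner0 mulr0.
apply: has_cderiv_ext (has_cderivD (has_cderivM IHp (has_cderiv_line q)) (has_cderiv_cst c)) => t.
  by rewrite !hornerE.
rewrite derivD derivM derivX derivC; move: (t%:C%C * q) => u.
by rewrite !hornerE; ring.
Qed.

Lemma has_cderiv_cexp f f' : has_cderiv f f' ->
  has_cderiv (fun t => cexp (f t)) (fun t => f' t * cexp (f t)).
Proof.
move=> df t; have [fr fi] := df t; split => /=.
  have := is_deriveM (is_derive1_comp (is_derive_expR _) fr)
     (is_derive1_comp (is_derive_cos _) fi) => D.
  by apply: is_derive_eq D _; rewrite cReM /GRing.scale /=; ring.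
have := is_deriveM (is_derive1_comp (is_derive_expR _) fr)
   (is_derive1_comp (is_derive_sin _) fi) => D.
by apply: is_derive_eq D _; rewrite cImM /GRing.scale /=; ring.
Qed.

(** The mean value theorem, applied to the real and to the imaginary part; hence
    the factor 2. *)
Lemma has_cderiv_bound f f' (B : R) : has_cderiv f f' ->
  (forall t : R, 0 <= t <= 1 -> `|f' t| <= B%:C%C) ->
  `|f 1 - f 0| <= (B + B)%:C%C.
Proof.
move=> df fB.
have mvt (h dh : R -> R) : (forall t : R, is_derive t 1 h (dh t)) ->
    (forall t : R, 0 <= t <= 1 -> `|dh t| <= B) -> `|h 1 - h 0| <= B.
  move=> hd hB; have hc : {within `[0 : R, 1], continuous h}.
    by apply: derivable_within_continuous => t _; have [] := hd t.
  have [c] := MVT_segment ler01 (fun t _ => hd t) hc.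
  by rewrite in_itv /= => c01 ->; rewrite subr0 mulr1; exact: hB.
apply: le_trans (cnorm_le _) _; rewrite lecR cReD cImD cReN cImN; apply: lerD.
  apply: (mvt (fun t => Re (f t)) (fun t => Re (f' t))) => [t|t t01].
    by have [] := df t.
  by apply: le_trans (cRe_le_norm _) _; rewrite -cRe_norm_le fB.
apply: (mvt (fun t => Im (f t)) (fun t => Im (f' t))) => [t|t t01].
  by have [] := df t.
by apply: le_trans (cIm_le_norm _) _; rewrite -cRe_norm_le fB.
Qed.

(** If P nearly solves P' = Q' P, then P is nearly a multiple of exp Q, for the
    derivative of P (t q) exp (- Q (t q)) in t is q (P' - Q' P) (t q) exp (- Q
    (t q)). The choice Q = X gives the Taylor approximation of the exponential,
    and the choice of the moment and cumulant polynomials gives the exponential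
    formula. *)
Lemma exp_ode_bound (P Q : {poly C}) q (e B : R) : 0 <= e ->
  (forall t : R, 0 <= t <= 1 ->
    `|(P^`() - Q^`() * P).[t%:C%C * q]| <= e%:C%C) ->
  (forall t : R, 0 <= t <= 1 -> `|Q.[t%:C%C * q]| <= B%:C%C) ->
  `|P.[q] * cexp (- Q.[q]) - P.[0] * cexp (- Q.[0])|
    <= (2 * (Re `|q| * e * expR B))%:C%C.
Proof.
move=> e0 defect QB.
have dQ := has_cderiv_poly (- Q) q.
have D := has_cderivM (has_cderiv_poly P q) (has_cderiv_cexp dQ).
have := @has_cderiv_bound _ _ (Re `|q| * e * expR B) D.
rewrite !rmorph1 !rmorph0 !mul1r !mul0r !hornerN -mulr2n -[_ *+ 2]mulr_natl.
apply => t t01; set u := t%:C%C * q.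
have -> : q * P^`().[u] * cexp (- Q).[u] + P.[u] * (q * (- Q)^`().[u] * cexp (- Q).[u])
   = q * (P^`() - Q^`() * P).[u] * cexp (- Q.[u]).
  rewrite derivN !hornerN hornerD hornerN hornerM.
  move: (cexp _) P.[u] P^`().[u] Q^`().[u] => E a b c.
  by ring.
rewrite !normrM !(rmorphM (real_complex R)).
apply: ler_pM => //.
  by apply: ler_pM => //; exact: defect.
apply: le_trans (norm_cexp_le _) _; rewrite lecR ler_expR normrN.
by rewrite -cRe_norm_le QB.
Qed.

Definition exp_poly n : {poly C} := \poly_(k < n.+1) (k`!%:R^-1).

Lemma exp_poly_horner n z : (exp_poly n).[z] = \sum_(k < n.+1) z ^+ k / k`!%:R.
Proof. by rewrite horner_poly; apply: eq_bigr => k _; rewrite mulrC. Qed.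

Lemma exp_poly_deriv n : (exp_poly n)^`() - exp_poly n = - (n`!%:R^-1 *: 'X^n).
Proof.
apply/polyP => k; rewrite coefB coef_deriv coefN coefZ coefXn !coef_poly !ltnS.
have [->|kn] := eqVneq k n; first by rewrite ltnn leqnn mul0rn sub0r mulr1.
rewrite mulr0 oppr0; have [lt|ge] := ltnP k n.
  rewrite (ltnW lt) factS natrM invfM -[_ *+ k.+1]mulr_natl mulrA.
  by rewrite mulfV ?mul1r ?subrr // pnatr_eq0.
by rewrite mul0rn leq_eqVlt (negPf kn) ltnNge ge subrr.
Qed.

Lemma cexp_approx n z (r : R) : `|z| <= r%:C%C ->
  `|cexp z - \sum_(k < n.+1) z ^+ k / k`!%:R|
    <= (2 * (r * (r ^+ n / n`!%:R) * expR r * expR r))%:C%C.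
Proof.
move=> zr; have r0 : 0 <= r by rewrite -lecR; exact: le_trans (normr_ge0 z) zr.
have tz (t : R) : 0 <= t <= 1 -> `|t%:C%C * z| <= r%:C%C.
  move=> /andP[t0 t1]; apply: le_trans zr; rewrite normrM ler_piMl //.
  by rewrite normc_def /= expr0n addr0 sqrtr_sqr ger0_norm // lecR.
have bound : `|(\sum_(k < n.+1) z ^+ k / k`!%:R) * cexp (- z) - 1| <=
   (2 * (r * (r ^+ n / n`!%:R) * expR r))%:C%C.
  have := @exp_ode_bound (exp_poly n) 'X z (r ^+ n / n`!%:R) r.
  rewrite !hornerX !exp_poly_horner oppr0 cexp0 mulr1.
  rewrite [X in `|_ - X|]big_ord_recl /= expr0 divr1 [X in 1 + X]big1 ?addr0; last first.
    by move=> k _; rewrite expr0n /= mul0r.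
  move=> H; apply: le_trans (H _ _ _) _.
  - by rewrite divr_ge0 ?exprn_ge0.
  - move=> t t01; rewrite derivX mul1r exp_poly_deriv hornerN hornerZ hornerXn normrN normrM.
    rewrite normrX mulrC (rmorphM (real_complex R)) (rmorphXn (real_complex R)).
    apply: ler_pM => //.
      by apply: lerXn2r; rewrite ?nnegrE //; [rewrite lecR | exact: tz].
    rewrite normrV ?unitfE ?pnatr_eq0 -?lt0n ?fact_gt0 // normr_nat.
    by rewrite (fmorphV (real_complex R)) (rmorph_nat (real_complex R)).
  - by move=> t t01; rewrite hornerX; exact: tz.
  rewrite lecR ler_wpM2l // ler_wpM2r ?expR_ge0 // ler_wpM2r ?divr_ge0 ?exprn_ge0 //.
  by rewrite -cRe_norm_le.
have -> : cexp z - \sum_(k < n.+1) z ^+ k / k`!%:R =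
   - (((\sum_(k < n.+1) z ^+ k / k`!%:R) * cexp (- z) - 1) * cexp z).
  by rewrite mulrBl mul1r -mulrA [cexp (- z) * _]mulrC cexpNr mulr1 opprB.
rewrite normrN normrM.
rewrite [X in _ <= X%:C%C](_ : _ = 2 * (r * (r ^+ n / n`!%:R) * expR r) * expR r); last by ring.
rewrite (rmorphM (real_complex R)); apply: ler_pM => //.
apply: le_trans (norm_cexp_le _) _; rewrite lecR ler_expR.
by rewrite -cRe_norm_le.
Qed.

End ComplexExponential.

(** * Sequences tending to zero *)

Section NullSequences.
Variable R : realType.
Local Notation C := (CC R).
Implicit Types (u v : nat -> C).

Definition null u := forall e : R, 0 < e ->
  exists n0, forall n, (n0 <= n)%N -> `|u n| <= e%:C%C.

Lemma nullD u v : null u -> null v -> null (fun n => u n + v n).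
Proof.
move=> nu nv e e0; have e2 : 0 < e / 2 by rewrite divr_gt0.
have [n0 H] := nu _ e2; have [n1 H'] := nv _ e2; exists (maxn n0 n1) => n.
rewrite geq_max => /andP[/H un /H' vn]; apply: le_trans (ler_normD _ _) _.
by rewrite [e]splitr (rmorphD (real_complex R)); exact: lerD.
Qed.

Lemma nullM u v (B : R) : (forall n, `|u n| <= B%:C%C) -> null v ->
  null (fun n => u n * v n).
Proof.
move=> uB nv e e0.
have B0 : 0 <= B by rewrite -lecR; exact: le_trans (normr_ge0 (u 0%N)) (uB _).
have B1 : 0 < B + 1 by rewrite ltr_wpDl.
have [n0 H] := nv _ (divr_gt0 e0 B1); exists n0 => n /H vn.
rewrite normrM; apply: (@le_trans _ _ ((B * (e / (B + 1)))%:C%C)).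
  by rewrite (rmorphM (real_complex R)); exact: ler_pM.
rewrite lecR mulrCA ler_piMr ?(ltW e0) // ler_pdivrMr // mul1r.
by rewrite lerDl.
Qed.

Lemma null_const (z : C) : null (fun=> z) -> z = 0.
Proof.
move=> nz; apply/eqP; rewrite -normr_eq0; apply/negPn/negP => z0.
have z_gt0 : 0 < complex.Re `|z|.
  by rewrite -ltcR -normc_real normr_gt0 -normr_eq0.
have z2 : 0 < complex.Re `|z| / 2 by rewrite divr_gt0.
have [n0 /(_ n0 (leqnn n0))] := nz _ z2.
rewrite normc_real lecR ler_pdivlMr // mulr_natr mulr2n.
by rewrite gerDl leNgt z_gt0.
Qed.

End NullSequences.

Arguments cumulant : simpl never.

(** * Bounds on the cumulant series *)

Section CumulantSeries.
Local Open Scope classical_set_scope.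
Variable R : realType.
Local Notation C := (CC R).
Variables (m : nat -> C) (b : R).
Hypothesis m0 : m 0%N = 1.
Hypothesis b1 : 1 <= b.
Hypothesis m_bound : forall n, `|m n| <= (b ^+ n)%:C%C.
Local Notation kappa := (cumulant m).
Local Notation bC := (b%:C%C : C).

Let b0 : 0 <= b. Proof. exact: le_trans ler01 b1. Qed.
Let bC0 : 0 <= bC. Proof. by rewrite lecR. Qed.

Let m_boundC n : `|m n| <= bC ^+ n.
Proof. by rewrite -(rmorphXn (real_complex R)). Qed.

(** Induction on the recursion; the constant 3 is such that 1 + 3^0 + ... +
    3^(n-1) <= 3^n. *)
Lemma cumulant_bound n : `|kappa n.+1| <= n`!%:R * (bC ^+ n.+1 * 3 ^+ n).
Proof.
have [k] := ubnP n; elim: k n => // k IHk n; rewrite ltnS => nk.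
have := cumulantP m0 n; rewrite big_ord_recr /= binn subnn m0 mulr1 mul1r.
move/eqP; rewrite addrC -subr_eq => /eqP <-.
apply: le_trans (ler_normB _ _) _.
have geom : 1 + \sum_(i < n) (3 : C) ^+ i <= 3 ^+ n.
  elim: (n) => [|j IHj]; first by rewrite big_ord0 addr0.
  rewrite big_ord_recr /= addrA exprS; apply: le_trans (lerD IHj (lexx _)) _.
  by rewrite -mulr2n -[leLHS]mulr_natl ler_wpM2r ?exprn_ge0 // ler_nat.
apply: (@le_trans _ _ (n`!%:R * (bC ^+ n.+1 * (1 + \sum_(i < n) 3 ^+ i)))); last first.
  by rewrite !ler_wpM2l // exprn_ge0.
rewrite !mulrDr mulr1; apply: lerD.
  apply: le_trans (m_boundC _) _; rewrite ler_peMl ?exprn_ge0 // ler1n.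
  exact: fact_gt0.
apply: le_trans (ler_norm_sum _ _ _) _; rewrite !mulr_sumr; apply: ler_sum => i _.
rewrite !normrM normr_nat.
apply: (@le_trans _ _ ('C(n, i)%:R * (i`!%:R * (bC ^+ i.+1 * 3 ^+ i)) * bC ^+ (n - i))).
  apply: ler_pM; rewrite ?mulr_ge0 //.
  by apply: ler_wpM2l => //; apply: IHk; apply: leq_trans nk.
have -> : 'C(n, i)%:R * (i`!%:R * (bC ^+ i.+1 * 3 ^+ i)) * bC ^+ (n - i) =
   ('C(n, i) * i`!)%:R * (bC ^+ n.+1 * 3 ^+ i).
  have -> : bC ^+ n.+1 = bC ^+ i.+1 * bC ^+ (n - i).
    by rewrite -exprD; congr (_ ^+ _); have := ltn_ord i; lia.
  by rewrite natrM; ring.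
apply: ler_wpM2r; first by rewrite mulr_ge0 ?exprn_ge0.
rewrite ler_nat -(bin_fact (ltnW (ltn_ord i))) mulnA.
by rewrite leq_pmulr // fact_gt0.
Qed.

Definition moment_poly n : {poly C} := \poly_(k < n.+1) (m k / k`!%:R).
Definition cumulant_poly n : {poly C} := \poly_(k < n.+1) (kappa k / k`!%:R).

Let ode_defect n := (moment_poly n)^`() - (cumulant_poly n)^`() * moment_poly n.

Lemma fact_cancel j (z : C) : z / (j.+1)`!%:R *+ j.+1 = z / j`!%:R.
Proof.
rewrite factS natrM invfM -[LHS]mulr_natl mulrCA; congr (_ * _).
by rewrite mulrA mulfV ?mul1r // pnatr_eq0.
Qed.

(** Below the truncation the equation M' = K' M holds coefficient by
    coefficient, being the recursion of the cumulants. *)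
Lemma ode_defect_low n j : (j < n)%N -> (ode_defect n)`_j = 0.
Proof.
move=> jn; rewrite coefB coef_deriv coefM coef_poly ltnS jn fact_cancel.
apply/eqP; rewrite subr_eq0; apply/eqP.
have -> : m j.+1 / j`!%:R =
    (\sum_(i < j.+1) 'C(j, i)%:R * kappa i.+1 * m (j - i)%N) / j`!%:R.
  by rewrite -(cumulantP m0).
rewrite mulr_suml; apply: eq_bigr => i _.
have ij : (i <= j)%N by rewrite -ltnS.
rewrite coef_deriv !coef_poly !ltnS (leq_ltn_trans ij jn) fact_cancel.
rewrite (leq_trans (leq_subr _ _) (ltnW jn)).
rewrite -(bin_fact ij) !natrM.
have C0 : ('C(j, i))%:R != 0 :> C by rewrite pnatr_eq0 -lt0n bin_gt0.
have f0 k : (k`!)%:R != 0 :> C by rewrite pnatr_eq0 -lt0n fact_gt0.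
by field; rewrite C0 !f0.
Qed.

Lemma cumulant_coef_bound n i : `|((cumulant_poly n)^`())`_i| <= bC ^+ i.+1 * 3 ^+ i.
Proof.
have rhs0 : 0 <= bC ^+ i.+1 * 3 ^+ i by rewrite mulr_ge0 // exprn_ge0.
rewrite coef_deriv coef_poly; case: ifP => _; last by rewrite mul0rn normr0.
rewrite fact_cancel normrM normfV normr_nat ler_pdivrMr ?ltr0n ?fact_gt0 //.
by rewrite mulrC; exact: cumulant_bound.
Qed.

Lemma moment_coef_bound n i : `|(moment_poly n)`_i| <= bC ^+ i.
Proof.
rewrite coef_poly; case: ifP => _; last by rewrite normr0 exprn_ge0.
rewrite normrM normfV normr_nat ler_pdivrMr ?ltr0n ?fact_gt0 //.
apply: le_trans (m_boundC i) _; rewrite ler_peMr ?exprn_ge0 // ler1n.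
exact: fact_gt0.
Qed.

Lemma ode_defect_coef n j : (n <= j)%N ->
  `|(ode_defect n)`_j| <= 2 ^+ j * (bC * (3 * bC) ^+ j).
Proof.
move=> nj; rewrite coefB coef_deriv coefM.
rewrite [(moment_poly n)`_j.+1]coef_poly ltnS ltnNge nj /= mul0rn sub0r normrN.
apply: le_trans (ler_norm_sum _ _ _) _.
apply: (@le_trans _ _ (\sum_(i < j.+1) (bC * (3 * bC) ^+ j))).
  apply: ler_sum => i _; have ij : (i <= j)%N by rewrite -ltnS.
  rewrite normrM; apply: (@le_trans _ _ (bC ^+ i.+1 * 3 ^+ i * bC ^+ (j - i))).
    by apply: ler_pM => //; [exact: cumulant_coef_bound|exact: moment_coef_bound].
  rewrite exprMn mulrCA -exprS -[in bC ^+ j.+1](subnKC ij) -addSn exprD.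
  rewrite mulrAC [leRHS]mulrC ler_wpM2l ?mulr_ge0 ?exprn_ge0 //.
  by rewrite ler_eXn2l // ltr1n.
rewrite sumr_const card_ord -[leLHS]mulr_natl; apply: ler_wpM2r.
  by rewrite mulr_ge0 ?exprn_ge0 ?mulr_ge0.
rewrite -natrX ler_nat; exact: ltn_expl.
Qed.

Variable q : C.
Hypothesis q_small : 3 * bC * `|q| <= 4^-1.

Lemma geometric_half n s : \sum_(i < s) (2^-1 : C) ^+ (n + i) <= 2 * 2^-1 ^+ n.
Proof.
suff -> : \sum_(i < s) (2^-1 : C) ^+ (n + i) = 2 * 2^-1 ^+ n - 2 * 2^-1 ^+ (n + s).
  by rewrite gerBl mulr_ge0 // exprn_ge0 // invr_ge0.
elim: s => [|s IHs]; first by rewrite big_ord0 addn0 subrr.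
by rewrite big_ord_recr /= IHs addnS exprS mulrA mulfV // mul1r; ring.
Qed.

Lemma ode_defect_bound n (u : C) : `|u| <= `|q| ->
  `|(ode_defect n).[u]| <= 2 * bC * 2^-1 ^+ n.
Proof.
move=> uq; rewrite (@horner_coef_wide _ (n + size (ode_defect n))) ?leq_addl //.
rewrite big_split_ord /= big1 ?add0r; last first.
  by move=> i _; rewrite ode_defect_low // mul0r.
apply: le_trans (ler_norm_sum _ _ _) _.
apply: (@le_trans _ _ (\sum_(i < size (ode_defect n)) bC * 2^-1 ^+ (n + i))).
  apply: ler_sum => i _; rewrite normrM normrX; set j := (n + i)%N.
  apply: (@le_trans _ _ (2 ^+ j * (bC * (3 * bC) ^+ j) * `|q| ^+ j)).
    apply: ler_pM; rewrite ?exprn_ge0 //; first exact: ode_defect_coef (leq_addr _ _).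
    exact: lerXn2r.
  rewrite -mulrA mulrCA -mulrA ler_wpM2l // -!exprMn.
  apply: lerXn2r; rewrite ?nnegrE ?invr_ge0 ?mulr_ge0 //.
  have half : (2^-1 : C) = 2 * 4^-1.
    by rewrite (natrM _ 2 2) invfM mulrA mulfV // mul1r.
  rewrite [leLHS](_ : _ = 2 * (3 * bC * `|q|)); last by ring.
  by rewrite half ler_wpM2l.
rewrite -mulr_sumr [leRHS](_ : _ = bC * (2 * 2^-1 ^+ n)); last by ring.
by apply: ler_wpM2l => //; exact: geometric_half.
Qed.

Lemma cumulant_term_bound k : `|q ^+ k / k`!%:R * kappa k| <= 4^-1 ^+ k.
Proof.
case: k => [|k]; first by rewrite mulr0 normr0.
rewrite !normrM normrX normfV normr_nat.
apply: (@le_trans _ _ (`|q| ^+ k.+1 / (k.+1)`!%:R * (k`!%:R * (bC ^+ k.+1 * 3 ^+ k)))).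
  apply: ler_wpM2l; last exact: cumulant_bound.
  by rewrite mulr_ge0 ?exprn_ge0 ?invr_ge0 ?ler0n.
apply: (@le_trans _ _ ((3 * bC * `|q|) ^+ k.+1)); last first.
  by apply: lerXn2r; rewrite ?nnegrE ?mulr_ge0 // invr_ge0.
set x := `|q| ^+ k.+1; set y := bC ^+ k.+1; set f := (_`!%:R)^-1.
rewrite [leLHS](_ : _ = x * y * (k`!%:R * 3 ^+ k * f)); last by ring.
rewrite !exprMn -/x -/y [leRHS](_ : _ = x * y * 3 ^+ k.+1); last by ring.
apply: ler_wpM2l; first by rewrite mulr_ge0 // exprn_ge0.
rewrite ler_pdivrMr ?ltr0n ?fact_gt0 // -!natrX -!natrM ler_nat mulnC.
by apply: leq_mul; [rewrite leq_exp2l | exact: leq_fact].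
Qed.

(** Keeping the partial sums in the unit disc keeps their limit in the strip
    where the principal logarithm inverts the exponential. *)
Lemma cumulant_poly_bound n (u : C) : `|u| <= `|q| -> `|(cumulant_poly n).[u]| <= 1.
Proof.
move=> uq; rewrite horner_poly; apply: le_trans (ler_norm_sum _ _ _) _.
rewrite big_ord_recl /= mul0r mul0r normr0 add0r.
apply: (@le_trans _ _ (\sum_(i < n) 2^-1 ^+ (1 + i))); last first.
  by apply: le_trans (geometric_half _ _) _; rewrite expr1 mulfV.
apply: ler_sum => i _; apply: (@le_trans _ _ (4^-1 ^+ (1 + i))); last first.
  apply: lerXn2r; rewrite ?nnegrE ?invr_ge0 //.
  by rewrite lef_pV2 ?posrE ?ltr0n // ler_nat.
apply: le_trans (cumulant_term_bound _); rewrite /bump /= add1n.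
rewrite [X in _ <= `|X|](_ : _ = (kappa i.+1 / (i.+1)`!%:R) * q ^+ i.+1); last by ring.
rewrite normrM [leRHS]normrM; apply: ler_wpM2l => //.
by rewrite !normrX; apply: lerXn2r.
Qed.

End CumulantSeries.

(** * Summing the cumulant series to the logarithm *)

Section LogarithmSeries.
Local Open Scope classical_set_scope.
Variable R : realType.
Local Notation C := (CC R).
Implicit Types (u : nat -> C) (v : nat -> R).

Lemma null_bound u v : (forall n, `|u n| <= (v n)%:C%C) -> v @ \oo --> (0 : R) -> null u.
Proof.
move=> uv /cvgrPdist_lt v0 e e0; have [n0 _ H] := v0 e e0.
exists n0 => n nn0; apply: le_trans (uv n) _; rewrite lecR ltW //.
by apply: le_lt_trans (H n nn0); rewrite sub0r normrN ler_norm.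
Qed.

Lemma null_geometric (c : R) : null (fun n => c%:C%C * 2^-1 ^+ n).
Proof.
apply: (@null_bound _ (fun n => `|c| * 2^-1 ^+ n)) => [n|].
  rewrite normrM normrX (rmorphM (real_complex R)) (rmorphXn (real_complex R)).
  rewrite (fmorphV (real_complex R)) (rmorph_nat (real_complex R)).
  rewrite [`|2^-1|]ger0_norm ?invr_ge0 //; apply: ler_wpM2r.
    by rewrite exprn_ge0 // invr_ge0.
  by rewrite normc_def /= expr0n addr0 sqrtr_sqr.
apply: cvg_geometric; rewrite ger0_norm ?invr_ge0 //.
by rewrite invf_lt1 // ltr1n.
Qed.

Lemma null_ext u u' : u =1 u' -> null u -> null u'.
Proof. by move=> /funext ->. Qed.

Lemma complex_series_limit u : (forall k, `|u k| <= 4^-1 ^+ k) ->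
  exists l : C, null (fun n => \sum_(k < n.+1) u k - l).
Proof.
move=> u4.
have cv (h : C -> R) : (forall z, `|h z| <= complex.Re `|z|) ->
    cvgn (series (fun k => h (u k))).
  move=> hn; apply: normed_cvg.
  apply: (@series_le_cvg _ _ (fun k => 1 * 4^-1 ^+ k)) => [n|n|n|].
  - exact: normr_ge0.
  - by rewrite mul1r exprn_ge0 // invr_ge0.
  - rewrite mul1r; apply: le_trans (hn _) _; rewrite -cRe_norm_le.
    apply: le_trans (u4 n) _; rewrite (rmorphXn (real_complex R)).
    by rewrite (fmorphV (real_complex R)) (rmorph_nat (real_complex R)).
  - apply: is_cvg_geometric_series; rewrite ger0_norm ?invr_ge0 //.
    by rewrite invf_lt1 // ltr1n.
have cr := cv _ (@cRe_le_norm R); have ci := cv _ (@cIm_le_norm R).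
set x := series _ in cr; set y := series _ in ci.
exists (limn x +i* limn y)%C => e e0.
have e2 : 0 < e / 2 by rewrite divr_gt0.
have /cvgrPdist_lt/(_ _ e2)[n0 _ H] := cr; have /cvgrPdist_lt/(_ _ e2)[n1 _ H'] := ci.
exists (maxn n0 n1) => n; rewrite geq_max => /andP[n0n n1n].
apply: le_trans (cnorm_le _) _; rewrite lecR [e]splitr; apply: lerD.
  rewrite cReD cReN cRe_sum /=; have := H n.+1 (leq_trans n0n (leqnSn n)).
  by rewrite distrC /x /series /= big_mkord => /ltW.
rewrite cImD cImN cIm_sum /=; have := H' n.+1 (leq_trans n1n (leqnSn n)).
by rewrite distrC /y /series /= big_mkord => /ltW.
Qed.

Lemma null_cexp u : null u -> null (fun n => cexp (u n) - 1).
Proof.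
move=> nu e e0.
pose K := 2 * (expR 1 * expR 1) : R.
have K0 : 0 < K by rewrite !mulr_gt0 // expR_gt0.
have d0 : 0 < Num.min 1 (e / K) by rewrite lt_min ltr01 divr_gt0.
have [n0 H] := nu _ d0; exists n0 => n /H; set r := Num.min _ _ => un.
have := cexp_approx 0 un; rewrite big_ord1 expr0 divr1 => le1; apply: le_trans le1 _.
have r1 : r <= 1 by rewrite ge_min lexx.
rewrite lecR fact0 divr1 mulr1; apply: (@le_trans _ _ (r * K)).
  rewrite /K [leRHS](_ : _ = 2 * (r * expR 1 * expR 1)); last by ring.
  rewrite ler_wpM2l //; apply: ler_pM; rewrite ?mulr_ge0 ?expR_ge0 ?(ltW d0) ?ler_expR //.
  by apply: ler_wpM2l; rewrite ?(ltW d0) ?ler_expR.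
by rewrite -ler_pdivlMr // ge_min lexx orbT.
Qed.

Lemma clog_cexp (z : C) : `|complex.Im z| < pi -> clog (cexp z) = z.
Proof.
case: z => x y /= ypi; have e0 := expR_gt0 x.
rewrite /clog norm_cexp /= expRK /carg norm_cexp /=.
rewrite [_ / _](_ : _ = cos y); last by rewrite mulrAC divff ?mul1r ?gt_eqF.
rewrite pmulr_rge0 //; have [y0|y0] := leP 0 y.
  have y_pi : y < pi by apply: le_lt_trans ypi; exact: ler_norm.
  rewrite sin_ge0_pi ?cosK // ?in_itv /= ?y0 ?ltW //.
have y_pi : - y < pi by apply: le_lt_trans ypi; rewrite -normrN ler_norm.
have sy : sin y < 0.
  by rewrite -oppr_gt0 -sinN sin_gt0_pi // oppr_gt0 y0.
rewrite leNgt sy /= -cosN cosK ?opprK // in_itv /= oppr_ge0 !ltW //.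
Qed.

Section Exponentiation.
Variables (m : nat -> C) (b : R).
Hypothesis m0 : m 0%N = 1.
Hypothesis b1 : 1 <= b.
Hypothesis m_bound : forall n, `|m n| <= (b ^+ n)%:C%C.
Variables (q K : C).
Hypothesis q_small : 3 * b%:C%C * `|q| <= 4^-1.
Hypothesis moment_lim : null (fun n => (moment_poly m n).[q] - K).

Lemma cumulant_poly_horner n :
  (cumulant_poly m n).[q] = \sum_(k < n.+1) q ^+ k / k`!%:R * cumulant m k.
Proof. by rewrite horner_poly; apply: eq_bigr => k _; ring. Qed.

Lemma moment_exp_cumulant :
  null (fun n => (moment_poly m n).[q] * cexp (- (cumulant_poly m n).[q]) - 1).
Proof.
have e0 n : 0 <= 2 * b * 2^-1 ^+ n.
  by rewrite !mulr_ge0 ?exprn_ge0 ?invr_ge0 // (le_trans ler01).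
have tq (t : R) : 0 <= t <= 1 -> `|t%:C%C * q| <= `|q|.
  move=> /andP[t0 t1]; rewrite normrM ler_piMl //.
  by rewrite normc_def /= expr0n addr0 sqrtr_sqr ger0_norm // lecR.
pose c := 2 * (complex.Re `|q| * (2 * b) * expR 1) : R.
apply: (@null_bound _ (fun n => c * 2^-1 ^+ n)) => [n|]; last first.
  by apply: cvg_geometric; rewrite ger0_norm ?invr_ge0 // invf_lt1 // ltr1n.
have := @exp_ode_bound R (moment_poly m n) (cumulant_poly m n) q _ 1 (e0 n).
rewrite [X in `|_ - X|](_ : _ = 1); last first.
  rewrite !horner_coef0 !coef_poly /= mul0r oppr0 cexp0 mulr1 m0.
  by rewrite mulfV // oner_eq0.
move=> H; apply: le_trans (H _ _) _.
- move=> t /tq t01; apply: le_trans (ode_defect_bound m0 b1 m_bound q_small n t01) _.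
  rewrite !(rmorphM (real_complex R)) (rmorphXn (real_complex R)).
  by rewrite (fmorphV (real_complex R)) !(rmorph_nat (real_complex R)).
- by move=> t /tq t01; exact: (cumulant_poly_bound m0 b1 m_bound q_small n t01).
- by rewrite lecR /c le_eqVlt; apply/orP; left; apply/eqP; ring.
Qed.

(** The partial sums P_n of the moment series and Q_n of the cumulant series
    satisfy P_n exp (- Q_n) -> 1. With P_n -> K and Q_n -> l this gives K = exp
    l, and l, being of modulus at most 3/2 < pi, is the principal logarithm of
    K. *)
Theorem cumulant_series_log : null (fun n => (cumulant_poly m n).[q] - clog K).
Proof.
have [l lim_l] : exists l, null (fun n => (cumulant_poly m n).[q] - l).
  have [l H] := complex_series_limit (cumulant_term_bound m0 b1 m_bound q_small).
  by exists l; apply: null_ext H => n; rewrite cumulant_poly_horner.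
have Kl : K * cexp (- l) = 1.
  apply/eqP; rewrite -subr_eq0; apply/eqP; apply: null_const.
  (* P_n exp (- Q_n) is known to be bounded only for n >= n1, hence the shift of
     all sequences by n1 *)
  have [n1 bnd] := moment_exp_cumulant ltr01.
  pose P n := (moment_poly m (n1 + n)).[q]; pose Q n := (cumulant_poly m (n1 + n)).[q].
  have shift u : null u -> null (fun n => u (n1 + n)%N).
    move=> nu e e0; have [n0 H] := nu e e0; exists n0 => n nn; apply: H.
    exact: leq_trans (leq_addl _ _).
  have PQ n : `|P n * cexp (- Q n)| <= 2%:C%C.
    rewrite -[P n * _](subrK 1); apply: le_trans (ler_normD _ _) _.
    rewrite normr1 [2]mulr2n (rmorphD (real_complex R)).
    by apply: lerD => //; exact: bnd (leq_addr _ _).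
  have N1 : null (fun n => cexp (- l) * (- (P n - K))).
    apply: (@nullM _ _ _ (complex.Re `|cexp (- l)|)) => [n|].
      by rewrite -normc_real.
    move=> e e0; have [n0 H] := shift _ moment_lim e e0.
    by exists n0 => n /H; rewrite normrN.
  have N2 : null (fun n => P n * cexp (- Q n) * (cexp (Q n - l) - 1)).
    exact: nullM PQ (null_cexp (shift _ lim_l)).
  have N3 := shift _ moment_exp_cumulant.
  apply: null_ext (nullD (nullD N1 N2) N3) => n.
  have -> : P n * cexp (- Q n) * (cexp (Q n - l) - 1) =
      P n * cexp (- l) - P n * cexp (- Q n).
    by rewrite mulrBr mulr1 -mulrA -cexpD addKr.
  by rewrite -/(P n) -/(Q n); ring.
have -> : K = cexp l by rewrite -[K]mulr1 -(cexpNr l) mulrCA Kl mulr1.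
rewrite clog_cexp //.
have half : (0 : R) < 2^-1 by rewrite invr_gt0.
have [n0 /(_ n0 (leqnn n0)) H] := lim_l _ half.
have Q1 := cumulant_poly_bound m0 b1 m_bound q_small n0 (lexx _).
have l_le : `|l| <= (1 + 2^-1)%:C%C.
  rewrite -[l](subKr (cumulant_poly m n0).[q]); apply: le_trans (ler_normB _ _) _.
  by rewrite (rmorphD (real_complex R)); exact: lerD.
apply: (@le_lt_trans _ _ (1 + 2^-1)).
  by apply: le_trans (cIm_le_norm _) _; rewrite -cRe_norm_le.
by apply: lt_le_trans (pi_ge2 R); lra.
Qed.

End Exponentiation.

End LogarithmSeries.

(** * Uniqueness of Maclaurin coefficients *)

Section MaclaurinUniqueness.
Local Open Scope classical_set_scope.
Variable R : realType.
Local Notation C := (CC R).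

Lemma cRe_norm_ge0 (z : C) : 0 <= complex.Re `|z|.
Proof. by rewrite -lecR -normc_real; exact: normr_ge0. Qed.

Lemma pos_real (e : C) : 0 < e -> exists2 r : R, 0 < r & e = r%:C%C.
Proof.
move=> e0; have := ltW e0; rewrite lecE => /andP[/eqP Ime _].
have eE : e = (complex.Re e)%:C%C by apply: cc_eq.
by exists (complex.Re e) => //; rewrite -ltcR -eE.
Qed.

Lemma cvg_nullP (u : nat -> C) (l : C) :
  u @ \oo --> l <-> null (fun n => u n - l).
Proof.
have E := @cvgrPdist_lt C (C : pseudoMetricNormedZmodType C) nat \oo _ u l.
split=> [/E cv e e0|nu].
  have eC : (0 : C) < e%:C%C by rewrite ltcR.
  by have [n0 _ H] := cv _ eC; exists n0 => n /H; rewrite distrC => /ltW.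
apply/E => e /pos_real[r r0 ->].
have r2 : 0 < r / 2 by rewrite divr_gt0.
have [n0 H] := nu _ r2; exists n0 => // n /= /H; rewrite distrC => le1.
apply: le_lt_trans le1 _; rewrite ltcR ltr_pdivrMr // ltr_pMr //.
by rewrite ltr1n.
Qed.

(** At the point s = 2^-(j+1), if the coefficients before the k-th one vanish,
    then s^k f_k is compensated by the tail of the series, of size at most 2 B
    s^(k+1), and by an error which may be taken smaller than s^(k+1). So f_k is
    bounded by a multiple of s, for every j. *)
Lemma bounded_coef_eq0 (f : nat -> C) (B : R) : (forall k, `|f k| <= B%:C%C) ->
  (forall j : nat, null (fun n => \sum_(k < n) (2^-1 ^+ j.+1) ^+ k * f k)) ->
  forall k, f k = 0.
Proof.
move=> fB nf k; have [n] := ubnP k; elim: n k => // n IHn k; rewrite ltnS => kn.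
apply: null_const => e e0.
have [j0 Hj] := @null_geometric R (1 + (B + B)) e e0.
exists 0%N => _ _; pose s : C := 2^-1 ^+ j0.+1.
have s0 : 0 < s by rewrite exprn_gt0 // invr_gt0.
have sR : s = (2^-1 ^+ j0.+1)%:C%C.
  by rewrite (rmorphXn (real_complex R)) (fmorphV (real_complex R)) (rmorph_nat (real_complex R)).
have t0 : 0 < (2^-1 : R) ^+ j0.+1 ^+ k.+1 by rewrite !exprn_gt0 // invr_gt0.
have [n0 Hn] := nf j0 _ t0.
have := Hn (k.+1 + n0)%N (leq_addl _ _).
rewrite -/s big_split_ord /= big_ord_recr /= big1 ?add0r; last first.
  by move=> i _; rewrite IHn ?mulr0 // (leq_trans (ltn_ord i)).
have tC : (2^-1 ^+ j0.+1 ^+ k.+1 : R)%:C%C = s ^+ k.+1.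
  by rewrite sR (rmorphXn (real_complex R)).
set S := \sum_(i < n0) _; rewrite tC => le1.
have le2 : `|S| <= s ^+ k.+1 * (B + B)%:C%C.
  apply: le_trans (ler_norm_sum _ _ _) _.
  apply: (@le_trans _ _ (s ^+ k.+1 * B%:C%C * \sum_(i < n0) 2^-1 ^+ (0 + i))).
    rewrite mulr_sumr; apply: ler_sum => i _.
    rewrite normrM normrX exprD ger0_norm ?(ltW s0) // add0n.
    rewrite -!mulrA; apply: ler_wpM2l; first by rewrite exprn_ge0 // ltW.
    rewrite mulrC; apply: ler_pM; rewrite ?exprn_ge0 ?(ltW s0) // ?fB //.
    apply: lerXn2r; rewrite ?nnegrE ?invr_ge0 ?(ltW s0) //.
    by rewrite /s exprS ler_piMr ?invr_ge0 // exprn_ile1 ?invr_ge0 // invf_le1 ?ler1n.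
  rewrite -mulrA; apply: ler_wpM2l; first by rewrite exprn_ge0 // ltW.
  rewrite (rmorphD (real_complex R)) -mulr2n -[leRHS]mulr_natr; apply: ler_wpM2l.
    exact: le_trans (normr_ge0 (f 0%N)) (fB _).
  by have := geometric_half R 0 n0; rewrite expr0 mulr1.
apply: le_trans (Hj j0 (leqnn _)).
have : `|s ^+ k * f k| <= s ^+ k.+1 * (1 + (B + B))%:C%C.
  rewrite -[s ^+ k * f k](addrK S); apply: le_trans (ler_normB _ _) _.
  rewrite (rmorphD (real_complex R)) mulrDr rmorph1 mulr1; exact: lerD.
rewrite normrM normrX ger0_norm ?(ltW s0) // exprSr -mulrA ler_pM2l ?exprn_gt0 // => le3.
apply: le_trans le3 _.
have B0 : 0 <= (1 + (B + B))%:C%C :> C.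
  have := le_trans (normr_ge0 (f 0%N)) (fB 0%N); rewrite !lecR => B0.
  by rewrite !addr_ge0.
rewrite normrM [X in _ <= X * _]ger0_norm // mulrC ler_wpM2l //.
rewrite ger0_norm ?exprn_ge0 ?invr_ge0 // /s exprS ler_piMl ?exprn_ge0 ?invr_ge0 //.
by rewrite invf_le1 ?ler1n.
Qed.

Lemma null_bounded_terms (f : nat -> C) : null (fun n => \sum_(k < n) f k) ->
  exists B : R, forall k, `|f k| <= B%:C%C.
Proof.
move=> nf; have [n0 H] := nf 1 ltr01.
exists (2 + \sum_(i < n0) complex.Re `|f i|) => k.
have sum0 : 0 <= \sum_(i < n0) complex.Re `|f i|.
  by apply: sumr_ge0 => i _; exact: cRe_norm_ge0.
have [n0k|kn0] := leqP n0 k.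
  have -> : f k = \sum_(i < k.+1) f i - \sum_(i < k) f i.
    by rewrite big_ord_recr /= addrAC subrr add0r.
  apply: le_trans (ler_normB _ _) _.
  apply: le_trans (lerD (H _ (leq_trans n0k (leqnSn k))) (H _ n0k)) _.
  by rewrite -(rmorphD (real_complex R)) lecR lerDl.
rewrite cRe_norm_le (bigD1 (Ordinal kn0)) //= addrCA lerDl addr_ge0 //.
by apply: sumr_ge0 => i _; exact: cRe_norm_ge0.
Qed.

(** At a real point r inside both discs of convergence the difference of the two
    series converges to 0; its terms r^k e_k are bounded, and evaluation at the
    points r 2^-(j+1) shows that they vanish. *)
Lemma maclaurin_uniq (f : C -> C) (c c' : nat -> C) :
  is_maclaurin f c -> is_maclaurin f c' -> c =1 c'.
Proof.
move=> fc fc'.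
have : \forall q \near (0 : C),
    series (fun k => q ^+ k / k`!%:R * c k) @ \oo --> f q /\
    series (fun k => q ^+ k / k`!%:R * c' k) @ \oo --> f q.
  exact: filterI fc fc'.
move=> /nbhs_ballP[d /= d0 H].
pose e k := (c k - c' k) / k`!%:R.
have [dr dr0 dR] := pos_real d0.
have nulls (q : C) : `|q| < d -> null (fun n => \sum_(k < n) q ^+ k * e k).
  move=> qd; have [] := H q; first by rewrite -ball_normE /= sub0r normrN.
  move=> /cvg_nullP cq /cvg_nullP cq'.
  have cq'N : null (fun n => (-1) * (series (fun k => q ^+ k / k`!%:R * c' k) n - f q)).
    apply: (@nullM R (fun=> -1) _ 1) => // n.
    by rewrite normrN normr1.
  apply: null_ext (nullD cq cq'N) => n.
  rewrite mulN1r opprB addrA subrK /series /= !big_mkord -sumrB.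
  by apply: eq_bigr => k _; rewrite /e; ring.
have r0 : 0 < dr / 2 by rewrite divr_gt0.
pose r : C := (dr / 2)%:C%C.
have rd : `|r| < d.
  rewrite ger0_norm; last by rewrite lecR ltW.
  by rewrite dR ltcR ltr_pdivrMr // ltr_pMr ?ltr1n.
have r_neq0 : r != 0 by rewrite gt_eqF // ltcR.
have [B fB] := @null_bounded_terms (fun k => r ^+ k * e k) (nulls r rd).
have re0 : forall k, r ^+ k * e k = 0.
  apply: (bounded_coef_eq0 fB) => j.
  have sd : `|2^-1 ^+ j.+1 * r| < d.
    rewrite normrM; apply: le_lt_trans rd; rewrite ler_piMl //.
    rewrite ger0_norm ?exprn_ge0 ?invr_ge0 //.
    by rewrite exprn_ile1 ?invr_ge0 // invf_le1 ?ler1n.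
  apply: null_ext (nulls _ sd) => n; apply: eq_bigr => k _.
  by rewrite exprMn -mulrA.
move=> k; apply/eqP; rewrite -subr_eq0; have /eqP := re0 k.
rewrite mulf_eq0 expf_eq0 (negPf r_neq0) andbF /= /e mulf_eq0 invr_eq0.
by rewrite pnatr_eq0 -[k`! == 0%N]negbK -lt0n fact_gt0 orbF.
Qed.

End MaclaurinUniqueness.

(** * The partition function as a series of moments *)

Section PartitionFunctionSeries.
Local Open Scope classical_set_scope.
Variables (R : realType) (N : nat) (mu : probability (unitary R N) R).
Local Notation C := (CC R).
Local Notation UN := (unitary R N).

Let mu2_setT : (mu \x mu)%E [set: UN * UN] = 1%E := probability_setT _.

Lemma bounded_measurable_cexp d (T : measurableType d) (f : T -> C) :
  bounded_measurable f -> bounded_measurable (fun x => cexp (f x)).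
Proof.
move=> [fr fi [B fB]].
have er : measurable_fun [set: T] (fun x => expR (complex.Re (f x))).
  apply: measurableT_comp fr.
  apply: measurable_realfun.continuous_measurable_fun; exact: continuous_expR.
split.
- apply: measurable_realfun.measurable_funM => //.
  apply: measurableT_comp fi.
  apply: measurable_realfun.continuous_measurable_fun; exact: continuous_cos.
- apply: measurable_realfun.measurable_funM => //.
  apply: measurableT_comp fi.
  apply: measurable_realfun.continuous_measurable_fun; exact: continuous_sin.
- exists (expR B) => x; apply: le_trans (norm_cexp_le _) _.
  by rewrite lecR ler_expR -cRe_norm_le.
Qed.

Lemma commutator_trace_bounded : exists2 B : R, 0 <= B &
  forall UV : UN * UN, `|commutator_trace UV| <= B%:C%C.
Proof.
have [_ _ [B H]] := bounded_measurable_traceX R N 1.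
exists B; last by move=> UV; have := H UV; rewrite expr1.
by rewrite -lecR; exact: le_trans (normr_ge0 _) (H point).
Qed.

Lemma trace_moment_bound : exists2 b : R, 1 <= b &
  forall n, `|trace_moment mu n| <= (b ^+ n)%:C%C.
Proof.
have [B B0 HB] := commutator_trace_bounded.
(* the summand 1 ensures b >= 1, and the 2 comes from cintegral_bound *)
pose b : R := 1 + 2 * N%:R * B; have b0 : 0 <= 2 * N%:R * B by rewrite !mulr_ge0.
exists b => [|n]; first by rewrite lerDl.
case: n => [|n]; first by rewrite trace_moment0 normr1 expr0.
apply: (@le_trans _ _ ((2 * N%:R * B) ^+ n.+1)%:C%C); last first.
  by rewrite lecR; apply: lerXn2r; rewrite ?nnegrE ?addr_ge0 // lerDr.
rewrite /trace_moment normrM normrX normr_nat.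
apply: (@le_trans _ _ (N%:R ^+ n.+1 * (B ^+ n.+1 + B ^+ n.+1)%:C%C)).
  apply: ler_wpM2l; first exact: exprn_ge0.
  apply: cintegral_bound => //; first exact: bounded_measurable_traceX.
  move=> UV; rewrite normrX (rmorphXn (real_complex R)).
  by apply: lerXn2r; rewrite ?nnegrE // lecR.
rewrite -(rmorph_nat (real_complex R)) -(rmorphXn (real_complex R)).
rewrite -(rmorphM (real_complex R)) lecR !exprMn -mulr2n -[_ *+ 2]mulr_natl mulrCA mulrA.
rewrite ler_wpM2r ?exprn_ge0 // ler_wpM2r ?exprn_ge0 //.
by rewrite ler_eXnr // ler1n.
Qed.

(** The exponential series converges uniformly on bounded sets, so it may be
    integrated term by term. *)
Lemma KN_moment_poly q :
  null (fun n => (moment_poly (trace_moment mu) n).[q] - KN mu q).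
Proof.
have [B B0 HB] := commutator_trace_bounded.
pose z (UV : UN * UN) : C := q * N%:R * commutator_trace UV.
pose r := complex.Re `|q| * N%:R * B.
have q0 := cRe_norm_ge0 q.
have zr UV : `|z UV| <= r%:C%C.
  rewrite !normrM normr_nat [X in X * _ * _ <= _]normc_real /r.
  rewrite !(rmorphM (real_complex R)) (rmorph_nat (real_complex R)).
  by apply: ler_wpM2l; rewrite // mulr_ge0 // lecR.
have bz : bounded_measurable z.
  apply: bounded_measurableM; first exact: bounded_measurable_cst.
  by have := bounded_measurable_traceX R N 1; under eq_fun do rewrite expr1.
have bpow k : bounded_measurable (fun UV => z UV ^+ k).
  elim: k => [|k IHk].
    by under eq_fun do rewrite expr0; exact: bounded_measurable_cst.
  by under eq_fun do rewrite exprS; exact: bounded_measurableM.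
have bterm k : bounded_measurable (fun UV => k`!%:R^-1 * z UV ^+ k).
  by apply: bounded_measurableM => //; exact: bounded_measurable_cst.
pose S n UV := \sum_(k < n.+1) k`!%:R^-1 * z UV ^+ k.
have bS n : bounded_measurable (S n) by exact: bounded_measurable_sum.
have polyE n : (moment_poly (trace_moment mu) n).[q] = cintegral (mu \x mu)%E (S n).
  rewrite horner_poly /S cintegral_sum //; apply: eq_bigr => k _.
  rewrite cintegralZ // /trace_moment.
  under [X in _ = _ * cintegral _ X]eq_fun do rewrite /z exprMn exprMn.
  rewrite cintegralZ //; last exact: bounded_measurable_traceX.
  by ring.
pose K := 2 * (r * expR r * expR r) : R.
apply: (@null_bound _ _ (fun n => (K + K) * exp_coeff r n)); last first.
  rewrite -[X in _ --> X](mulr0 (K + K)).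
  apply: cvgM; first exact: cvg_cst.
  exact: cvg_series_cvg_0 (is_cvg_series_exp_coeff r).
move=> n; rewrite polyE.
have -> : cintegral (mu \x mu)%E (S n) - KN mu q =
    cintegral (mu \x mu)%E (fun UV => S n UV + -1 * cexp (z UV)).
  rewrite cintegralD //; last first.
    apply: bounded_measurableM; first exact: bounded_measurable_cst.
    exact: bounded_measurable_cexp.
  rewrite cintegralZ //; last exact: bounded_measurable_cexp.
  by rewrite mulN1r.
rewrite mulrDl; apply: cintegral_bound => // [|UV].
  apply: bounded_measurableD => //; apply: bounded_measurableM.
    exact: bounded_measurable_cst.
  exact: bounded_measurable_cexp.
rewrite mulN1r distrC; have := cexp_approx n (zr UV).
rewrite (_ : \sum_(k < n.+1) z UV ^+ k / k`!%:R = S n UV); last first.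
  by apply: eq_bigr => k _; rewrite mulrC.
move=> le1; apply: le_trans le1 _; rewrite lecR /K /exp_coeff /=.
by rewrite le_eqVlt; apply/orP; left; apply/eqP; ring.
Qed.

(** The radius 1 / (12 b) is what the condition 3 b |q| <= 1/4 for summing the
    cumulant series requires. *)
Theorem LN_coef_cumulant d : LN_coef mu d = cumulant (trace_moment mu) d.
Proof.
have [b b1 mb] := trace_moment_bound.
have b_gt0 : 0 < b by exact: lt_le_trans b1.
have mac : is_maclaurin (LN mu) (cumulant (trace_moment mu)).
  have d0 : 0 < (12 * b)^-1 by rewrite invr_gt0 mulr_gt0.
  apply/nbhs_ballP; exists (12 * b)^-1%:C%C => /=; first by rewrite ltcR.
  move=> q; rewrite -ball_normE /= sub0r normrN => qd.
  have q_small : 3 * b%:C%C * `|q| <= 4^-1.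
    apply: (@le_trans _ _ (3 * b%:C%C * (12 * b)^-1%:C%C)).
      by rewrite ler_wpM2l ?ltW // mulr_gt0 // ltcR.
    rewrite -[3](rmorph_nat (real_complex R)) -!(rmorphM (real_complex R)).
    rewrite -[4](rmorph_nat (real_complex R)) -(fmorphV (real_complex R)) lecR.
    rewrite le_eqVlt; apply/orP; left; apply/eqP; field.
    by rewrite gt_eqF.
  have lim := cumulant_series_log (trace_moment0 mu) b1 mb q_small (KN_moment_poly q).
  apply/cvg_nullP => e /lim[n0 Hn]; exists n0.+1 => -[//|n] /Hn.
  by rewrite cumulant_poly_horner /series /= big_mkord.
apply: (maclaurin_uniq _ mac).
exact: (@xgetPex _ (fun=> 0) [set c | is_maclaurin (LN mu) c]) (ex_intro _ _ mac).
Qed.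

End PartitionFunctionSeries.

(** * The genus expansion *)

Lemma connected_factorizations_odd n (a : 'I_n) (A : {set 'I_n}) r : odd r ->
  #|connected_factorizations a A r| = 0%N.
Proof.
move=> r_odd; apply/eqP; rewrite cards_eq0; apply/eqP/setP => t.
by rewrite inE (factorizations_odd A r_odd) !inE.
Qed.

Lemma sum_even (V : zmodType) (F : nat -> V) h : (forall i, odd i -> F i = 0) ->
  \sum_(i < h.*2) F i = \sum_(1 <= g < h.+1) F (2 * g - 2)%N.
Proof.
move=> Fodd; elim: h => [|h IHh]; first by rewrite big_ord0 big_nil.
rewrite doubleS !big_ord_recr /= IHh [RHS]big_nat_recr //= -addrA; congr (_ + _).
rewrite [F h.*2.+1]Fodd ?addr0 /= ?odd_double //; congr (F _).
by rewrite mulnS addKn mul2n.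
Qed.

Lemma genus_power (C : fieldType) (x : C) g : (0 < g)%N -> x != 0 ->
  x ^ (2 - 2 * g%:Z) = (- x^-1) ^+ (2 * g - 2).
Proof.
move=> g0 x0; have even_g : ~~ odd (2 * g - 2) by rewrite oddB ?oddM // leq_pmulr.
rewrite exprNn -signr_odd (negPf even_g) expr0 mul1r exprVn.
have -> : 2 - 2 * g%:Z = - (2 * g - 2)%N%:Z by lia.
by rewrite -exprnN.
Qed.

Section GenusExpansion.
Local Open Scope classical_set_scope.

(** The order 2h - 1 of the expansion in -1/N, the even terms of which are those
    of genus 1, ..., h, leaves an error of order N^(-2h), negligible against
    N^(2 - 2h). *)
Lemma genus_expansion_of_inverse (R : realType) (f : nat -> CC R) (c : nat -> CC R) :
  (forall r, odd r -> c r = 0) -> inverse_expansion f c ->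
  genus_expansion f (fun g => c (2 * g - 2)%N).
Proof.
move=> c_odd fc h h_gt0.
(* h > 0, so that the predecessor is genuine *)
have [K [N0 H]] := fc (h.*2.-1); have hS : h.*2.-1.+1 = h.*2.
  by rewrite prednK // double_gt0.
rewrite hS in H; apply/eqoP => e e0.
have Ke0 : 0 <= `|K| / e by rewrite divr_ge0 // ltW.
have [N1 H1] := complex_archimedean Ke0.
exists (maxn (maxn N0 N1) 1) => // N /=; rewrite !geq_max => /andP[/andP[NN0 NN1] N_gt0].
have N_neq0 : N%:R != 0 :> CC R by rewrite pnatr_eq0 -lt0n.
have x0 : 0 <= (N%:R^-1 : CC R) by rewrite invr_ge0.
have -> : \sum_(1 <= g < h.+1) N%:R ^ (2 - 2 * g%:Z) * c (2 * g - 2)%N =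
    \sum_(i < h.*2) (- N%:R^-1) ^+ i * c i.
  rewrite (@sum_even _ (fun i => (- N%:R^-1) ^+ i * c i)); last first.
    by move=> i /c_odd ->; rewrite mulr0.
  by apply: eq_big_nat => g /andP[g0 _]; rewrite genus_power.
have errN := H N NN0; apply: le_trans (errN) _.
rewrite genus_power // normrX normrN ger0_norm //.
have -> : (h.*2 = (2 * h - 2) + 2)%N by rewrite -mul2n; lia.
rewrite exprD mulrCA [leRHS]mulrC; apply: ler_wpM2l; first exact: exprn_ge0.
have xx : (N%:R^-1 : CC R) ^+ 2 <= N%:R^-1.
  by rewrite expr2 ler_piMl // invf_le1 ?ltr0n // ler1n.
have KN : `|K| / e * N%:R^-1 <= 1.
  by rewrite ler_pdivrMr ?ltr0n // mul1r H1.
apply: (@le_trans _ _ (`|K| * N%:R^-1)).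
  apply: (@le_trans _ _ (`|K| * N%:R^-1 ^+ 2)); last by rewrite ler_wpM2l.
  rewrite ler_wpM2r ?exprn_ge0 //; apply: real_ler_norm.
  have := le_trans (normr_ge0 _) errN.
  rewrite pmulr_lge0 ?exprn_gt0 ?invr_gt0 ?ltr0n //; exact: ger0_real.
by rewrite -[leRHS]mul1r -ler_pdivrMr // mulrAC.
Qed.

End GenusExpansion.

Theorem theorem1p3 (R : realType)
  (mu : forall N : nat, probability (unitary R N) R)
  (mu_haar : forall N : nat, (0 < N)%N -> is_haar (mu N))
  (d : nat) (d_gt0 : (0 < d)%N) :
  genus_expansion (fun N : nat => LN_coef (mu N) d)
    (fun g : nat => (monotone_hurwitz g d)%:R).
Proof.
pose a := Ordinal d_gt0.
have expansion := connected_expansion (fun N => trace_moment0 (mu N))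
  (trace_moment_expansion mu_haar) (finset.in_setT a).
rewrite cardsT card_ord in expansion.
have -> : (fun N => LN_coef (mu N) d) = (fun N => cumulant (trace_moment (mu N)) d).
  by apply/funext => N; exact: LN_coef_cumulant.
have -> : (fun g => (monotone_hurwitz g d)%:R) =
    (fun g => #|connected_factorizations a [set: 'I_d] (2 * g - 2)|%:R) :> (nat -> CC R).
  by apply/funext => g; rewrite /monotone_hurwitz (card_monotone_factorizations _ a).
apply: (@genus_expansion_of_inverse R _
  (fun r => #|connected_factorizations a [set: 'I_d] r|%:R)) expansion => r r_odd.
by rewrite connected_factorizations_odd.
Qed.
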